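(* Let $n\ge 2$, $R_0>0$, $\lambda>0$, and let $\Omega=\{x\in\mathbb{R}^n : |x|>R_0\}$ and $\Omega^\star=\{x\in\mathbb{R}^n : |x|>R_0+4\}$. Let $f$ be a solution of the Helmholtz equation $\Delta f=-\lambda f$ in $\Omega$. If for some real number $p$ with $0<p\le \frac{2n}{n-1}$ one has $$\int_{\Omega^\star}|f|^p\,dx<\infty,$$ then $f\equiv 0$ in $\Omega$.
   Context: $|x|$ is the Euclidean norm on $\mathbb{R}^n$, $\Delta=\sum_{i=1}^n \partial_{x_i}^2$ is the Laplacian, and $dx$ is Lebesgue measure. A solution $f$ of $\Delta f=-\lambda f$ in the open set $\Omega$ is understood in the classical sense: $f$ is a (real- or complex-valued) $C^2$ function on $\Omega$ satisfying the equation pointwise. No condition is imposed on $f$ at the boundary $|x|=R_0$. *)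

(* Defs.v *)
From HB Require Import structures.
From mathcomp Require Import all_boot all_order all_algebra.
From mathcomp Require Import complex.
From mathcomp Require Import all_classical all_reals all_analysis.

Set Implicit Arguments.
Unset Strict Implicit.
Unset Printing Implicit Defensive.

Import Order.TTheory GRing.Theory Num.Theory.
Import numFieldNormedType.Exports.

Local Open Scope classical_set_scope.
Local Open Scope complex_scope.
Local Open Scope ring_scope.

Section EuclideanSpace.
Context {R : realType} {n : nat}.
Implicit Types (x : 'rV[R]_n) (A : set 'rV[R]_n).

(* The norm that the library puts on row vectors is the maximum norm; it induces
   the same topology but is not the norm |x| used to define the domains. *)
Definition enorm x : R := Num.sqrt (\sum_(i < n) x ord0 i ^+ 2).

Definition exterior (r : R) : set 'rV[R]_n := [set x | r < enorm x].

Definition partial (i : 'I_n) (g : 'rV[R]_n -> R) : 'rV[R]_n -> R :=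
  fun x => 'D_(delta_mx ord0 i) g x.

(* 'D_v g x is a junk value where the limit does not exist, hence the explicit
   derivability condition. Meant for open A. *)
Fixpoint Ck_on (k : nat) A (g : 'rV[R]_n -> R) : Prop :=
  (forall x, A x -> {for x, continuous g}) /\
  if k is k'.+1 then
    forall i : 'I_n, (forall x, A x -> derivable g x (delta_mx ord0 i)) /\
                     Ck_on k' A (partial i g)
  else True.

(* R[i] has no normed module structure over R in the library, so complex-valued
   functions are differentiated through their real and imaginary parts;
   real-valued functions are the case complex.Im (f x) = 0. *)
Definition cCk_on (k : nat) A (f : 'rV[R]_n -> R[i]) : Prop :=
  Ck_on k A (fun x => complex.Re (f x)) /\ Ck_on k A (fun x => complex.Im (f x)).

Definition cpartial (i : 'I_n) (f : 'rV[R]_n -> R[i]) : 'rV[R]_n -> R[i] :=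
  fun x => partial i (fun y => complex.Re (f y)) x +i*
           partial i (fun y => complex.Im (f y)) x.

Definition laplacian (f : 'rV[R]_n -> R[i]) : 'rV[R]_n -> R[i] :=
  fun x => \sum_(i < n) cpartial i (cpartial i f) x.

Definition helmholtz_solution A (lambda : R) (f : 'rV[R]_n -> R[i]) : Prop :=
  cCk_on 2 A f /\ forall x, A x -> laplacian f x = - lambda%:C * f x.

End EuclideanSpace.

Section LebesgueMeasure.
Context {R : realType}.
Local Open Scope ereal_scope.

(* R^n as a measurable space: tuples carry the product of the Borel sigma-algebras,
   whereas row vectors carry the topology and have no measurable structure. *)
Definition tupleR (n : nat) := n.-tuple (measurableTypeR R).

HB.instance Definition _ n := Measurable.on (tupleR n).

Definition row_of_tuple (n : nat) (t : tupleR n) : 'rV[R]_n := \row_i tnth t i.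

Definition tuple_cons (n : nat) (p : tupleR n * measurableTypeR R) : tupleR n.+1 :=
  [tuple of p.2 :: p.1].

Lemma measurable_tuple_cons (n : nat) :
  measurable_fun [set: tupleR n * measurableTypeR R] (@tuple_cons n).
Proof. exact: measurable_cons. Qed.

Section lebesgue_step.
Context (n : nat) (mu : {measure set tupleR n -> \bar R}).

Definition lebesgue_step : set (tupleR n.+1) -> \bar R :=
  pushforward (mu \x lebesgue_measure) (@tuple_cons n).

(* The generated name gives the measurability proof to the library instance on
   pushforward, which cannot infer it. *)
HB.instance Definition _ := Measure.copy lebesgue_step
  (measure_function_pushforward__canonical__measure_function_Measure
    (mu \x lebesgue_measure) (@measurable_tuple_cons n)).

End lebesgue_step.

Fixpoint lebesgueN (n : nat) : {measure set tupleR n -> \bar R} :=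
  if n is m.+1 then lebesgue_step (lebesgueN m) else \d_([tuple] : tupleR 0).

Lemma measurable_box (n : nat) (A : 'I_n -> set (measurableTypeR R)) :
  (forall i, measurable (A i)) ->
  measurable [set t : tupleR n | forall i, A i (tnth t i)].
Proof.
move=> mA.
rewrite [X in measurable X](_ : _ = \bigcap_(i in [set: 'I_n])
    ((fun t : tupleR n => tnth t i) @^-1` A i)); last first.
  by apply/seteqP; split => t /= h i; [move=> _; exact: h|exact: h].
apply: fin_bigcap_measurable; first exact: finite_finset.
by move=> i _; rewrite -[X in measurable X]setTI; exact: measurable_tnth.
Qed.

(* This property determines Lebesgue measure on the Borel sets of R^n. *)
Lemma lebesgueN_box (n : nat) (A : 'I_n -> set (measurableTypeR R)) :
  (forall i, measurable (A i)) ->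
  lebesgueN n [set t | forall i, A i (tnth t i)] =
  \big[*%E/1%E]_(i < n) lebesgue_measure (A i).
Proof.
elim: n A => [|n ih] A mA.
  by rewrite big_ord0 /= diracE mem_set// => -[].
rewrite big_ord_recl /= /lebesgue_step /pushforward.
rewrite [X in (_ \x _) X](_ : _ =
    [set t : tupleR n | forall i, A (lift ord0 i) (tnth t i)] `*` A ord0); last first.
  apply/seteqP; split => -[t x] /=.
    move=> h; split; last exact: (h ord0).
    by move=> i; move: (h (lift ord0 i)); rewrite /tuple_cons /= tnthS.
  move=> [h h0] i; case: (unliftP ord0 i) => [j ->|->]; last exact: h0.
  by rewrite /tuple_cons /= tnthS.
rewrite product_measure1E//; last first.
  by apply: (@measurable_box n (fun i => A (lift ord0 i))).
by rewrite (ih (fun i => A (lift ord0 i)))// muleC.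
Qed.

End LebesgueMeasure.

(* Main.v *)
(* For a fixed vector y consider the moments T_k(phi) = int f (y.x)^k phi(|x|) dx,
   with phi compactly supported in ]R0, +oo[.  Since
   Lap ((y.x)^k phi(|x|)) = (y.x)^k (phi'' + (n-1+2k)/r phi')
                            + k (k-1) |y|^2 (y.x)^(k-2) phi,
   Green's identity shows, by induction on k, that T_k is a weak solution of a
   radial equation, which reads S (psi'' + lambda psi - b psi / r^2) = 0 for
   S (psi) = T_k (r^(-(n-1)/2-k) psi).  To evaluate S (g), solve psi'' + lambda psi = g
   by Duhamel's formula from the left of the support of g and cut psi off at
   radius R.  The p-integrability of f gives int_{R<|x|<4R} |f| |x|^(-(n-1)/2) = o(R),
   exactly what is needed for the cut-off error to vanish as R -> oo, so that
   S (g) = S (b psi / r^2); iterating, the right-hand side tends to 0.  Hence all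
   T_k vanish.  As 1 - |x-y|^2/Q is a polynomial in y.x with radial coefficients,
   f is orthogonal to all its powers, which concentrate at x = y (Landau kernels),
   and f (y) = 0.  This argument never needs unique continuation.
   The estimate int |f| |x|^(-(n-1)/2) = o(R) follows from Young's inequality if p >= 1;
   if p < 1, f is first shown to be bounded near infinity, through the mean value
   property and a weighted maximum argument. *)
Require Import Defs.
From HB Require Import structures.
From mathcomp Require Import all_boot all_order all_algebra.
From mathcomp Require Import complex.
From mathcomp Require Import all_classical all_reals all_analysis.
From mathcomp Require Import measurable_realfun ring lra.

Import Order.TTheory GRing.Theory Num.Theory.
Import numFieldNormedType.Exports.

Set Implicit Arguments.
Unset Strict Implicit.
Unset Printing Implicit Defensive.

Local Open Scope classical_set_scope.
Local Open Scope ring_scope.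

(** * Lebesgue measure and the topology of row vectors *)

Section Measurability.
Context {R : realType}.

(** The proof is kept free of surface integrals, spherical means and spherical harmonics: every
    integral runs over the whole space and has a continuous, compactly supported integrand. The
    solution, controlled on the exterior domain alone, is always multiplied by a test function that
    vanishes near every other point. Powers of a single linear form [y.x], with arbitrary [y], take
    over the role of the spherical harmonics. The obstacle to iterating Duhamel's formula is that
    the potential [b / r^2] decays at infinity but need not be small near [R0], so a single step
    need not contract in a plain supremum norm. Sources are therefore measured against
    [r^-2 exp (-kap/r)], a weight with an explicit primitive: integrating gains [1/kap], multiplying
    by [b / r^2] restores the weight, and a large [kap] makes each step halve the constant. The
    solution of the one-dimensional equation stays bounded with its derivative, so cutting it off at
    radius [R] leaves an error of order [1/R] carried by a shell of radius [R]. *)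

Lemma measurable_preimage_row_of_tuple (n : nat) (A : set 'rV[R]_n) :
  open A -> measurable ((@row_of_tuple R n) @^-1` A).
Proof.
move=> oA.
(* Row vectors carry the topology and tuples the sigma-algebra; rational boxes link the two, an open
   set being the countable union of the rational boxes that it contains. *)
pose box (qm : 'rV[rat]_n * nat) : set (tupleR n) :=
  [set t | forall i, ball (ratr (qm.1 ord0 i) : R) (qm.2.+1%:R^-1) (tnth t i)].
have -> : (@row_of_tuple R n) @^-1` A = \bigcup_(qm in
   [set qm | forall t : tupleR n, box qm t -> A (row_of_tuple t)]) box qm.
  apply/seteqP; split => [t /= At|t [qm /= + qmt]]; last exact.
  have /nbhs_ballP[e /= e0 eA] : nbhs (row_of_tuple t) A.
    by rewrite nbhsE; exists A.
  (* Half of [e], because two points of a box of radius [1/(m+1)] are only known to be within twice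
     that radius. *)
  have [m em] : exists m, m.+1%:R^-1 < e / 2 :> R.
    have [m _ /(_ m (leqnn m))] :=
      near_infty_natSinv_lt (PosNum (divr_gt0 e0 (ltr0Sn R 1))).
    by exists m.
  have /choice[q hq] (i : 'I_n) : exists q : rat, `|(ratr q : R) - tnth t i| < m.+1%:R^-1.
    have m0 : 0 < m.+1%:R^-1 :> R by rewrite invr_gt0 ltr0Sn.
    have /rat_in_itvoo[q] : tnth t i - m.+1%:R^-1 < tnth t i + m.+1%:R^-1.
      by rewrite ltrBlDr -addrA ltrDl addr_gt0.
    by rewrite in_itv/= => /andP[q1 q2]; exists q; rewrite ltr_distl; apply/andP.
  exists (\row_i q i, m) => /=.
    move=> s hs; apply: eA; split => // i j; rewrite !mxE /ball /=.
    have /= := hs j; rewrite mxE /ball /= => hsj.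
    have := hq j => hqj.
    have -> : tnth t j - tnth s j =
       (ratr (q j) - tnth s j) - (ratr (q j) - tnth t j) by ring.
    rewrite [e]splitr; apply: le_lt_trans (ler_normB _ _) _.
    by apply: ltrD; [exact: lt_trans hsj em|exact: lt_trans hqj em]. 
  by move=> i; rewrite /= mxE /ball /=.
rewrite bigcup_mkcond; apply: countable_bigcupT_measurable => [|qm].
  exact: countableP.
case: ifP => // _; apply: (measurable_box (A := fun i => ball (ratr (qm.1 ord0 i) : R)
  (qm.2.+1%:R^-1))).
by move=> i; rewrite ball_itv; exact: measurable_itv.
Qed.

Lemma measurable_fun_continuous_row (n : nat) (A : set 'rV[R]_n)
    (F : 'rV[R]_n -> R) :
  open A -> (forall x, A x -> {for x, continuous F}) ->
  measurable_fun ((@row_of_tuple R n) @^-1` A) (F \o @row_of_tuple R n).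
Proof.
move=> oA cF mA; apply: (measurability _ (RGenOpens.measurableE R)) => //.
move=> _ [_ [a [b ->] <-]].
rewrite (_ : _ `&` _ = (@row_of_tuple R n) @^-1` (A `&` F @^-1` `]a, b[)) //.
apply: measurable_preimage_row_of_tuple.
rewrite openE => x [Ax Fx]; rewrite /interior.
apply: filterI; first exact: open_nbhs_nbhs.
by apply: cF => //; apply: open_nbhs_nbhs; split => //; exact: interval_open.
Qed.

Lemma sigma_finite_lebesgueN (n : nat) : sigma_finite setT (@lebesgueN R n).
Proof.
exists (fun k => [set t : tupleR n | forall i, `[- k%:R, k%:R]%classic (tnth t i)]).
  apply/seteqP; split => // t _.
  exists (Num.truncn (\sum_i `|tnth t i|)).+1 => // i; rewrite /= in_itv/= -ler_norml.
  apply: le_trans (ltW (truncnS_gt _)).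
  by rewrite (bigD1 i)//= lerDl sumr_ge0.
move=> k; split.
  by apply: (measurable_box (A := fun=> _)) => i; exact: measurable_itv.
rewrite (lebesgueN_box (A := fun=> _)); last by move=> i; exact: measurable_itv.
suff /fin_numP[_ /eqP] : \big[*%E/1%E]_(i < n)
    lebesgue_measure `[- k%:R, k%:R]%classic \is a @fin_num R by rewrite ltey => /eqP.
elim/big_ind : _ => //; first by move=> x y; exact: fin_numM.
by move=> i _; rewrite lebesgue_measure_itv/=; case: ifP.
Qed.

End Measurability.

(** * Integrals of continuous functions of compact support *)

Section Integral.
Context {R : realType}.

(** The integrands of [intN] are kept in this class, where integrability is automatic and [intN] is
    linear and monotone. *)
Definition ccont (n : nat) (F : 'rV[R]_n -> R) : Prop :=
  continuous F /\ exists M, forall x, M < `|x| -> F x = 0.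

Definition intN (n : nat) (F : 'rV[R]_n -> R) : R :=
  \int[lebesgueN n]_t F (row_of_tuple t).

(** The closed ball about [a] for the maximum norm, seen in tuples: a ball whose volume is
    explicit. *)
Definition box (n : nat) (a : 'rV[R]_n) (r : R) : set (tupleR n) :=
  [set t | forall i, `[a ord0 i - r, a ord0 i + r]%classic (tnth t i)].

Lemma mx_norm_leP (n : nat) (x : 'rV[R]_n) (M : R) : 0 <= M ->
  reflect (forall i, `|x ord0 i| <= M) (`|x| <= M).
Proof.
move=> M0; rewrite [X in reflect _ (X <= _)](_ : _ =
  \big[Num.max/0]_i `|x i.1 i.2|); last by rewrite {1}/Num.norm/= mx_normrE.
apply: (iffP idP) => [/bigmax_leP[_ h] i|h]; last apply/bigmax_leP.
  exact: (h (ord0, i)).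
split=> [//|[i j] _ /=]; rewrite ord1; exact: h.
Qed.

Lemma measurable_cbox (n : nat) (a : 'rV[R]_n) (r : R) : measurable (box a r).
Proof.
apply: (measurable_box (A := fun i => `[a ord0 i - r, a ord0 i + r]%classic)).
by move=> i; exact: measurable_itv.
Qed.

Lemma lebesgueN_cbox (n : nat) (a : 'rV[R]_n) (r : R) : 0 <= r ->
  lebesgueN n (box a r) = ((2 * r) ^+ n)%:E.
Proof.
move=> r0; rewrite /box (lebesgueN_box
  (A := fun i => `[a ord0 i - r, a ord0 i + r]%classic)); last first.
  by move=> i; exact: measurable_itv.
under eq_bigr => i _.
  rewrite lebesgue_measure_itv/= lte_fin.
  rewrite (_ : (if _ then _ else _) = (2 * r)%:E); last first.
    case: ifPn => [_|]; first by rewrite -EFinB; congr (_%:E); ring.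
    by rewrite -leNgt => h; congr (_%:E); lra.
  over.
rewrite prodEFin; congr (_%:E).
by rewrite prodr_const card_ord.
Qed.

Lemma row_of_tuple_box (n : nat) (t : tupleR n) (a : 'rV[R]_n) (r : R) :
  0 <= r -> (box a r t <-> `|row_of_tuple t - a| <= r).
Proof.
move=> r0; split.
  move=> h; apply/mx_norm_leP => // i; rewrite !mxE.
  by have := h i; rewrite /= in_itv/= => /andP[h1 h2]; rewrite ler_norml; apply/andP; split;
    lra.
move=> /(mx_norm_leP _ r0) h i; have := h i; rewrite !mxE ler_norml => /andP[h1 h2].
by rewrite /= in_itv/=; apply/andP; split; lra.
Qed.

Lemma measurable_cont (n : nat) (F : 'rV[R]_n -> R) : continuous F ->
  measurable_fun setT (fun t => F (@row_of_tuple R n t)).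
Proof.
move=> cF; rewrite -(preimage_setT (@row_of_tuple R n)).
by apply: measurable_fun_continuous_row => [|x _]; [exact: openT|exact: cF].
Qed.

Lemma compact_norm_le (n : nat) (M : R) : compact [set x : 'rV[R]_n | `|x| <= M].
Proof.
apply: bounded_closed_compact.
  by exists M; split; [exact: num_real|move=> N MN x /= xM; exact: le_trans xM (ltW MN)].
apply: (@preimage_closed _ _ (fun x : 'rV[R]_n => `|x|) [set y | y <= M]).
  by move=> x _; exact: norm_continuous.
exact: closed_le.
Qed.

Lemma ccont_bounded (n : nat) (F : 'rV[R]_n -> R) : ccont F ->
  exists2 C, 0 <= C & forall x, `|F x| <= C.
Proof.
move=> [cF [M MF]].
have [|||c _ hc] := @EVT_max_rV R n (fun x => `|F x|) [set x | `|x| <= Num.max M 0].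
- by exists 0; rewrite /= normr0 le_max lexx orbT.
- exact: compact_norm_le.
- apply: continuous_subspaceT => x; apply: continuous_comp; first exact: cF.
  exact: norm_continuous.
exists `|F c| => // x.
have [xM|xM] := leP `|x| (Num.max M 0); first by apply: hc; rewrite inE.
by rewrite MF ?normr0//; apply: le_lt_trans xM; rewrite le_max lexx.
Qed.

Lemma ccont_integrable (n : nat) (F : 'rV[R]_n -> R) : ccont F ->
  (lebesgueN n).-integrable setT (fun t => (F (row_of_tuple t))%:E).
Proof.
move=> ccF; have [C C0 FC] := ccont_bounded ccF; have [cF [M MF]] := ccF.
have M0 : 0 <= Num.max M 0 by rewrite le_max lexx orbT.
apply: (@le_integrable _ _ _ _ _ measurableT _
   (fun t => (C * \1_(box 0 (Num.max M 0)) t)%:E)).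
- by apply/measurable_EFinP; exact: measurable_cont.
- move=> t _; rewrite !abse_EFin lee_fin indicE.
  have [|tM] := boolP (t \in box 0 (Num.max M 0)).
    by rewrite mulr1 (ger0_norm C0).
  rewrite mulr0 normr0 MF ?normr0//.
  have : ~ (box 0 (Num.max M 0) t) by move/mem_set; exact/negP.
  rewrite row_of_tuple_box// subr0 => /negP; rewrite -ltNge.
  by apply: le_lt_trans; rewrite le_max lexx.
- under eq_fun do rewrite EFinM.
  apply: integrableZl => //.
  apply/integrableP; split.
    by apply/measurable_EFinP; apply: measurable_indic; exact: measurable_cbox.
  under eq_integral do rewrite gee0_abs ?lee_fin//.
  rewrite integral_indic ?setIT//; last exact: measurable_cbox.
  by have /= := lebesgueN_cbox (0 : 'rV[R]_n) M0; rewrite /box => ->; rewrite ltry.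
Qed.

Lemma ccontD (n : nat) (F G : 'rV[R]_n -> R) : ccont F -> ccont G -> ccont (fun x => F x + G x).
Proof.
move=> [cF [M MF]] [cG [N NG]]; split; first by move=> x; exact: (cvgD (cF x) (cG x)).
exists (Num.max M N) => x; rewrite gt_max => /andP[xM xN].
by rewrite MF// NG// addr0.
Qed.

Lemma ccontMl (n : nat) (F G : 'rV[R]_n -> R) : continuous F -> ccont G -> ccont (fun x => F
  x * G x).
Proof.
move=> cF [cG [N NG]]; split; first by move=> x; exact: (cvgM (cF x) (cG x)).
by exists N => x xN; rewrite NG// mulr0.
Qed.

Lemma ccontMr (n : nat) (F G : 'rV[R]_n -> R) : ccont F -> continuous G -> ccont (fun x => F
  x * G x).
Proof.
by move=> cF cG; under eq_fun do rewrite mulrC; exact: ccontMl.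
Qed.

Lemma ccontZ (n : nat) (c : R) (F : 'rV[R]_n -> R) : ccont F -> ccont (fun x => c * F x).
Proof. by move=> cF; apply: (@ccontMl _ (fun=> c)) => //; exact: cst_continuous. Qed.

Lemma ccontN (n : nat) (F : 'rV[R]_n -> R) : ccont F -> ccont (fun x => - F x).
Proof. by move=> cF; under eq_fun do rewrite -mulN1r; exact: ccontZ. Qed.

Lemma ccontB (n : nat) (F G : 'rV[R]_n -> R) : ccont F -> ccont G -> ccont (fun x => F x - G x).
Proof. by move=> cF cG; apply: ccontD => //; exact: ccontN. Qed.

Lemma ccont_norm (n : nat) (F : 'rV[R]_n -> R) : ccont F -> ccont (fun x => `|F x|).
Proof.
move=> [cF [M MF]]; split.
  by move=> x; apply: continuous_comp; [exact: cF|exact: norm_continuous].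
by exists M => x xM; rewrite MF// normr0.
Qed.

Lemma intND (n : nat) (F G : 'rV[R]_n -> R) : ccont F -> ccont G ->
  intN (fun x => F x + G x) = intN F + intN G.
Proof. by move=> cF cG; rewrite /intN RintegralD//; exact: ccont_integrable. Qed.

Lemma intNB (n : nat) (F G : 'rV[R]_n -> R) : ccont F -> ccont G ->
  intN (fun x => F x - G x) = intN F - intN G.
Proof. by move=> cF cG; rewrite /intN RintegralB//; exact: ccont_integrable. Qed.

Lemma intNZ (n : nat) (c : R) (F : 'rV[R]_n -> R) : ccont F ->
  intN (fun x => c * F x) = c * intN F.
Proof.
move=> cF.
by rewrite /intN (RintegralZl (f := fun t => F (row_of_tuple t)))//; exact: ccont_integrable.
Qed.

Lemma intN0 (n : nat) : intN (fun _ : 'rV[R]_n => 0) = 0.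
Proof. by rewrite /intN /Rintegral integral0. Qed.

Lemma ccont0 (n : nat) : ccont (fun _ : 'rV[R]_n => 0).
Proof. by split; [exact: cst_continuous|exists 0]. Qed.

Lemma ccont_sum (n m : nat) (F : 'I_m -> 'rV[R]_n -> R) : (forall i, ccont (F i)) ->
  ccont (fun x => \sum_i F i x).
Proof.
elim: m F => [|m ih] F cF; first by under eq_fun do rewrite big_ord0; exact: ccont0.
under eq_fun do rewrite big_ord_recl.
by apply: ccontD => //; apply: ih.
Qed.

Lemma intN_sum (n m : nat) (F : 'I_m -> 'rV[R]_n -> R) : (forall i, ccont (F i)) ->
  intN (fun x => \sum_i F i x) = \sum_i intN (F i).
Proof.
elim: m F => [|m ih] F cF.
  by rewrite big_ord0; under eq_fun do rewrite big_ord0; exact: intN0.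
under eq_fun do rewrite big_ord_recl.
by rewrite intND ?big_ord_recl ?ih//; exact: ccont_sum.
Qed.

Lemma intN_le (n : nat) (F G : 'rV[R]_n -> R) : ccont F -> ccont G ->
  (forall x, F x <= G x) -> intN F <= intN G.
Proof.
move=> cF cG FG; rewrite /intN.
by apply: (le_Rintegral (f1 := fun t => F (row_of_tuple t))
  (f2 := fun t => G (row_of_tuple t))) => //; exact: ccont_integrable.
Qed.

Lemma intN_ge0 (n : nat) (F : 'rV[R]_n -> R) : (forall x, 0 <= F x) -> 0 <= intN F.
Proof. by move=> F0; apply: Rintegral_ge0. Qed.

Lemma le_normr_intN (n : nat) (F G : 'rV[R]_n -> R) : ccont F -> ccont G ->
  (forall x, `|F x| <= G x) -> `|intN F| <= intN G.
Proof.
move=> cF cG FG; rewrite ler_norml; apply/andP; split.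
  rewrite -mulN1r -intNZ//; apply: intN_le => //; first exact: ccontZ.
  by move=> x; rewrite mulN1r; have := FG x; rewrite ler_norml => /andP[].
by apply: intN_le => // x; exact: le_trans (ler_norm _) (FG x).
Qed.

Lemma Rintegral_indic_box (n : nat) (c : R) (a : 'rV[R]_n) (r : R) : 0 <= r ->
  (lebesgueN n).-integrable setT (fun t => (c * \1_(box a r) t)%:E) /\
  \int[lebesgueN n]_t (c * \1_(box a r) t) = c * (2 * r) ^+ n.
Proof.
move=> r0.
have I1 : (lebesgueN n).-integrable setT (fun t => (\1_(box a r) t)%:E).
  apply/integrableP; split.
    by apply/measurable_EFinP; apply: measurable_indic; exact: measurable_cbox.
  under eq_integral do rewrite gee0_abs ?lee_fin//.
  rewrite integral_indic ?setIT//; last exact: measurable_cbox.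
  by rewrite lebesgueN_cbox// ltry.
split.
  by under eq_fun do rewrite EFinM; apply: integrableZl.
rewrite RintegralZl//; congr (_ * _).
rewrite /Rintegral integral_indic ?setIT//; last exact: measurable_cbox.
by rewrite lebesgueN_cbox.
Qed.

Lemma intN_box_upper (n : nat) (F : 'rV[R]_n -> R) (c r : R) (a : 'rV[R]_n) :
  ccont F -> 0 <= c -> 0 <= r -> (forall x, `|F x| <= c) ->
  (forall x, r < `|x - a| -> F x = 0) -> `|intN F| <= c * (2 * r) ^+ n.
Proof.
move=> cF c0 r0 Fc F0.
apply: le_trans (_ : intN (fun x => `|F x|) <= _).
  by apply: le_normr_intN => //; exact: ccont_norm.
have [I1 <-] := Rintegral_indic_box c a r0.
apply: (le_Rintegral (f1 := fun t => `|F (row_of_tuple t)|)) => //.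
  exact: (ccont_integrable (ccont_norm cF)).
move=> t _; rewrite indicE.
have [|tb] := boolP (t \in box a r); first by rewrite mulr1.
rewrite mulr0 F0 ?normr0// ltNge; apply/negP => /row_of_tuple_box.
by move=> /(_ r0)/mem_set; exact/negP.
Qed.

Lemma intN_box_lower (n : nat) (F : 'rV[R]_n -> R) (c r : R) (a : 'rV[R]_n) :
  ccont F -> 0 <= c -> 0 <= r -> (forall x, 0 <= F x) ->
  (forall x, `|x - a| <= r -> c <= F x) -> c * (2 * r) ^+ n <= intN F.
Proof.
move=> cF c0 r0 F0 Fc.
have [I1 <-] := Rintegral_indic_box c a r0.
apply: (le_Rintegral (f2 := fun t => F (row_of_tuple t))) => //.
  exact: (ccont_integrable cF).
move=> t _; rewrite indicE.
have [|tb] := boolP (t \in box a r); last by rewrite mulr0.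
by rewrite mulr1 => /set_mem/row_of_tuple_box; move=> /(_ r0) /Fc.
Qed.

End Integral.

(** * Fubini and integration by parts *)

Section Parts.
Context {R : realType}.

(** A separate name for [lebesgueN], to carry the sigma-finiteness instance that Fubini's theorem
    asks for. *)
Definition lebN (n : nat) : set (tupleR n) -> \bar R := @lebesgueN R n.

HB.instance Definition _ n := Measure.copy (@lebN n) (@lebesgueN R n).

HB.instance Definition _ n := @Measure_isSigmaFinite.Build _ _ _ (@lebN n)
  (@sigma_finite_lebesgueN R n).

Lemma integral_derive_compact (f f' : R -> R) (M : R) :
  (forall s : R, is_derive s 1 f (f' s)) -> continuous f' ->
  (forall s, M < `|s| -> f s = 0) -> (forall s, M < `|s| -> f' s = 0) ->
  (\int[lebesgue_measure]_s (f' s)%:E = 0)%E.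
Proof.
move=> ff' cf' f0 f'0.
pose N := `|M| + 1.
have N0 : 0 < N by rewrite /N ltr_wpDl.
have MN : M < `|N|.
  by rewrite gtr0_norm// /N; apply: le_lt_trans (ler_norm _) _; rewrite ltrDl.
have cf : continuous f.
  move=> s; apply: differentiable_continuous; apply/derivable1_diffP.
  by have [] := ff' s.
rewrite (_ : (fun s => (f' s)%:E) = (fun s => (f' s)%:E) \_ `[-N, N]%classic); last first.
  apply/funext => s; rewrite patchE; case: ifPn => // /negP sN.
  rewrite f'0//; rewrite ltNge; apply/negP => sM; apply: sN; rewrite inE/= in_itv/=.
  rewrite -ler_norml; apply: le_trans sM _; rewrite /N.
  by apply: le_trans (ler_norm _) _; rewrite lerDl.
rewrite -integral_mkcond (@continuous_FTC2 _ f' f)//.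
- by rewrite f0// f0 ?normrN// sube0.
- by rewrite gtrN.
- exact: continuous_subspaceT.
- split.
  + by move=> x _; have [] := ff' x.
  + by apply: cvg_at_right_filter; exact: cf.
  + by apply: cvg_at_left_filter; exact: cf.
- by move=> x _; rewrite derive1E; have [] := ff' x.
Qed.

(** Counterpart on row vectors of [tuple_cons], through which Fubini's theorem is read. *)
Definition row_cons (n : nat) (s : R) (x : 'rV[R]_n) : 'rV[R]_n.+1 :=
  \row_i oapp (x ord0) s (unlift ord0 i).

Lemma row_of_tuple_cons (n : nat) (p : tupleR n * measurableTypeR R) :
  row_of_tuple (tuple_cons p) = row_cons p.2 (row_of_tuple p.1).
Proof.
apply/rowP => i; rewrite !mxE; case: unliftP => [j ->|->] /=.
  by rewrite mxE tnthS.
by rewrite tnth0.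
Qed.

Lemma row_cons_le (n : nat) (s : R) (x : 'rV[R]_n) (M : R) : 0 <= M ->
  (`|row_cons s x| <= M) = (`|s| <= M) && (`|x| <= M).
Proof.
move=> M0; apply/idP/idP.
  move=> /(mx_norm_leP _ M0) h; apply/andP; split.
    by have := h ord0; rewrite mxE unlift_none.
  by apply/mx_norm_leP => // i; have := h (lift ord0 i); rewrite mxE liftK.
move=> /andP[sM /(mx_norm_leP _ M0) xM]; apply/mx_norm_leP => // i; rewrite mxE.
by case: unliftP => [j|] _ //=.
Qed.

Lemma row_consB (n : nat) (s t : R) (x y : 'rV[R]_n) :
  row_cons s x - row_cons t y = row_cons (s - t) (x - y).
Proof. by apply/rowP => i; rewrite !mxE; case: unliftP => [j|] _ //=; rewrite !mxE. Qed.

Lemma row_consD (n : nat) (s t : R) (x y : 'rV[R]_n) :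
  row_cons s x + row_cons t y = row_cons (s + t) (x + y).
Proof. by apply/rowP => i; rewrite !mxE; case: unliftP => [j|] _ //=; rewrite !mxE. Qed.

Lemma continuous_lip (V W : normedModType R) (k : V -> W) :
  (forall x y, `|k x - k y| <= `|x - y|) -> continuous k.
Proof.
move=> kl x; apply/cvgrPdist_le => e e0; near=> y.
apply: le_trans (kl _ _) _.
by near: y; apply: cvgr_dist_le.
Unshelve. all: by end_near. Qed.

Lemma row_cons_continuous_r (n : nat) (s : R) : continuous (@row_cons n s).
Proof.
apply: continuous_lip => x y.
by rewrite row_consB subrr row_cons_le// normr0 normr_ge0 lexx.
Qed.

Lemma row_cons_continuous_l (n : nat) (x : 'rV[R]_n) : continuous (fun s => row_cons s x).
Proof.
apply: (@continuous_lip R^o) => s t.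
by rewrite row_consB subrr row_cons_le// normr0 normr_ge0 lexx.
Qed.

Lemma row_cons_delta0 (n : nat) (h : R) : h *: delta_mx ord0 ord0 = row_cons h (0 : 'rV[R]_n).
Proof.
apply/rowP => i; rewrite !mxE eqxx /=; case: unliftP => [j ->|->] /=.
  by rewrite mxE mulr0.
by rewrite mulr1.
Qed.

Lemma row_cons_deltaS (n : nat) (h : R) (j : 'I_n) :
  h *: delta_mx ord0 (lift ord0 j) = row_cons 0 (h *: delta_mx ord0 j : 'rV[R]_n).
Proof.
apply/rowP => i; rewrite !mxE eqxx /=; case: unliftP => [k ->|->] /=.
  by rewrite !mxE eqxx /= (inj_eq lift_inj).
by rewrite mulr0.
Qed.

(** The two difference quotients are the same function of [h]. A chain rule through the total
    derivative would ask for more than a directional derivative. *)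
Lemma is_derive_along (n m : nat) (g : 'rV[R]_n -> R) (k : 'rV[R]_m -> 'rV[R]_n) x v w d :
  (forall h, k (x + h *: v) = k x + h *: w) ->
  is_derive (k x) w g d -> is_derive x v (g \o k) d.
Proof.
move=> kE [dg gE].
have E : (fun h : R => h^-1 *: (((g \o k) \o shift x) (h *: v) - (g \o k) x)) =
         (fun h : R => h^-1 *: ((g \o shift (k x)) (h *: w) - g (k x))).
  by apply/funext => h; rewrite /= [_ + x]addrC kE [_ + k x]addrC.
by split; [rewrite /derivable E|rewrite /derive E].
Qed.

Lemma is_derive_along1 (n : nat) (g : 'rV[R]_n -> R) (k : R -> 'rV[R]_n) (s : R) w d :
  (forall h, k (s + h) = k s + h *: w) ->
  is_derive (k s) w g d -> is_derive s 1 (g \o k) d.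
Proof.
move=> kE [dg gE].
have E : (fun h : R => h^-1 *: (((g \o k) \o shift s) (h *: 1) - (g \o k) s)) =
         (fun h : R => h^-1 *: ((g \o shift (k s)) (h *: w) - g (k s))).
  by apply/funext => h; rewrite /= -[h *: 1]/(h * 1) mulr1 [_ + s]addrC kE [_ + k s]addrC.
by split; [rewrite /derivable E|rewrite /derive E].
Qed.

Lemma ccont_row_cons (n : nat) (F : 'rV[R]_n.+1 -> R) (s : R) : ccont F ->
  ccont (fun x : 'rV[R]_n => F (row_cons s x)).
Proof.
move=> [cF [M MF]]; split.
  by move=> x; apply: continuous_comp; [exact: row_cons_continuous_r|exact: cF].
exists `|M| => x xM; apply: MF; apply: le_lt_trans (ler_norm M) _.
by rewrite ltNge row_cons_le// negb_and -!ltNge xM orbT.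
Qed.

(** Both orders serve in [intN_derive0]: the first coordinate is integrated innermost when the
    derivative is along it, outermost when the derivative is along another one and the dimension is
    lowered. *)
Lemma integral_lebesgueNS (n : nat) (F : 'rV[R]_n.+1 -> R) : ccont F ->
  (\int[lebesgueN n.+1]_t (F (row_of_tuple t))%:E =
   \int[lebesgueN n]_t \int[lebesgue_measure]_s (F (row_cons s (row_of_tuple t)))%:E)%E /\
  (\int[lebesgueN n.+1]_t (F (row_of_tuple t))%:E =
   \int[lebesgue_measure]_s \int[lebesgueN n]_t (F (row_cons s (row_of_tuple t)))%:E)%E.
Proof.
move=> ccF.
pose mu : {sigma_finite_measure set (tupleR n) -> \bar R} := @lebN n.
have mf : measurable_fun setT (fun t : tupleR n.+1 => (F (row_of_tuple t))%:E).
  by apply/measurable_EFinP; apply: measurable_cont; case: ccF.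
have intf : (mu \x lebesgue_measure)%E.-integrable setT
    ((fun t : tupleR n.+1 => (F (row_of_tuple t))%:E) \o @tuple_cons R n).
  apply/integrableP; split.
    by apply: measurableT_comp => //; exact: measurable_tuple_cons.
  have /integrableP[_] := ccont_integrable ccF.
  rewrite [X in (X < _)%E -> _](_ : _ = (\int[pushforward (mu \x lebesgue_measure)%E
    (@tuple_cons R n)]_t `|(F (row_of_tuple t))%:E|)%E)//.
  rewrite ge0_integral_pushforward//.
    exact: measurable_tuple_cons.
  by apply: measurableT_comp.
have E : (\int[lebesgueN n.+1]_t (F (row_of_tuple t))%:E =
  \int[mu \x lebesgue_measure]_p (F (row_cons p.2 (row_of_tuple p.1)))%:E)%E.
  transitivity (\int[pushforward (mu \x lebesgue_measure)%E
    (@tuple_cons R n)]_t (F (row_of_tuple t))%:E)%E => //.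
  rewrite integral_pushforward//.
    by rewrite preimage_setT; apply: eq_integral => p _ /=; rewrite row_of_tuple_cons.
  exact: measurable_tuple_cons.
have intf' : (mu \x lebesgue_measure)%E.-integrable setT
    (fun p => (F (row_cons p.2 (row_of_tuple p.1)))%:E).
  by move: intf; congr integrable; apply/funext => p /=; rewrite row_of_tuple_cons.
split.
  by rewrite E -(integral12_prod_meas1 intf').
by rewrite E -(integral21_prod_meas1 intf').
Qed.

Lemma intN_derive0 (n : nat) (i : 'I_n) (g dg : 'rV[R]_n -> R) :
  (forall x, is_derive x (delta_mx ord0 i) g (dg x)) ->
  ccont g -> ccont dg -> intN dg = 0.
Proof.
rewrite /intN /Rintegral => gdg cg cdg.
suff -> : (\int[lebesgueN n]_t (dg (row_of_tuple t))%:E = 0)%E by [].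
elim: n i g dg gdg cg cdg => [[] //|n ih] i g dg gdg cg cdg.
case: (unliftP ord0 i) => [j|] ij; rewrite {}ij in gdg.
  have [_ ->] := integral_lebesgueNS cdg.
  rewrite integral0_eq// => s _.
  apply: (ih j (fun x => g (row_cons s x)) (fun x => dg (row_cons s x))).
  - move=> x; apply: is_derive_along (gdg _) => h.
    by rewrite row_cons_deltaS row_consD addr0.
  - exact: ccont_row_cons.
  - exact: ccont_row_cons.
have [-> _] := integral_lebesgueNS cdg.
rewrite integral0_eq// => t _.
have [[_ [M MF]] [cF [N NF]]] := (cg, cdg).
apply: (@integral_derive_compact (fun s => g (row_cons s (row_of_tuple t))) _ (Num.max `|M|
  `|N|)).
- move=> s; apply: (is_derive_along1 (w := delta_mx ord0 ord0)) (gdg _) => h.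
  by rewrite row_cons_delta0 row_consD addr0.
- by move=> s; apply: continuous_comp; [exact: row_cons_continuous_l|exact: cF].
- move=> s; rewrite gt_max => /andP[sM sN]; apply: MF.
  by apply: le_lt_trans (ler_norm M) _; rewrite ltNge row_cons_le// negb_and -!ltNge sM.
- move=> s; rewrite gt_max => /andP[sM sN]; apply: NF.
  by apply: le_lt_trans (ler_norm N) _; rewrite ltNge row_cons_le// negb_and -!ltNge sN.
Qed.

End Parts.

(** * Green's identity *)

Section DerivativeRules.
Context {R : realType}.

Lemma is_derive_funM (V : normedModType R) (x v : V) (f g : V -> R) (df dg : R) :
  is_derive x v f df -> is_derive x v g dg ->
  is_derive x v (fun y => f y * g y) (df * g x + f x * dg).
Proof.
move=> fd gd; rewrite addrC [df * _]mulrC.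
exact: (@is_deriveM _ _ f g).
Qed.

Lemma is_derive_funD (V : normedModType R) (x v : V) (f g : V -> R) (df dg : R) :
  is_derive x v f df -> is_derive x v g dg ->
  is_derive x v (fun y => f y + g y) (df + dg).
Proof. by move=> fd gd; exact: (@is_deriveD _ _ _ f g). Qed.

Lemma is_derive_funB (V : normedModType R) (x v : V) (f g : V -> R) (df dg : R) :
  is_derive x v f df -> is_derive x v g dg ->
  is_derive x v (fun y => f y - g y) (df - dg).
Proof. by move=> fd gd; exact: (@is_deriveB _ _ _ f g). Qed.

Lemma is_derive_funZ (V : normedModType R) (x v : V) (c : R) (f : V -> R) (df : R) :
  is_derive x v f df -> is_derive x v (fun y => c * f y) (c * df).
Proof. by move=> fd; exact: (@is_deriveZ _ _ _ f). Qed.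

Lemma is_derive_funX (V : normedModType R) (x v : V) (f : V -> R) (df : R) (k : nat) :
  is_derive x v f df ->
  is_derive x v (fun y => f y ^+ k) (k%:R * f x ^+ k.-1 * df).
Proof.
case: k => [|k] fd; first by rewrite !mul0r; exact: is_derive_cst.
have -> : (fun y => f y ^+ k.+1) = f ^+ k.+1 by rewrite exprfctE.
apply: is_derive_eq => //=.
Qed.

Lemma is_derive_ext (V W : normedModType R) (x v : V) (f g : V -> W) (d : W) :
  (forall y, f y = g y) -> is_derive x v f d -> is_derive x v g d.
Proof. by move=> /funext ->. Qed.

Lemma is_derive_near0 (V W : normedModType R) (x v : V) (f : V -> W) :
  (\near x, f x = 0) -> is_derive x v f 0.
Proof.
move=> f0; apply: (near_eq_is_derive (f := cst 0)).
  by apply: filterS f0 => y /= ->.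
Qed.

Lemma is_derive_unique (V W : normedModType R) (x v : V) (f : V -> W) (a b : W) :
  is_derive x v f a -> is_derive x v f b -> a = b.
Proof. by move=> [_ <-] [_ <-]. Qed.

(** Restriction to a line brings the chain rule and the derivatives of polynomials down to one real
    variable. *)
Lemma is_derive_line (V W : normedModType R) (x v : V) (f : V -> W) (d : W) :
  is_derive x v f d <-> is_derive (0 : R) 1 (fun t : R => f (x + t *: v)) d.
Proof.
have E : (fun h : R => h^-1 *: ((f \o shift x) (h *: v) - f x)) =
   (fun h : R => h^-1 *: (((fun t : R => f (x + t *: v)) \o shift 0) (h *: 1)
      - f (x + (0 : R) *: v))).
  by apply/funext => h /=; rewrite addr0 scale0r addr0 -[h *: 1]/(h * 1) mulr1 addrC [_ +
    x]addrC addrC.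
split.
  by move=> [fd fE]; split; [rewrite /derivable -E|rewrite /derive -E].
by move=> [fd fE]; split; [rewrite /derivable E|rewrite /derive E].
Qed.

Lemma is_derive_chain (V : normedModType R) (x v : V) (g : V -> R) (f : R -> R) (df dg : R) :
  is_derive (g x) 1 f df -> is_derive x v g dg ->
  is_derive x v (fun y => f (g y)) (df * dg).
Proof.
move=> fd /is_derive_line gd; apply/is_derive_line.
by apply: (@is_derive1_comp _ f (fun t : R => g (x + t *: v))); rewrite ?scale0r ?addr0.
Qed.

Lemma is_derive_continuous (f : R -> R) (x d : R) :
  is_derive x 1 f d -> {for x, continuous f}.
Proof.
by move=> [fd _]; apply: differentiable_continuous; apply/derivable1_diffP.
Qed.

Lemma continuous_chain (V : topologicalType) (g : R -> R) (h : V -> R) :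
  continuous g -> continuous h -> continuous (fun x => g (h x)).
Proof. by move=> cg ch x; apply: continuous_comp; [exact: ch|exact: cg]. Qed.

Lemma continuous_mul (V : topologicalType) (g h : V -> R) :
  continuous g -> continuous h -> continuous (fun x => g x * h x).
Proof. by move=> cg ch x; exact: (cvgM (cg x) (ch x)). Qed.

Lemma continuous_add (V : topologicalType) (g h : V -> R) :
  continuous g -> continuous h -> continuous (fun x => g x + h x).
Proof. by move=> cg ch x; exact: (cvgD (cg x) (ch x)). Qed.

Lemma continuous_pow (V : topologicalType) (g : V -> R) (k : nat) :
  continuous g -> continuous (fun x => g x ^+ k).
Proof.
move=> cg; elim: k => [|k ih]; first exact: cst_continuous.
by under eq_fun do rewrite exprS; exact: continuous_mul.
Qed.

End DerivativeRules.

Section Green.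
Context {R : realType} {n : nat}.
Implicit Types (u F : 'rV[R]_n -> R) (A : set 'rV[R]_n).

(** Radial test functions are written in the variable [|x|^2] because it is a polynomial,
    differentiable at the origin too. *)
Definition sqn (x : 'rV[R]_n) : R := \sum_(i < n) x ord0 i ^+ 2.
Definition dot (y x : 'rV[R]_n) : R := \sum_(i < n) y ord0 i * x ord0 i.

Lemma continuous_coord (i : 'I_n) : continuous (fun x : 'rV[R]_n => x ord0 i).
Proof. exact: coord_continuous. Qed.

Lemma continuous_fsum (I : Type) (s : seq I) (f : I -> 'rV[R]_n -> R) :
  (forall i, continuous (f i)) -> continuous (fun x => \sum_(i <- s) f i x).
Proof.
move=> cf; elim: s => [|i s ih].
  by under eq_fun do rewrite big_nil; exact: cst_continuous.
by under eq_fun do rewrite big_cons; move=> x; exact: (cvgD (cf i x) (ih x)).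
Qed.

Lemma continuous_sqn : continuous sqn.
Proof.
by apply: continuous_fsum => i; apply: continuous_pow; exact: continuous_coord.
Qed.

Lemma continuous_dot (y : 'rV[R]_n) : continuous (dot y).
Proof.
apply: continuous_fsum => i.
by apply: continuous_mul; [exact: cst_continuous|exact: continuous_coord].
Qed.

Lemma continuous_subr (V : normedModType R) (c : V) : continuous (fun x : V => x - c).
Proof. by move=> x; apply: cvgB; [exact: cvg_id|exact: cvg_cst]. Qed.

Lemma dotD (y a b : 'rV[R]_n) : dot y (a + b) = dot y a + dot y b.
Proof. by rewrite -big_split; apply: eq_bigr => i _; rewrite mxE mulrDr. Qed.

Lemma dot_deltaZ (y : 'rV[R]_n) (t : R) (i : 'I_n) :
  dot y (t *: delta_mx ord0 i) = t * y ord0 i.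
Proof.
rewrite /dot (bigD1 i)//= !mxE !eqxx mulr1 big1 ?addr0 1?mulrC// => j ji.
by rewrite !mxE eqxx (negbTE ji) mulr0 mulr0.
Qed.

Lemma sqnD (a b : 'rV[R]_n) : sqn (a + b) = sqn a + 2 * dot a b + sqn b.
Proof.
rewrite /sqn /dot mulr_sumr -!big_split; apply: eq_bigr => i _ /=.
by rewrite mxE; ring.
Qed.

Lemma sqn_dot (a : 'rV[R]_n) : sqn a = dot a a.
Proof. by apply: eq_bigr => i _; rewrite expr2. Qed.

Lemma dotC (a b : 'rV[R]_n) : dot a b = dot b a.
Proof. by apply: eq_bigr => i _; rewrite mulrC. Qed.

Lemma sqn_ge0 (a : 'rV[R]_n) : 0 <= sqn a.
Proof. by apply: sumr_ge0 => i _; exact: sqr_ge0. Qed.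

Lemma normr_le_sqn (a : 'rV[R]_n) : `|a| ^+ 2 <= sqn a.
Proof.
rewrite -ler_sqrt ?sqrtr_sqr ?normr_id ?exprn_ge0//; last exact: sqn_ge0.
apply/mx_norm_leP; rewrite ?sqrtr_ge0// => i.
rewrite -sqrtr_sqr; apply: ler_wsqrtr.
by rewrite /sqn (bigD1 i)//= lerDl sumr_ge0// => j _; exact: sqr_ge0.
Qed.

Lemma sqn_le_normr (a : 'rV[R]_n) (e : R) : `|a| <= e -> sqn a <= n%:R * e ^+ 2.
Proof.
move=> ae; have e0 : 0 <= e by exact: le_trans ae.
apply: le_trans (_ : \sum_(i < n) e ^+ 2 <= _); last first.
  by rewrite sumr_const card_ord mulr_natl.
apply: ler_sum => i _; rewrite -[_ ^+ 2]ger0_norm ?sqr_ge0// normrX.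
by rewrite lerXn2r ?nnegrE//; have /(mx_norm_leP _ e0) := ae; apply.
Qed.

Lemma continuous_sqnB (c : 'rV[R]_n) : continuous (fun z : 'rV[R]_n => sqn (z - c)).
Proof.
move=> z; exact: (@continuous_comp _ _ _ (fun z : 'rV[R]_n => z - c) sqn z
  (@continuous_subr _ c z) (@continuous_sqn (z - c))).
Qed.

Lemma near_sqnB_gt (c z : 'rV[R]_n) (s : R) :
  s < sqn (z - c) -> \near z, s < sqn (z - c).
Proof.
move=> sz; have hN : nbhs (sqn (z - c)) [set t | s < t] by exact: lt_nbhsr.
exact: (@continuous_sqnB c z _ hN).
Qed.

Lemma is_derive_dot (y c x : 'rV[R]_n) (i : 'I_n) :
  is_derive x (delta_mx ord0 i) (fun x => dot y (x - c)) (y ord0 i).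
Proof.
apply/is_derive_line.
apply: (@is_derive_ext _ _ _ _ _ (fun t : R => dot y (x - c) + t * y ord0 i)).
  by move=> t; rewrite [x + _ - c]addrAC [RHS]dotD dot_deltaZ.
apply: (is_derive_eq (is_derive_funD (is_derive_cst (dot y (x - c)) (0 : R) 1)
  (is_derive_funM (is_derive_id (0 : R) 1) (is_derive_cst (y ord0 i) (0 : R) 1)))).
by rewrite /cst /=; ring.
Qed.

Lemma is_derive_sqn (c x : 'rV[R]_n) (i : 'I_n) :
  is_derive x (delta_mx ord0 i) (fun x => sqn (x - c)) (2 * (x - c) ord0 i).
Proof.
apply/is_derive_line.
apply: (@is_derive_ext _ _ _ _ _
  (fun t : R => sqn (x - c) + (2 * (x - c) ord0 i) * t + t * t)).
  move=> t; rewrite [x + _ - c]addrAC [RHS]sqnD dot_deltaZ [sqn (_ *: _)]sqn_dot dot_deltaZ.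
  by rewrite !mxE !eqxx /=; ring.
apply: (is_derive_eq (is_derive_funD (is_derive_funD (is_derive_cst (sqn (x - c)) (0 : R) 1)
    (is_derive_funM (is_derive_cst (2 * (x - c) ord0 i) (0 : R) 1) (is_derive_id (0 : R) 1)))
  (is_derive_funM (is_derive_id (0 : R) 1) (is_derive_id (0 : R) 1)))).
by rewrite /cst /=; ring.
Qed.

(** Nothing is known of [u] outside [A], but a point there has a neighbourhood on which [F], hence
    the product, vanishes. The solution enters integrals over the whole space in this way. *)
Lemma ccont_mul_on A u F : (forall x, A x -> {for x, continuous u}) -> ccont F ->
  (forall x, A x \/ \near x, F x = 0) -> ccont (fun x => u x * F x).
Proof.
move=> cu [cF [M MF]] AF; split; last by exists M => x xM; rewrite MF// mulr0.
move=> x; have [Ax|F0] := AF x; first exact: (cvgM (cu x Ax) (cF x)).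
have uF0 : \near x, u x * F x = 0 by apply: filterS F0 => z ->; rewrite mulr0.
rewrite /continuous_at (nbhs_singleton uF0).
apply: cvg_trans (near_eq_cvg _) (@cvg_cst _ 0 _ (nbhs x) _).
by apply: filterS uF0 => z ->.
Qed.

(** For each [i], [u ddF_i - ddu_i F] is the derivative along [i] of the compactly supported
    [u dF_i - du_i F], so its integral is zero; summing over [i] and inserting the equation for [u]
    gives the claim. *)
Lemma green_identity A u (du ddu : 'I_n -> 'rV[R]_n -> R) (lam : R)
    (F : 'rV[R]_n -> R) (dF ddF : 'I_n -> 'rV[R]_n -> R) :
  (forall x, A x -> {for x, continuous u}) ->
  (forall x i, A x -> {for x, continuous (du i)}) ->
  (forall x i, A x -> {for x, continuous (ddu i)}) ->
  (forall x i, A x -> is_derive x (delta_mx ord0 i) u (du i x)) ->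
  (forall x i, A x -> is_derive x (delta_mx ord0 i) (du i) (ddu i x)) ->
  (forall x, A x -> \sum_i ddu i x = - lam * u x) ->
  (forall x i, is_derive x (delta_mx ord0 i) F (dF i x)) ->
  (forall x i, is_derive x (delta_mx ord0 i) (dF i) (ddF i x)) ->
  ccont F -> (forall i, ccont (dF i)) -> (forall i, ccont (ddF i)) ->
  (forall x, A x \/ \near x, F x = 0) ->
  intN (fun x => u x * (\sum_i ddF i x + lam * F x)) = 0.
Proof.
move=> cu cdu cddu hu hdu hlap hF hdF cF cdF cddF AF.
(* Vanishing on a neighbourhood passes from [F] to its derivatives by uniqueness of the derivative
   at each nearby point. *)
have AdF i x : A x \/ \near x, dF i x = 0.
  have [Ax|/near_join F0] := AF x; [by left|right].
  apply: filterS F0 => y F0.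
  exact: (is_derive_unique (hF y i) (is_derive_near0 _ F0)).
have AddF i x : A x \/ \near x, ddF i x = 0.
  have [Ax|/near_join F0] := AdF i x; [by left|right].
  apply: filterS F0 => y F0.
  exact: (is_derive_unique (hdF y i) (is_derive_near0 _ F0)).
have c1 i : ccont (fun x => u x * ddF i x) by exact: (ccont_mul_on cu).
have c2 i : ccont (fun x => ddu i x * F x).
  by apply: (ccont_mul_on (A := A)) => // x Ax; exact: cddu.
have key i : intN (fun x => u x * ddF i x - ddu i x * F x) = 0.
  apply: (@intN_derive0 _ _ i (fun x => u x * dF i x - du i x * F x)).
  - move=> x; have [Ax|F0] := AF x.
      have := is_derive_funB (is_derive_funM (hu x i Ax) (hdF x i)) (is_derive_funM (hdu x i
        Ax) (hF x i)).
      by congr is_derive; ring.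
    have [Ax|dF0] := AdF i x.
      have := is_derive_funB (is_derive_funM (hu x i Ax) (hdF x i)) (is_derive_funM (hdu x i
        Ax) (hF x i)).
      by congr is_derive; ring.
    have [Ax|ddF0] := AddF i x.
      have := is_derive_funB (is_derive_funM (hu x i Ax) (hdF x i)) (is_derive_funM (hdu x i
        Ax) (hF x i)).
      by congr is_derive; ring.
    rewrite (nbhs_singleton F0) (nbhs_singleton ddF0) !mulr0 subr0.
    apply: is_derive_near0; apply: filterS2 F0 dF0 => y -> ->.
    by rewrite !mulr0 subr0.
  - apply: ccontB; first exact: (ccont_mul_on cu).
    by apply: (ccont_mul_on (A := A)) => // x Ax; exact: cdu.
  - exact: ccontB.
transitivity (intN (fun x => \sum_(i < n) (u x * ddF i x - ddu i x * F x))).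
  congr intN; apply/funext => x; rewrite sumrB -mulr_sumr -mulr_suml.
  have [Ax|F0] := AF x; first by rewrite hlap//; ring.
  by rewrite (nbhs_singleton F0); ring.
rewrite intN_sum; first by rewrite big1.
by move=> i; exact: ccontB.
Qed.

Lemma ccont_radial (c : 'rV[R]_n) (F : R -> R) (s1 : R) : continuous F ->
  (forall s, s1 <= s -> F s = 0) -> ccont (fun x => F (sqn (x - c))).
Proof.
move=> cF F0; split.
  by apply: continuous_chain => //; exact: continuous_sqnB.
(* Beyond this radius [|x - c|] is at least [|s1| + 1], so its square, and with it [sqn (x - c)],
   exceeds [s1]. *)
exists (`|s1| + 1 + `|c|) => x hx; apply: F0.
apply: le_trans (normr_le_sqn _).
have h1 : `|s1| + 1 <= `|x - c|.
  have : `|x| <= `|x - c| + `|c| by rewrite -{1}(subrK c x) ler_normD.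
  by move: hx; lra.
apply: le_trans (ler_norm s1) _.
have := normr_ge0 s1; move: h1; set a := `|s1|; set b := `|x - c|; nra.
Qed.

(* With s = |x-c|^2 and L = y.(x-c), the function L^k F(s) has Laplacian
   k (k-1) |y|^2 L^(k-2) F + L^k (4 s F'' + (2 n + 4 k) F'). *)
Lemma green_radial A u (du ddu : 'I_n -> 'rV[R]_n -> R) (lam : R)
    (y c : 'rV[R]_n) (k : nat) (F F1 F2 : R -> R) (s1 : R) :
  (forall x, A x -> {for x, continuous u}) ->
  (forall x i, A x -> {for x, continuous (du i)}) ->
  (forall x i, A x -> {for x, continuous (ddu i)}) ->
  (forall x i, A x -> is_derive x (delta_mx ord0 i) u (du i x)) ->
  (forall x i, A x -> is_derive x (delta_mx ord0 i) (du i) (ddu i x)) ->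
  (forall x, A x -> \sum_i ddu i x = - lam * u x) ->
  (forall s : R, is_derive s 1 F (F1 s)) ->
  (forall s : R, is_derive s 1 F1 (F2 s)) ->
  continuous F2 ->
  (forall s, s1 <= s -> [/\ F s = 0, F1 s = 0 & F2 s = 0]) ->
  (forall x, A x \/ \near x, F (sqn (x - c)) = 0) ->
  intN (fun x => u x * ((k * k.-1)%:R * sqn y * dot y (x - c) ^+ k.-2 * F (sqn (x - c))
     + dot y (x - c) ^+ k * (4 * sqn (x - c) * F2 (sqn (x - c))
            + (2 * n%:R + 4 * k%:R) * F1 (sqn (x - c)))
     + lam * (dot y (x - c) ^+ k * F (sqn (x - c))))) = 0.
Proof.
move=> cu cdu cddu hu hdu hlap hF hF1 cF2 F0 AF.
pose L (x : 'rV[R]_n) : R := dot y (x - c).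
pose S (x : 'rV[R]_n) : R := sqn (x - c).
pose D (i : 'I_n) (x : 'rV[R]_n) : R := (x - c) ord0 i.
have cF : continuous F by move=> s; exact: (is_derive_continuous (hF s)).
have cF1 : continuous F1 by move=> s; exact: (is_derive_continuous (hF1 s)).
have cL : continuous L.
  by move=> x; apply: continuous_comp; [exact: continuous_subr|exact: continuous_dot].
have cD i : continuous (D i).
  move=> x; exact: (@continuous_comp 'rV[R]_n 'rV[R]_n R (fun x => x - c)
    (fun x => x ord0 i) x (@continuous_subr _ c x) (@continuous_coord i (x - c))).
have ccF : ccont (fun x => F (S x)) by apply: (@ccont_radial c F s1) => // s /F0[].
have ccF1 : ccont (fun x => F1 (S x)) by apply: (@ccont_radial c F1 s1) => // s /F0[].
have ccF2 : ccont (fun x => F2 (S x)) by apply: (@ccont_radial c F2 s1) => // s /F0[].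
have hL x i : is_derive x (delta_mx ord0 i) L (y ord0 i) by exact: is_derive_dot.
have hS x i : is_derive x (delta_mx ord0 i) S (2 * D i x) by exact: is_derive_sqn.
have hD x i : is_derive x (delta_mx ord0 i) (D i) 1.
  have := is_derive_dot (delta_mx ord0 i) c x i; rewrite mxE !eqxx.
  apply: is_derive_ext => z.
  by rewrite dotC -[delta_mx _ _]scale1r dot_deltaZ mul1r.
have hFS x i : is_derive x (delta_mx ord0 i) (fun x => F (S x)) (F1 (S x) * (2 * D i x)).
  exact: is_derive_chain.
have hF1S x i : is_derive x (delta_mx ord0 i) (fun x => F1 (S x)) (F2 (S x) * (2 * D i x)).
  exact: is_derive_chain.
have hLk m x i : is_derive x (delta_mx ord0 i) (fun x => L x ^+ m) (m%:R * L x ^+ m.-1 * y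
  ord0 i).
  exact: is_derive_funX.
pose dP (i : 'I_n) (x : 'rV[R]_n) : R := (k%:R * y ord0 i) * (L x ^+ k.-1 * F (S x)) + 2 * (D
  i x * (L x ^+ k * F1 (S x))).
pose ddP (i : 'I_n) (x : 'rV[R]_n) : R := (k%:R * y ord0 i) * ((k.-1%:R * L x ^+ k.-2 * y
  ord0 i) * F (S x)
    + L x ^+ k.-1 * (F1 (S x) * (2 * D i x)))
  + 2 * (L x ^+ k * F1 (S x) + D i x * ((k%:R * L x ^+ k.-1 * y ord0 i) * F1 (S x)
      + L x ^+ k * (F2 (S x) * (2 * D i x)))).
have cLk m : continuous (fun x => L x ^+ m) by exact: continuous_pow.
have := @green_identity A u du ddu lam (fun x => L x ^+ k * F (S x)) dP ddP
  cu cdu cddu hu hdu hlap.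
have -> : (fun x => u x * (\sum_i ddP i x + lam * (L x ^+ k * F (S x)))) =
  (fun x => u x * ((k * k.-1)%:R * sqn y * dot y (x - c) ^+ k.-2 * F (sqn (x - c))
     + dot y (x - c) ^+ k * (4 * sqn (x - c) * F2 (sqn (x - c))
            + (2 * n%:R + 4 * k%:R) * F1 (sqn (x - c)))
     + lam * (dot y (x - c) ^+ k * F (sqn (x - c))))).
  apply/funext => x; congr (_ * (_ + _)).
  rewrite -/(S x) -/(L x).
  transitivity (\sum_(i < n) ((k * k.-1)%:R * L x ^+ k.-2 * F (S x) * (y ord0 i ^+ 2)
      + (4 * k%:R * L x ^+ k.-1 * F1 (S x)) * (y ord0 i * D i x)
      + 2 * L x ^+ k * F1 (S x) + 4 * L x ^+ k * F2 (S x) * (D i x ^+ 2))).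
    by apply: eq_bigr => i _; rewrite /ddP natrM; ring.
  rewrite !big_split /= -!mulr_sumr sumr_const card_ord -mulr_natl.
  rewrite -/(sqn y) -/(dot y (x - c)) -/(L x) -/(sqn (x - c)) -/(S x).
  (* For [k = 0] the truncated predecessor spoils [L ^+ k.-1 * L = L ^+ k], but the coefficient
     [k%:R] makes both sides zero. *)
  have -> : 4 * k%:R * L x ^+ k.-1 * F1 (S x) * L x = 4 * k%:R * L x ^+ k * F1 (S x).
    by case: (k) => [|m]; rewrite ?mulr0 ?mul0r//= exprSr; ring.
  by ring.
apply.
- move=> x i; have := is_derive_funM (hLk k x i) (hFS x i).
  by congr is_derive; rewrite /dP; ring.
- move=> x i.
  have := is_derive_funD (is_derive_funZ (k%:R * y ord0 i) (is_derive_funM (hLk k.-1 x i)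
    (hFS x i)))
    (is_derive_funZ 2 (is_derive_funM (hD x i) (is_derive_funM (hLk k x i) (hF1S x i)))).
  by congr is_derive; rewrite /ddP; ring.
- exact: ccontMl.
- move=> i; rewrite /dP; apply: ccontD; apply: ccontZ; first exact: ccontMl.
  by apply: ccontMl => //; exact: ccontMl.
- move=> i; rewrite /ddP; apply: ccontD; apply: ccontZ; apply: ccontD.
  + apply: ccontMl => //.
    apply: continuous_mul; last exact: cst_continuous.
    by apply: continuous_mul; [exact: cst_continuous|exact: cLk].
  + apply: ccontMl => //; apply: ccontMr => //.
    by apply: continuous_mul; [exact: cst_continuous|].
  + exact: ccontMl.
  + apply: ccontMl => //; apply: ccontD.
      apply: ccontMl => //.
      apply: continuous_mul; last exact: cst_continuous.
      by apply: continuous_mul; [exact: cst_continuous|exact: cLk].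
    apply: ccontMl => //; apply: ccontMr => //.
    by apply: continuous_mul; [exact: cst_continuous|].
- move=> x; have [Ax|F0'] := AF x; [by left|right].
  by apply: filterS F0' => z Fz; rewrite /S Fz mulr0.
Qed.

End Green.

(** * Cut-offs and the one-dimensional equation *)

Section OneVariable.
Context {R : realType}.
Implicit Types (f g : R -> R).

(** The truncated power [t_+^k], of class C^(k-1) for [k >= 1]. Cut-offs and bumps built from it are
    piecewise polynomial, with explicit derivatives and bounds. *)
Definition pospow (k : nat) (t : R) : R := Num.max t 0 ^+ k.

Lemma pospow0 (k : nat) (t : R) : t <= 0 -> pospow k.+1 t = 0.
Proof. by move=> t0; rewrite /pospow max_r// expr0n. Qed.

Lemma pospowE (k : nat) (t : R) : 0 <= t -> pospow k t = t ^+ k.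
Proof. by move=> t0; rewrite /pospow max_l. Qed.

Lemma pospow_ge0 (k : nat) (t : R) : 0 <= pospow k t.
Proof. by rewrite exprn_ge0// le_max lexx orbT. Qed.

Lemma pospow_le1 (k : nat) (t : R) : t <= 1 -> pospow k t <= 1.
Proof.
by move=> t1; rewrite exprn_ile1// ?le_max ?lexx ?orbT// ge_max t1 ler01.
Qed.

Lemma continuous_pospow (k : nat) : continuous (pospow k).
Proof.
apply: continuous_pow => t.
by apply: continuous_max; [exact: cvg_id|exact: cvg_cst].
Qed.

Lemma is_derive_pospow (k : nat) (t : R) :
  is_derive t 1 (pospow k.+2) (k.+2%:R * pospow k.+1 t).
Proof.
have [t0|t0|->] := ltgtP t 0.
- rewrite pospow0 ?ltW// mulr0; apply: is_derive_near0.
  by apply: filterS (lt_nbhsl t0) => s /ltW s0; rewrite pospow0.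
- apply: (@near_eq_is_derive _ _ _ (fun s : R => s ^+ k.+2)).
    by apply: filterS (lt_nbhsr t0) => s /ltW s0; rewrite pospowE.
  rewrite pospowE ?ltW//; apply: is_derive_eq (is_derive_funX k.+2 (is_derive_id t 1)) _.
  by rewrite mulr1.
(* At 0 the difference quotient of [pospow k.+2] is [pospow k.+1], which is continuous and vanishes
   there. *)
- rewrite pospow0// mulr0.
  have h : (fun h => h^-1 *: ((pospow k.+2 \o shift 0) (h *: 1) - pospow k.+2 0)) @ 0^' -->
    (0 : R).
    apply: cvg_trans (near_eq_cvg _) (_ : pospow k.+1 @ 0^' --> 0).
      near=> h; rewrite /= addr0 (pospow0 _ (lexx 0)) subr0 -[_ *: _]/(_ * _) -[h *: 1]/(h *
        1) mulr1.
      have h0 : h != 0 by near: h; exact: nbhs_dnbhs_neq.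
      have [hn|hp] := leP h 0; first by rewrite !pospow0// mulr0.
      by rewrite !pospowE ?ltW// [in RHS]exprS mulKf.
    rewrite -[X in _ --> X](pospow0 k (lexx 0)).
    by apply: cvg_within_filter; exact: continuous_pospow.
  split; first by apply/cvg_ex; exists 0.
  exact/cvg_lim.
Unshelve. all: by end_near. Qed.

(** The witness is [chi (t) = (1 - (t-1)_+^3)_+^3]: the inner cube makes the junction at 1 of class
    C^2, the outer one the junction at 2. *)
Lemma ex_cutoff : exists chi chi1 chi2 : R -> R, exists C : R,
  [/\ (forall t : R, is_derive t 1 chi (chi1 t)),
      (forall t : R, is_derive t 1 chi1 (chi2 t)),
      continuous chi2,
      (forall t, 0 <= chi t <= 1) &
      [/\ (forall t, t <= 1 -> chi t = 1),
          (forall t, 2 <= t -> chi t = 0),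
          (forall t, t <= 1 \/ 2 <= t -> chi1 t = 0 /\ chi2 t = 0),
          0 <= C &
          (forall t, `|chi1 t| <= C /\ `|chi2 t| <= C)]].
Proof.
pose a k t := pospow k (t - 1).
pose b k t := pospow k (1 - a 3%N t).
have da k (t : R) : is_derive t 1 (a k.+2) (k.+2%:R * a k.+1 t).
  apply: (is_derive_eq (is_derive_chain (g := fun t : R => t - 1)
    (is_derive_pospow k (t - 1)) (is_derive_funB (is_derive_id t 1) (is_derive_cst (1 : R) t
      1)))).
  by rewrite subr0 mulr1.
have db k (t : R) : is_derive t 1 (b k.+2) (k.+2%:R * b k.+1 t * (- 3 * a 2%N t)).
  apply: (is_derive_eq (is_derive_chain (g := fun t : R => 1 - a 3%N t)
    (is_derive_pospow k (1 - a 3%N t)) (is_derive_funB (is_derive_cst (1 : R) t 1) (da 1%N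
      t)))).
  by rewrite /b; ring.
have ca k : continuous (a k).
  apply: continuous_chain; first exact: continuous_pospow.
  exact: (@continuous_subr _ R^o).
have cb k : continuous (b k).
  apply: continuous_chain; first exact: continuous_pospow.
  by move=> t; apply: cvgB; [exact: cvg_cst|exact: ca].
(* 72 is [9 * (6 + 2)]: the triangle inequality for the second derivative, all truncated powers
   being at most 1 when [t <= 2]. *)
exists (b 3%N), (fun t => - 9 * (b 2%N t * a 2%N t)),
  (fun t => - 9 * ((2 * b 1%N t * (- 3 * a 2%N t)) * a 2%N t + b 2%N t * (2 * a 1%N t))), 72.
have a0 k t : t <= 1 -> a k.+1 t = 0 by move=> t1; rewrite /a pospow0// subr_le0.
have b0 k t : 2 <= t -> b k.+1 t = 0.
  move=> t2; rewrite /b pospow0// subr_le0 /a pospowE; last by lra.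
  by rewrite exprn_ege1//; lra.
have a01 k t : t <= 2 -> 0 <= a k t <= 1.
  by move=> t2; rewrite pospow_ge0 pospow_le1//; lra.
have b01 k t : 0 <= b k t <= 1.
  by rewrite pospow_ge0 pospow_le1// lerBlDr lerDl pospow_ge0.
split; [| | |exact: b01|split].
- by move=> t; apply: is_derive_eq (db 1%N t) _; ring.
- move=> t; apply: (is_derive_funZ (- 9) (is_derive_funM (db 0%N t) (da 0%N t))).
- apply: continuous_mul; first exact: cst_continuous.
  apply: continuous_add; apply: continuous_mul => //; apply: continuous_mul => //.
  + by apply: continuous_mul => //; exact: cst_continuous.
  + by apply: continuous_mul => //; exact: cst_continuous.
  + exact: cst_continuous.
- by move=> t t1; rewrite /b a0// subr0 pospowE// expr1n.
- by move=> t t2; rewrite b0.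
- move=> t [t1|t2]; first by rewrite !a0//; split; ring.
  by rewrite !b0//; split; ring.
- by lra.
- move=> t; have [t2|/ltW t2] := leP t 2; last by rewrite !b0//; split; rewrite ler_norml; lra.
  have := (a01 1%N t t2, a01 2%N t t2, b01 1%N t, b01 2%N t).
  set a1 := a 1%N t; set a2 := a 2%N t; set b1 := b 1%N t; set b2 := b 2%N t.
  move=> [[[/andP[? ?] /andP[? ?]] /andP[? ?]] /andP[? ?]].
  have ? : 0 <= b2 * a2 <= 1 by rewrite mulr_ge0//= mulr_ile1.
  have ? : 0 <= b2 * a1 <= 1 by rewrite mulr_ge0//= mulr_ile1.
  have ? : 0 <= b1 * a2 <= 1 by rewrite mulr_ge0//= mulr_ile1.
  have ? : 0 <= b1 * a2 * a2 <= 1.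
    by rewrite mulr_ge0 ?mulr_ge0//= mulr_ile1 ?mulr_ge0// mulr_ile1.
  have -> : 2 * b1 * (-3 * a2) * a2 + b2 * (2 * a1) = - 6 * (b1 * a2 * a2) + 2 * (b2 * a1) by
    ring.
  by split; rewrite ler_norml; apply/andP; split; lra.
Qed.

(** Square roots, inverses and real powers are differentiated only at positive arguments; vanishing
    up to some [r0 > 0] carries the formula to the whole line. *)
Lemma is_derive_glue f df (r0 : R) : 0 < r0 ->
  (forall r : R, 0 < r -> is_derive r 1 f (df r)) ->
  (forall r, r <= r0 -> f r = 0) ->
  (forall r, r <= r0 -> df r = 0) -> forall r : R, is_derive r 1 f (df r).
Proof.
move=> r00 fd f0 df0 r; have [r_gt0|r_le0] := ltP 0 r; first exact: fd.
have rr0 : r < r0 by exact: le_lt_trans r_le0 r00.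
rewrite df0 ?ltW//; apply: is_derive_near0.
by apply: filterS (lt_nbhsl rr0) => s /ltW; exact: f0.
Qed.

Lemma continuous_glue f (r0 : R) : 0 < r0 ->
  (forall r : R, 0 < r -> {for r, continuous f}) ->
  (forall r, r <= r0 -> f r = 0) -> continuous f.
Proof.
move=> r00 cf f0 r; have [r_gt0|r_le0] := ltP 0 r; first exact: cf.
have rr0 : r < r0 by exact: le_lt_trans r_le0 r00.
apply: (@is_derive_continuous _ f r 0); apply: is_derive_near0.
by apply: filterS (lt_nbhsl rr0) => s /ltW; exact: f0.
Qed.

Lemma is_derive_nondecr f df (a b : R) : a <= b ->
  (forall r : R, a <= r -> is_derive r 1 f (df r)) ->
  (forall r, a < r -> 0 <= df r) -> f a <= f b.
Proof.
move=> ab fd df0; have [->//|ab'] := eqVneq a b.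
have {ab ab'}ab : a < b by rewrite lt_neqAle ab'.
have [||c /[!in_itv]/= /andP[ac _] E] := @MVT _ f df a b ab.
- by move=> x; rewrite in_itv/= => /andP[/ltW ax _]; exact: fd.
- apply: continuous_in_subspaceT => x; rewrite inE/= in_itv/= => /andP[ax _].
  exact: (is_derive_continuous (fd x ax)).
by rewrite -subr_ge0 E mulr_ge0 ?subr_ge0 ?df0// ltW.
Qed.

Lemma antiderivative g (r0 : R) : continuous g -> (forall r, r <= r0 -> g r = 0) ->
  exists G : R -> R, (forall r : R, is_derive r 1 G (g r)) /\
    (forall r, r <= r0 -> G r = 0).
Proof.
move=> cg g0.
(* Starting at [r0 - 1] instead of [r0] makes [r0] an interior point, where the fundamental theorem
   of calculus gives a two-sided derivative. *)
pose G x := \int[lebesgue_measure]_(t in `[r0 - 1, x]) g t.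
have G0 r : r <= r0 -> G r = 0.
  move=> rr0; rewrite /G /Rintegral integral0_eq// => t /=.
  by rewrite in_itv/= => /andP[_ tr]; rewrite g0// (le_trans tr).
exists G; split => // r.
have [rr0|rr0] := ltP r r0.
  rewrite g0 ?ltW//; apply: is_derive_near0.
  by apply: filterS (lt_nbhsl rr0) => s /ltW; exact: G0.
have r01 : r0 - 1 < r by apply: lt_le_trans rr0; rewrite ltrBlDr ltrDl.
have [||dG1 dG2] := @continuous_FTC1_closed R g (r0 - 1) r (r + 1) _ _ r01 (cg r).
- by rewrite ltrDl.
- apply: continuous_compact_integrable; first exact: segment_compact.
  exact: continuous_subspaceT.
- by split; [exact: dG1|rewrite -derive1E; exact: dG2].
Qed.

Lemma is_derive_expRV (kap r : R) : 0 < r ->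
  is_derive r 1 (fun r : R => expR (- kap / r)) (kap * (r ^- 2 * expR (- kap / r))).
Proof.
move=> r0.
have dV : is_derive r 1 (fun r : R => r^-1) (- r ^- 2).
  have rn0 : r != 0 by rewrite gt_eqF.
  split; first exact: (@derivableV _ _ id).
  by rewrite (@deriveV _ _ id)// derive_id -[_ *: _]/(_ * _) mulr1.
apply: (is_derive_eq (is_derive_chain (g := fun r : R => - kap / r)
  (is_derive_expR (- kap / r)) (is_derive_funZ (- kap) dV))).
by ring.
Qed.

(* The weight r^-2 exp (-kap/r) is exp (-kap/r)' / kap: one integration preserves the
   shape of the bound and gains a factor 1/kap. *)
Lemma antiderivative_bound G g (r0 K kap : R) : 0 < r0 -> 0 < kap -> 0 <= K ->
  (forall r : R, is_derive r 1 G (g r)) -> (forall r, r <= r0 -> G r = 0) ->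
  (forall r, 0 < r -> `|g r| <= K * (r ^- 2 * expR (- kap / r))) ->
  forall r, 0 < r -> `|G r| <= K / kap * expR (- kap / r).
Proof.
move=> r00 kap0 K0 dG G0 gK r rp.
have Kk : 0 <= K / kap by rewrite divr_ge0// ltW.
have [rr0|/ltW rr0] := leP r r0; first by rewrite G0// normr0 mulr_ge0// expR_ge0.
(* For either sign, [K / kap * expR (- kap / r)] plus or minus [G r] is nondecreasing on [r >= r0]
   and nonnegative at [r0]. *)
rewrite ler_norml; apply/andP; split.
  have := @is_derive_nondecr (fun r => K / kap * expR (- kap / r) + G r)
    (fun r => K / kap * (kap * (r ^- 2 * expR (- kap / r))) + g r) r0 r rr0.
  rewrite G0// addr0 => h.
  suff : 0 <= K / kap * expR (- kap / r) + G r by lra.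
  apply: le_trans (h _ _); first by rewrite mulr_ge0// expR_ge0.
    move=> s r0s; apply: is_derive_funD (is_derive_funZ _ (is_derive_expRV _ _)) (dG s).
    exact: lt_le_trans r0s.
  move=> s r0s; have := gK s (lt_trans r00 r0s).
  by rewrite mulrA divfK ?gt_eqF// ler_norml => /andP[h1 h2]; lra.
have := @is_derive_nondecr (fun r => K / kap * expR (- kap / r) - G r)
  (fun r => K / kap * (kap * (r ^- 2 * expR (- kap / r))) - g r) r0 r rr0.
rewrite G0// subr0 => h.
suff : 0 <= K / kap * expR (- kap / r) - G r by lra.
apply: le_trans (h _ _); first by rewrite mulr_ge0// expR_ge0.
  move=> s r0s; apply: is_derive_funB (is_derive_funZ _ (is_derive_expRV _ _)) (dG s).
  exact: lt_le_trans r0s.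
move=> s r0s; have := gK s (lt_trans r00 r0s).
by rewrite mulrA divfK ?gt_eqF// ler_norml => /andP[h1 h2]; lra.
Qed.

Lemma normr_sin_le1 (x : R) : `|sin x| <= 1.
Proof. by rewrite ler_norml sin_geN1 sin_le1. Qed.

Lemma normr_cos_le1 (x : R) : `|cos x| <= 1.
Proof. by rewrite ler_norml cos_geN1 cos_le1. Qed.

(** The solution is the integral of [sin (om (r - s)) g (s) / om] over [s <= r]. Expanding the sine
    leaves two antiderivatives in [r] alone, those of [cos (om r) g] and [sin (om r) g]; each obeys
    [antiderivative_bound], whence the factor 2. *)
Lemma duhamel g (r0 om K kap : R) : 0 < r0 -> 0 < om -> 0 < kap -> 0 <= K ->
  continuous g -> (forall r, r <= r0 -> g r = 0) ->
  (forall r, 0 < r -> `|g r| <= K * (r ^- 2 * expR (- kap / r))) ->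
  exists psi psi1 : R -> R,
   [/\ (forall r : R, is_derive r 1 psi (psi1 r)),
       (forall r : R, is_derive r 1 psi1 (g r - om ^+ 2 * psi r)),
       (forall r, r <= r0 -> psi r = 0 /\ psi1 r = 0),
       (forall r, 0 < r -> `|psi r| <= 2 * K / (kap * om) * expR (- kap / r)) &
       (forall r, 0 < r -> `|psi1 r| <= 2 * K / kap * expR (- kap / r))].
Proof.
move=> r00 om0 kap0 K0 cg g0 gK.
pose s_ (r : R) : R := sin (om * r); pose c_ (r : R) : R := cos (om * r).
have ds (r : R) : is_derive r 1 s_ (om * c_ r).
  apply: (is_derive_eq (is_derive_chain (g := fun r : R => om * r)
    (is_derive_sin (om * r)) (is_derive_funZ om (is_derive_id r 1)))).
  by rewrite mulr1 mulrC.
have dc (r : R) : is_derive r 1 c_ (- om * s_ r).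
  apply: (is_derive_eq (is_derive_chain (g := fun r : R => om * r)
    (is_derive_cos (om * r)) (is_derive_funZ om (is_derive_id r 1)))).
  by rewrite mulr1 mulrC mulrN mulNr.
have cs : continuous s_ by move=> r; exact: (is_derive_continuous (ds r)).
have ccs : continuous c_ by move=> r; exact: (is_derive_continuous (dc r)).
have [|r rr0|C [dC C0]] := @antiderivative (fun r => c_ r * g r) r0.
- exact: continuous_mul.
- by rewrite g0// mulr0.
have [|r rr0|D [dD D0]] := @antiderivative (fun r => s_ r * g r) r0.
- exact: continuous_mul.
- by rewrite g0// mulr0.
have Cb r : 0 < r -> `|C r| <= K / kap * expR (- kap / r).
  move: r; apply: (antiderivative_bound r00 kap0 K0 dC C0) => r rp.
  rewrite normrM; apply: le_trans (gK r rp).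
  by rewrite ler_piMl// normr_cos_le1.
have Db r : 0 < r -> `|D r| <= K / kap * expR (- kap / r).
  move: r; apply: (antiderivative_bound r00 kap0 K0 dD D0) => r rp.
  rewrite normrM; apply: le_trans (gK r rp).
  by rewrite ler_piMl// normr_sin_le1.
exists (fun r => om^-1 * (s_ r * C r - c_ r * D r)), (fun r => c_ r * C r + s_ r * D r).
have om_n0 : om != 0 by rewrite gt_eqF.
split.
- move=> r.
  apply: (is_derive_eq (is_derive_funZ om^-1 (is_derive_funB (is_derive_funM (ds r) (dC r))
    (is_derive_funM (dc r) (dD r))))).
  rewrite (_ : om * c_ r * C r + s_ r * (c_ r * g r) -
    (- om * s_ r * D r + c_ r * (s_ r * g r)) = om * (c_ r * C r + s_ r * D r)); last by ring.
  by rewrite mulKf.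
- move=> r.
  apply: (is_derive_eq (is_derive_funD (is_derive_funM (dc r) (dC r)) (is_derive_funM (ds r)
    (dD r)))).
  rewrite expr2 -[om * om * _]mulrA mulVKf//.
  rewrite (_ : - om * s_ r * C r + c_ r * (c_ r * g r) +
    (om * c_ r * D r + s_ r * (s_ r * g r)) = (c_ r ^+ 2 + s_ r ^+ 2) * g r -
     om * (s_ r * C r - c_ r * D r)); last by ring.
  by rewrite /c_ /s_ cos2Dsin2 mul1r.
- by move=> r rr0; rewrite C0// D0// !mulr0 subr0 addr0 mulr0.
- move=> r rp; rewrite normrM gtr0_norm ?invr_gt0//.
  rewrite (_ : 2 * K / (kap * om) * expR (- kap / r) =
     om^-1 * (K / kap * expR (- kap / r) + K / kap * expR (- kap / r))); last first.
    by rewrite invfM; ring.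
  rewrite ler_pM2l ?invr_gt0//; apply: le_trans (ler_normB _ _) _.
  rewrite !normrM; apply: lerD.
    by apply: le_trans (Cb r rp); rewrite ler_piMl// normr_sin_le1.
  by apply: le_trans (Db r rp); rewrite ler_piMl// normr_cos_le1.
- move=> r rp.
  rewrite (_ : 2 * K / kap * expR (- kap / r) =
     (K / kap * expR (- kap / r) + K / kap * expR (- kap / r))); last by ring.
  apply: le_trans (ler_normD _ _) _.
  rewrite !normrM; apply: lerD.
    by apply: le_trans (Cb r rp); rewrite ler_piMl// normr_cos_le1.
  by apply: le_trans (Db r rp); rewrite ler_piMl// normr_sin_le1.
Qed.

End OneVariable.

(** * Consequences of p-integrability *)

Section Decay.
Context {R : realType} {n : nat}.
Implicit Types (u F : 'rV[R]_n -> R).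

Let E (r : R) : set (tupleR n) := (@row_of_tuple R n) @^-1` (exterior r).

Lemma enormE (x : 'rV[R]_n) : enorm x = Num.sqrt (sqn x).
Proof. by []. Qed.

Lemma enorm_ge0 (x : 'rV[R]_n) : 0 <= enorm x.
Proof. exact: sqrtr_ge0. Qed.

Lemma sqr_enorm (x : 'rV[R]_n) : enorm x ^+ 2 = sqn x.
Proof. by rewrite sqr_sqrtr// sqn_ge0. Qed.

Lemma normr_le_enorm (x : 'rV[R]_n) : `|x| <= enorm x.
Proof.
rewrite -(ler_pXn2r (_ : 0 < 2)%N)// ?nnegrE ?enorm_ge0//.
by rewrite sqr_enorm normr_le_sqn.
Qed.

Lemma continuous_enorm : continuous (@enorm R n).
Proof.
by apply: continuous_chain; [exact: sqrt_continuous|exact: continuous_sqn].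
Qed.

Lemma open_exterior (r : R) : open (@exterior R n r).
Proof.
apply: (@open_comp _ _ (@enorm R n) [set y | r < y]); last exact: open_gt.
by move=> x _; exact: continuous_enorm.
Qed.

Lemma measurable_exterior (r : R) : measurable (E r).
Proof. by apply: measurable_preimage_row_of_tuple; exact: open_exterior. Qed.

Lemma measurable_powR_exterior u (p R0 r : R) : R0 <= r ->
  (forall x, exterior R0 x -> {for x, continuous u}) ->
  measurable_fun (E r) (fun t => `|u (row_of_tuple t)| `^ p).
Proof.
move=> R0r cu.
apply: (measurableT_comp (measurable_powR p)).
apply: measurableT_comp => //.
apply: (measurable_fun_continuous_row (F := u)); first exact: open_exterior.
by move=> x rx; apply: cu; exact: le_lt_trans rx.
Qed.

Lemma integral_tail u (p R0 r : R) : R0 <= r ->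
  (forall x, exterior R0 x -> {for x, continuous u}) ->
  (\int[lebesgueN n]_(t in E r) (`|u (row_of_tuple t)| `^ p)%:E < +oo)%E ->
  forall eta, 0 < eta -> exists R1, r <= R1 /\ forall R2, R1 <= R2 ->
  (\int[lebesgueN n]_(t in E R2) (`|u (row_of_tuple t)| `^ p)%:E <= eta%:E)%E.
Proof.
move=> R0r cu uoo eta eta0.
pose f (t : tupleR n) : R := `|u (row_of_tuple t)| `^ p.
have mf := measurable_powR_exterior p R0r cu.
have mE := measurable_exterior r.
have intf : (lebesgueN n).-integrable (E r) (EFin \o f).
  apply/integrableP; split; first exact/measurable_EFinP.
  apply: le_lt_trans uoo; rewrite le_eqVlt; apply/orP; left; apply/eqP.
  by apply: eq_integral => t _; rewrite /= ger0_norm// powR_ge0.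
pose f_ (k : nat) := (EFin \o f) \_ (E k%:R).
have mf_ k : measurable_fun (E r) (f_ k).
  apply/(measurable_restrict _ (measurable_exterior _) mE).
  by apply: measurable_funS mE _ _ => //; exact/measurable_EFinP.
have [] := @dominated_convergence _ _ _ (lebesgueN n) (E r) mE f_ (cst 0%E) (EFin \o f) mf_.
- exact: measurable_cst.
- apply: aeW => t Et.
  have [k kt] : exists k : nat, enorm (row_of_tuple t) <= k%:R.
    by exists (Num.truncn (enorm (row_of_tuple t))).+1; exact/ltW/truncnS_gt.
  apply: cvg_near_cst; exists k => // j /= kj.
  rewrite /f_ patchE ifF//; apply/negP; rewrite inE /E /= /exterior /=.
  by apply/negP; rewrite -leNgt (le_trans kt)// ler_nat.
- exact: intf.
- apply: aeW => t k Et; rewrite /f_ patchE; case: ifPn => _ /=.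
    by rewrite ger0_norm// powR_ge0.
  by rewrite normr0 lee_fin powR_ge0.
move=> _ _; rewrite integral0_eq// => h.
have [k _ hk] : \forall k \near \oo, (\int[lebesgueN n]_(t in E r) f_ k t < eta%:E)%E.
  apply: (h [set x | (x < eta%:E)%E]); apply: open_nbhs_nbhs; split; last by rewrite /= lte_fin.
  exact: open_ereal_lt_ereal.
exists (Num.max r k%:R); split; first by rewrite le_max lexx.
move=> R2; rewrite ge_max => /andP[rR2 kR2].
apply: le_trans (ltW (hk k (leqnn k))).
rewrite [leRHS](_ : _ = \int[lebesgueN n]_(t in E r `&` E k%:R) (f t)%:E)%E; last first.
  by rewrite /f_ -integral_mkcondr.
apply: ge0_subset_integral => //.
- exact: measurable_exterior.
- by apply: measurableI => //; exact: measurable_exterior.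
- by apply: measurable_funS mE _ _ => //; exact/measurable_EFinP.
- by move=> t Et; split; exact: le_lt_trans Et.
Qed.

(** If [a] exceeds [d], then [a = a^(1-p) a^p] and [a^(1-p) <= d^(1-p)]. The level [d] stays free,
    to be adapted to the radius of a shell. *)
Lemma normr_le_powR (a d p : R) : 0 < d -> 1 <= p -> 0 <= a ->
  a <= d + d `^ (1 - p) * a `^ p.
Proof.
move=> d0 p1 a0; have [ad|da] := leP a d.
  by apply: (le_trans ad); rewrite lerDl mulr_ge0// powR_ge0.
have {}a0 : 0 < a by exact: lt_trans da.
apply: (@le_trans _ _ (a `^ (1 - p) * a `^ p)).
  rewrite -powRD; last by rewrite (gt_eqF a0) implybT.
  by rewrite subrK powRr1// ltW.
apply: (@le_trans _ _ (d `^ (1 - p) * a `^ p)); last by rewrite lerDr ltW.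
rewrite ler_wpM2r ?powR_ge0// -[1 - p]opprB !powRN lef_pV2 ?posrE ?powR_gt0//.
by apply: ge0_ler_powR; rewrite ?nnegrE ?subr_ge0// ltW.
Qed.

(** The origin of the range of [p]. Splitting [|u|] at a level proportional to [R2^(-beta)], the
    part below contributes the order [R2^(n - beta) = R2^(1 + beta)], with a small constant, and the
    part above at most [R2^(beta (p - 1))] times the tail of the p-integral. As [R2 >= 1], the
    latter power is controlled by [R2^(1 + beta)] when [beta p <= 1 + 2 beta = n], which for
    [beta = (n-1)/2] is [p <= 2n/(n-1)]. The continuous [F] stands for [|u|] restricted to the
    shell. *)
Lemma shell_small u (p beta R0 r : R) : 0 < R0 -> R0 <= r -> 1 <= p ->
  n%:R = 1 + 2 * beta -> beta * p <= n%:R ->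
  (forall x, exterior R0 x -> {for x, continuous u}) ->
  (\int[lebesgueN n]_(t in E r) (`|u (row_of_tuple t)| `^ p)%:E < +oo)%E ->
  forall eps, 0 < eps -> exists R1, [/\ 1 <= R1, r <= R1 & forall R2, R1 <= R2 ->
    forall F, ccont F -> (forall x, `|F x| <= `|u x|) ->
    (forall x, enorm x <= R2 \/ 4 * R2 < enorm x -> F x = 0) ->
    `|intN F| <= eps * R2 `^ (1 + beta)].
Proof.
move=> R00 R0r p1 nE bp cu uoo eps eps0.
(* The shell lies in the cube [|x| <= 4 R2], of volume [(8 R2)^n]; [eta] below is the size of the
   tail that makes the second term the other half of [eps]. *)
pose e1 := eps / 2 / 8 ^+ n.
have e10 : 0 < e1 by rewrite !divr_gt0// exprn_gt0.
pose eta := eps / 2 / e1 `^ (1 - p).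
have eta0 : 0 < eta by rewrite !divr_gt0// powR_gt0.
have [R1 [rR1 tail]] := integral_tail R0r cu uoo eta0.
exists (Num.max 1 R1); split; first by rewrite le_max lexx.
  by rewrite le_max rR1 orbT.
move=> R2; rewrite ge_max => /andP[R21 R2R1] F cF Fu F0.
have R20 : 0 < R2 by exact: lt_le_trans R21.
pose d := e1 * R2 `^ (- beta).
have d0 : 0 < d by rewrite mulr_gt0// powR_gt0.
pose f (t : tupleR n) : R := `|u (row_of_tuple t)| `^ p.
have rR2 : r <= R2 by exact: le_trans R2R1.
have mE := measurable_exterior R2.
have mf : measurable_fun (E R2) f by apply: measurable_powR_exterior cu; exact: le_trans rR2.
have mf' : measurable_fun setT ((EFin \o f) \_ (E R2)).
  apply/(measurable_restrictT _ mE); exact/measurable_EFinP.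
have R40 : 0 <= 4 * R2 by rewrite mulr_ge0// ltW.
have [I1 I2] := @Rintegral_indic_box R n d (0 : 'rV[R]_n) _ R40.
have mI : measurable_fun setT (fun t => (d * \1_(box (0 : 'rV[R]_n) (4 * R2)) t)%:E).
  exact: measurable_int I1.
have key : ((intN (fun x => `|F x|))%:E <=
    \int[lebesgueN n]_t ((d * \1_(box (0 : 'rV[R]_n) (4 * R2)) t)%:E
       + (d `^ (1 - p))%:E * ((EFin \o f) \_ (E R2)) t))%E.
  rewrite /intN /Rintegral fineK; last first.
    apply: integrable_fin_num => //; exact: (ccont_integrable (ccont_norm cF)).
  apply: ge0_le_integral => //.
  - by apply/measurable_EFinP; apply: (measurable_cont (F := fun x => `|F x|)); case:
    (ccont_norm cF).
  - by apply: emeasurable_funD => //; exact: measurable_funeM.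
  move=> t _; rewrite patchE.
  have fge0 : (0 <= (if t \in E R2 then (EFin \o f) t else 0%E))%E.
    by case: ifPn => // _; rewrite lee_fin powR_ge0.
  have [/orP tF|] := boolP ((enorm (row_of_tuple t) <= R2) || (4 * R2 < enorm (row_of_tuple
    t))).
    rewrite F0// normr0 adde_ge0//; last by rewrite mule_ge0// lee_fin powR_ge0.
    by rewrite lee_fin mulr_ge0// ltW.
  rewrite negb_or -leNgt -ltNge => /andP[tR2 t4R2].
  rewrite mem_set// indicE mem_set/=; last first.
    by apply/row_of_tuple_box => //; rewrite subr0 (le_trans (normr_le_enorm _)).
  rewrite mulr1 -EFinM -EFinD lee_fin; apply: le_trans (Fu _) _.
  exact: normr_le_powR.
have {key} : ((intN (fun x => `|F x|))%:E <= (d * (2 * (4 * R2)) ^+ n + d `^ (1 - p) *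
  eta)%:E)%E.
  apply: le_trans key _; rewrite ge0_integralD//; last 3 first.
  - by move=> t _; rewrite lee_fin mulr_ge0// ltW.
  - move=> t _; rewrite mule_ge0 ?lee_fin ?powR_ge0// patchE; case: ifPn => // _.
    by rewrite lee_fin powR_ge0.
  - exact: measurable_funeM.
  rewrite EFinD; apply: leeD.
    rewrite -I2 /Rintegral fineK//; exact: integrable_fin_num.
  rewrite ge0_integralZl//; last 2 first.
  - by move=> t _; rewrite patchE; case: ifPn => // _; rewrite lee_fin powR_ge0.
  - by rewrite lee_fin powR_ge0.
  rewrite EFinM lee_pmul ?lee_fin ?powR_ge0//.
    by apply: integral_ge0 => t _; rewrite patchE; case: ifPn => // _; rewrite lee_fin powR_ge0.
  by rewrite -integral_mkcond; exact: tail.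
rewrite lee_fin => key.
apply: le_trans (le_normr_intN cF (ccont_norm cF) _) _ => //.
apply: le_trans key _.
rewrite [leRHS](_ : _ = eps / 2 * R2 `^ (1 + beta) + eps / 2 * R2 `^ (1 + beta)); last by
  rewrite -mulrDl -splitr.
apply: lerD.
  rewrite /d (_ : 2 * (4 * R2) = 8 * R2); last by ring.
  rewrite exprMn -[R2 ^+ n]powR_mulrn ?(ltW R20)// mulrACA.
  rewrite /e1 divfK ?gt_eqF ?exprn_gt0//.
  rewrite -powRD; last by rewrite (gt_eqF R20) implybT.
  by rewrite (_ : - beta + n%:R = 1 + beta)// nE; ring.
rewrite /d powRM ?(ltW e10) ?powR_ge0// /eta.
have : e1 `^ (1 - p) != 0 by rewrite gt_eqF// powR_gt0.
set q := e1 `^ (1 - p) => q0.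
rewrite (_ : q * _ * _ = eps / 2 * (R2 `^ (- beta)) `^ (1 - p)); last by field.
rewrite ler_pM2l ?divr_gt0// -powRrM; apply: ler_powR => //.
by lra.
Qed.

Lemma bounded_on_shell u (R0 r1 r2 : R) : R0 < r1 ->
  (forall x, exterior R0 x -> {for x, continuous u}) ->
  exists2 C, 0 <= C & forall x, r1 <= enorm x <= r2 -> `|u x| <= C.
Proof.
move=> R0r1 cu.
pose A := [set x : 'rV[R]_n | r1 <= enorm x <= r2].
have [[x0 Ax0]|A0] := pselect (A !=set0); last first.
  by exists 0 => // x hx; exfalso; apply: A0; exists x.
have cA : compact A.
  apply: bounded_closed_compact.
    exists r2; split; [exact: num_real|move=> M r2M x /= /andP[_ xr2]].
    exact: le_trans (normr_le_enorm x) (le_trans xr2 (ltW r2M)).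
  rewrite (_ : A = [set x | r1 <= enorm x] `&` [set x | enorm x <= r2]); last first.
    by apply/seteqP; split => x /=; [move=> /andP[]|move=> [h1 h2]; apply/andP].
  apply: closedI.
    apply: (@preimage_closed _ _ (@enorm R n) [set y | r1 <= y]); last exact: closed_ge.
    by move=> x _; exact: continuous_enorm.
  apply: (@preimage_closed _ _ (@enorm R n) [set y | y <= r2]); last exact: closed_le.
  by move=> x _; exact: continuous_enorm.
have [|||c _ hc] := @EVT_max_rV R n (fun x => `|u x|) A.
- by exists x0.
- exact: cA.
- apply: continuous_in_subspaceT => x; rewrite inE /= => /andP[r1x _].
  apply: continuous_comp; last exact: norm_continuous.
  by apply: cu; exact: lt_le_trans r1x.
exists `|u c| => // x hx; apply: hc; rewrite inE; exact: hx.
Qed.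

(** On a shell of radius [R] the weight [R^(-(beta+2))] against the bound [R^(1+beta)] of
    [shell_small] leaves [1/R], and over dyadic shells these sum to a geometric series. The bound is
    uniform in the outer radius [r2]. *)
Lemma weighted_bound u (p beta R0 r r0 : R) : 0 < R0 -> R0 <= r -> R0 < r0 -> 1 <= p ->
  0 <= beta ->
  n%:R = 1 + 2 * beta -> beta * p <= n%:R ->
  (forall x, exterior R0 x -> {for x, continuous u}) ->
  (\int[lebesgueN n]_(t in E r) (`|u (row_of_tuple t)| `^ p)%:E < +oo)%E ->
  exists2 W, 0 <= W & forall F (r2 : R), ccont F ->
    (forall x, `|F x| <= `|u x| * enorm x `^ (- (beta + 2))) ->
    (forall x, enorm x <= r0 \/ r2 <= enorm x -> F x = 0) -> `|intN F| <= W.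
Proof.
move=> R00 R0r R0r0 p1 beta0 nE bp cu uoo.
have [R1 [R11 _ sh]] := shell_small R00 R0r p1 nE bp cu uoo (ltr01 : 0 < 1 :> R).
have [chi [chi_1 [chi_2 [Cchi [dchi _ _ chi01 [chi1 chi2 _ _ _]]]]]] := @ex_cutoff R.
have cchi : continuous chi by move=> t; exact: (is_derive_continuous (dchi t)).
pose rho := 2 * R1.
have rho0 : 0 < rho by rewrite /rho; lra.
have r00 : 0 < r0 by exact: lt_trans R0r0.
have [C C0 uC] := bounded_on_shell rho R0r0 cu.
pose W0 := C * r0 `^ (- (beta + 2)) * (2 * rho) ^+ n.
have W00 : 0 <= W0 by rewrite !mulr_ge0// ?powR_ge0 ?exprn_ge0// mulr_ge0// ltW.
exists (W0 + 4 / rho); first by rewrite addr_ge0// divr_ge0// ltW.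
(* Partial sums of the geometric series. At stage [m], a cut-off at [R2 = 2^m R1] splits off a piece
   carried by [R2 <= |x| <= 4 R2], which costs [1/R2], that is [4/rho] times [2^-m - 2^-(m+1)]. The
   shells overlap because the cut-off needs [R2 <= |x| <= 2 R2] to descend. *)
suff H m F : ccont F -> (forall x, `|F x| <= `|u x| * enorm x `^ (- (beta + 2))) ->
    (forall x, enorm x <= r0 \/ 2 ^+ m * rho <= enorm x -> F x = 0) ->
    `|intN F| <= W0 + (4 / rho) * (1 - 2 ^- m).
  move=> F r2 cF Fu F0.
  apply: le_trans (H (Num.truncn r2).+1 F cF Fu _) _.
    move=> x [xr0|xr2]; apply: F0; [by left|right].
    apply: le_trans xr2; apply: le_trans (ltW (truncnS_gt _)) _.
    apply: le_trans (_ : 2 ^+ (Num.truncn r2).+1 * 1 <= _).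
      by rewrite mulr1 -natrX ler_nat ltnW// ltn_expl.
    by rewrite ler_pM2l ?exprn_gt0// /rho; lra.
  by rewrite lerD2l ler_piMr ?divr_ge0 ?(ltW rho0)// lerBlDr lerDl invr_ge0 exprn_ge0.
elim: m F => [|m ih] F cF Fu F0.
  rewrite expr0 invr1 subrr mulr0 addr0.
  apply: (@intN_box_upper _ _ _ _ _ 0) => //.
  - by rewrite mulr_ge0// powR_ge0.
  - exact: ltW.
  - move=> x; have [/orP xF|] := boolP ((enorm x <= r0) || (2 ^+ 0 * rho <= enorm x)).
      by rewrite F0// normr0 mulr_ge0// powR_ge0.
    rewrite negb_or -!ltNge expr0 mul1r => /andP[r0x xrho].
    apply: le_trans (Fu x) _; apply: ler_pM => //; first exact: powR_ge0.
      by apply: uC; rewrite !ltW.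
    rewrite !powRN lef_pV2 ?posrE ?powR_gt0//; last exact: lt_trans r0x.
    apply: ge0_ler_powR; rewrite ?nnegrE ?enorm_ge0 ?(ltW r00) ?(ltW r0x)//.
    by rewrite addr_ge0.
  - move=> x; rewrite subr0 => rx; apply: F0; right.
    by rewrite expr0 mul1r; exact: le_trans (ltW rx) (normr_le_enorm x).
pose R2 := 2 ^+ m * R1.
have p2m : 1 <= 2 ^+ m :> R by rewrite exprn_ege1// ler1n.
have R2R1 : R1 <= R2 by rewrite /R2 ler_peMl//; lra.
have R20 : 0 < R2 by lra.
have R2E : 2 * R2 = 2 ^+ m * rho by rewrite /R2 /rho; ring.
have R4E : 4 * R2 = 2 ^+ m.+1 * rho by rewrite exprS /R2 /rho; ring.
pose th (x : 'rV[R]_n) : R := chi (enorm x / R2).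
have cth : continuous th.
  apply: continuous_chain => //; apply: continuous_mul; first exact: continuous_enorm.
  exact: cst_continuous.
have th01 x : 0 <= th x <= 1 by exact: chi01.
have cF1 : ccont (fun x => th x * F x) by exact: ccontMl.
have cF2 : ccont (fun x => F x - th x * F x) by exact: ccontB.
have nF1 x : `|th x * F x| <= `|F x|.
  by have /andP[t0 t1] := th01 x; rewrite normrM ger0_norm// ler_piMl.
have nF2 x : `|F x - th x * F x| <= `|F x|.
  have /andP[t0 t1] := th01 x.
  by rewrite -{1}[F x]mul1r -mulrBl normrM ger0_norm ?subr_ge0// ler_piMl// gerBl.
have h1 : `|intN (fun x => th x * F x)| <= W0 + (4 / rho) * (1 - 2 ^- m).
  apply: ih => //; first by move=> x; exact: le_trans (nF1 x) (Fu x).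
  move=> x [xr0|xr2]; first by rewrite F0 ?mulr0//; left.
  by rewrite /th chi2 ?mul0r// ler_pdivlMr// R2E.
have h2 : `|intN (fun x => F x - th x * F x)| <= R2^-1.
  pose a := R2 `^ (beta + 2).
  have a0 : 0 < a by rewrite powR_gt0.
  have := sh R2 R2R1 (fun x => a * (F x - th x * F x)) (ccontZ a cF2).
  rewrite intNZ// normrM gtr0_norm// => h.
  have {h} : a * `|intN (fun x => F x - th x * F x)| <= 1 * R2 `^ (1 + beta).
    apply: h => x.
      rewrite normrM gtr0_norm//.
      have [xR2|xR2] := leP (enorm x) R2.
        by rewrite /th chi1 ?mul1r ?subrr ?normr0 ?mulr0// ler_pdivrMr// mul1r.
      apply: le_trans (_ : a * (`|u x| * enorm x `^ (- (beta + 2))) <= _).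
        by rewrite ler_pM2l//; exact: le_trans (nF2 x) (Fu x).
      rewrite mulrCA ler_piMr// powRN ler_pdivrMr; last by rewrite powR_gt0//; exact:
        lt_trans xR2.
      rewrite mul1r; apply: ge0_ler_powR; rewrite ?nnegrE ?enorm_ge0 ?(ltW R20) ?(ltW xR2)//.
      by rewrite addr_ge0.
    move=> [xR2|xR2].
      by rewrite /th chi1 ?mul1r ?subrr ?mulr0// ler_pdivrMr// mul1r.
    by rewrite F0 ?mulr0 ?subrr ?mulr0//; right; rewrite -R4E ltW.
  rewrite mul1r -ler_pdivlMl//; move=> /le_trans; apply.
  rewrite /a -powRN -powRD; last by rewrite (gt_eqF R20) implybT.
  rewrite (_ : - (beta + 2) + (1 + beta) = -1); last by ring.
  by rewrite powR_inv1// ltW.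
have -> : intN F = intN (fun x => th x * F x) + intN (fun x => F x - th x * F x).
  by rewrite -intND//; congr intN; apply/funext => x; ring.
apply: le_trans (ler_normD _ _) _.
apply: le_trans (lerD h1 h2) _.
have -> : R2^-1 = (4 / rho) * (2 ^- m / 2).
  rewrite /R2 /rho.
  have : 2 ^+ m != 0 :> R by rewrite expf_neq0.
  have : R1 != 0 by rewrite gt_eqF//; lra.
  set q := 2 ^+ m => qn0 R1n0; field.
  by rewrite qn0 R1n0.
rewrite exprS [(2 * _)^-1]invfM -addrA -mulrDr lerD2l ler_pM2l ?divr_gt0//.
by move: (2 ^+ m)^-1 => q; lra.
Qed.

End Decay.

(** * Vanishing of the moments, and of the solution when 1 <= p *)

Section Rellich.
Context {R : realType} {n : nat}.
Context (u : 'rV[R]_n -> R) (du ddu : 'I_n -> 'rV[R]_n -> R) (om R0 : R).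
Context (R00 : 0 < R0) (om0 : 0 < om).
Context (cu : forall x, exterior R0 x -> {for x, continuous u}).
Context (cdu : forall x i, exterior R0 x -> {for x, continuous (du i)}).
Context (cddu : forall x i, exterior R0 x -> {for x, continuous (ddu i)}).
Context (hu : forall x i, exterior R0 x -> is_derive x (delta_mx ord0 i) u (du i x)).
Context (hdu : forall x i, exterior R0 x -> is_derive x (delta_mx ord0 i) (du i) (ddu i x)).
Context (hlap : forall x, exterior R0 x -> \sum_i ddu i x = - om ^+ 2 * u x).

Lemma near_enorm_lt (x : 'rV[R]_n) (r : R) : enorm x < r -> \near x, enorm x < r.
Proof.
move=> xr; have : nbhs (enorm x) [set s | s < r] by exact: lt_nbhsl.
exact: (@continuous_enorm R n x).
Qed.

Lemma exterior_or_near (P : R -> Prop) (r0 : R) : R0 < r0 -> (forall r, r <= r0 -> P r) ->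
  forall x : 'rV[R]_n, exterior R0 x \/ \near x, P (enorm x).
Proof.
move=> R0r0 Pr x; have [xR0|xR0] := ltP R0 (enorm x); [by left|right].
apply: filterS (near_enorm_lt (le_lt_trans xR0 R0r0)) => z /ltW; exact: Pr.
Qed.

Lemma continuous_powR_mul (h : R -> R) (a r0 : R) : 0 < r0 -> continuous h ->
  (forall r, r <= r0 -> h r = 0) -> continuous (fun r => r `^ a * h r).
Proof.
move=> r00 ch h0; apply: (continuous_glue r00).
  move=> r rp; apply: cvgM; last exact: ch.
  exact: (is_derive_continuous (is_derive1_powR a rp)).
by move=> r rr0; rewrite h0// mulr0.
Qed.

Lemma ccont_moment (y : 'rV[R]_n) (k : nat) (a r0 r2 : R) (h : R -> R) : R0 < r0 ->
  continuous h -> (forall r, r <= r0 -> h r = 0) -> (forall r, r2 <= r -> h r = 0) ->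
  ccont (fun x => u x * (dot y x ^+ k * (enorm x `^ a * h (enorm x)))).
Proof.
move=> R0r0 ch h0 h2.
have r00 : 0 < r0 by exact: lt_trans R0r0.
have ch' := @continuous_powR_mul h a r0 r00 ch h0.
apply: (ccont_mul_on cu).
  apply: ccontMl; first by apply: continuous_pow; exact: continuous_dot.
  split; first exact: (continuous_chain ch' (@continuous_enorm R n)).
  exists r2 => x xr2; rewrite h2 ?mulr0//.
  by rewrite (le_trans (ltW xr2))// normr_le_enorm.
move=> x; have [|hx] := exterior_or_near R0r0 h0 x; [by left|right].
by apply: filterS hx => z ->; rewrite !mulr0.
Qed.

Lemma dot_le (y x : 'rV[R]_n) : `|dot y x| <= (\sum_i `|y ord0 i|) * enorm x.
Proof.
apply: le_trans (ler_norm_sum _ _ _) _; rewrite mulr_suml.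
apply: ler_sum => i _; rewrite normrM ler_wpM2l//.
apply: le_trans (normr_le_enorm x).
by have /mx_norm_leP := lexx `|x|; apply.
Qed.

(** The vanishing of [T_k], with radial test functions expressed in [s = |x|^2] as in
    [green_radial]. *)
Definition vanishing (k : nat) (y : 'rV[R]_n) := forall (F : R -> R) (r0 s1 : R),
  R0 < r0 -> continuous F -> (forall s, s <= r0 ^+ 2 -> F s = 0) ->
  (forall s, s1 <= s -> F s = 0) ->
  intN (fun x => u x * (dot y x ^+ k * F (sqn x))) = 0.

(* The factor r^-l, l = (n-1)/2 + k, removes the first order term of the radial
   operator and creates the potential l (l-1) / r^2. *)
Lemma moment_identity (k : nat) (y : 'rV[R]_n) (l r0 r2 : R) (z z1 z2 : R -> R) :
  2 * l = n%:R - 1 + 2 * k%:R -> ((1 < k)%N -> vanishing k.-2 y) ->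
  R0 < r0 -> r0 <= r2 ->
  (forall r : R, is_derive r 1 z (z1 r)) -> (forall r : R, is_derive r 1 z1 (z2 r)) ->
  continuous z2 ->
  (forall r, r <= r0 \/ r2 <= r -> [/\ z r = 0, z1 r = 0 & z2 r = 0]) ->
  intN (fun x => u x * (dot y x ^+ k * (enorm x `^ (- l) * (z2 (enorm x)
     + om ^+ 2 * z (enorm x) - l * (l - 1) * z (enorm x) / enorm x ^+ 2)))) = 0.
Proof.
move=> lE van R0r0 r0r2 dz dz1 cz2 z0.
have r00 : 0 < r0 by exact: lt_trans R0r0.
have r20 : 0 < r2 by exact: lt_le_trans r0r2.
(* The substitution [r = sqrt s]: [F] is [r^-l z (r)] as a function of [s], and [F1], [F2] are its
   first two derivatives in [s], with [V] for [1/r]. *)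
pose P (s : R) : R := Num.sqrt s `^ (- l).
pose V (s : R) : R := (Num.sqrt s)^-1.
pose Z (s : R) : R := z (Num.sqrt s).
pose Z1 (s : R) : R := z1 (Num.sqrt s).
pose Z2 (s : R) : R := z2 (Num.sqrt s).
pose F (s : R) : R := P s * Z s.
pose F1 (s : R) : R := 2^-1 * (P s * (Z1 s * V s - l * (Z s * (V s * V s)))).
pose F2 (s : R) : R := 4^-1 * (P s * (Z2 s * (V s * V s)
  - (2 * l + 1) * (Z1 s * (V s * (V s * V s)))
  + (l ^+ 2 + 2 * l) * (Z s * (V s * V s * (V s * V s))))).
have sp (s : R) : 0 < s -> 0 < Num.sqrt s by rewrite sqrtr_gt0.
have dS (s : R) : 0 < s -> is_derive s 1 Num.sqrt (2^-1 * V s).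
  by move=> s0; apply: (is_derive_eq (is_derive1_sqrt s0)); rewrite invfM.
have dV (s : R) : 0 < s -> is_derive s 1 V (- 2^-1 * (V s * (V s * V s))).
  move=> s0; have sn0 : Num.sqrt s != 0 by rewrite gt_eqF// sp.
  split; first by apply: derivableV => //; have [] := dS s s0.
  rewrite deriveV//; last by have [] := dS s s0.
  have [_ ->] := dS s s0; rewrite -[_ *: _]/(_ * _) /V; field; exact: sn0.
have dP (s : R) : 0 < s -> is_derive s 1 P (- (l / 2) * (P s * (V s * V s))).
  move=> s0; apply: (is_derive_eq (is_derive_chain (g := fun s : R => Num.sqrt s)
    (is_derive1_powR (- l) (sp s s0)) (dS s s0))).
  rewrite powRD; last by rewrite (gt_eqF (sp s s0)) implybT.
  by rewrite powR_inv1 ?sqrtr_ge0// -/(V s) -/(P s); field.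
have dZ (s : R) : 0 < s -> is_derive s 1 Z (2^-1 * (Z1 s * V s)).
  move=> s0; apply: (is_derive_eq (is_derive_chain (g := fun s : R => Num.sqrt s) (dz _) (dS
    s s0))).
  by rewrite /Z1; ring.
have dZ1 (s : R) : 0 < s -> is_derive s 1 Z1 (2^-1 * (Z2 s * V s)).
  move=> s0; apply: (is_derive_eq (is_derive_chain (g := fun s : R => Num.sqrt s) (dz1 _) (dS
    s s0))).
  by rewrite /Z2; ring.
have Z0 s : s <= r0 ^+ 2 \/ r2 ^+ 2 <= s -> [/\ Z s = 0, Z1 s = 0 & Z2 s = 0].
  move=> hs; apply: z0; case: hs => hs; [left|right].
    by rewrite -(ger0_norm (ltW r00)) -sqrtr_sqr; exact: ler_wsqrtr.
  by rewrite -(ger0_norm (ltW r20)) -sqrtr_sqr; exact: ler_wsqrtr.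
have Fz s : s <= r0 ^+ 2 \/ r2 ^+ 2 <= s -> [/\ F s = 0, F1 s = 0 & F2 s = 0].
  by move=> /Z0 [z_0 z_1 z_2]; rewrite /F /F1 /F2 z_0 z_1 z_2; split; ring.
have r002 : 0 < r0 ^+ 2 by rewrite exprn_gt0.
have hF (s : R) : is_derive s 1 F (F1 s).
  move: s; apply: (is_derive_glue r002).
  - move=> s s0; apply: (is_derive_eq (is_derive_funM (dP s s0) (dZ s s0))).
    by rewrite /F1; field.
  - by move=> s hs; have [] := Fz s (or_introl hs).
  - by move=> s hs; have [] := Fz s (or_introl hs).
have hF1 (s : R) : is_derive s 1 F1 (F2 s).
  move: s; apply: (is_derive_glue r002).
  - move=> s s0; apply: (is_derive_eq (is_derive_funZ 2^-1 (is_derive_funM (dP s s0)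
      (is_derive_funB (is_derive_funM (dZ1 s s0) (dV s s0)) (is_derive_funZ l (is_derive_funM
        (dZ s s0)
        (is_derive_funM (dV s s0) (dV s s0)))))))).
    by rewrite /F2; field.
  - by move=> s hs; have [] := Fz s (or_introl hs).
  - by move=> s hs; have [] := Fz s (or_introl hs).
have cF2 : continuous F2.
  apply: (continuous_glue r002); last by move=> s hs; have [] := Fz s (or_introl hs).
  move=> s s0.
  have cP := is_derive_continuous (dP s s0).
  have cV := is_derive_continuous (dV s s0).
  have cZ := is_derive_continuous (dZ s s0).
  have cZ1 := is_derive_continuous (dZ1 s s0).
  have cZ2 : {for s, continuous Z2}.
    by apply: continuous_comp; [exact: sqrt_continuous|exact: cz2].
  apply: cvgM; first exact: cvg_cst.
  apply: cvgM; first exact: cP.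
  apply: cvgD; first apply: cvgB.
  - by apply: cvgM; [exact: cZ2|exact: (cvgM cV cV)].
  - apply: cvgM; first exact: cvg_cst.
    by apply: cvgM; [exact: cZ1|exact: (cvgM cV (cvgM cV cV))].
  - apply: cvgM; first exact: cvg_cst.
    by apply: cvgM; [exact: cZ|exact: (cvgM (cvgM cV cV) (cvgM cV cV))].
have hF0 s : r2 ^+ 2 <= s -> [/\ F s = 0, F1 s = 0 & F2 s = 0].
  by move=> hs; exact: Fz (or_intror hs).
have cF : continuous F by move=> s; exact: (is_derive_continuous (hF s)).
have AF0 (x : 'rV[R]_n) : exterior R0 x \/ \near x, F (sqn x) = 0.
  have [xR0|xR0] := ltP R0 (enorm x); [by left|right].
  apply: filterS (near_enorm_lt (le_lt_trans xR0 R0r0)) => w /ltW wr0.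
  have [] // := Fz (sqn w); left.
  by rewrite -sqr_enorm ler_pXn2r// ?nnegrE ?enorm_ge0// ltW.
have AF (x : 'rV[R]_n) : exterior R0 x \/ \near x, F (sqn (x - 0)) = 0.
  by have [|hx] := AF0 x; [left|right; apply: filterS hx => w; rewrite subr0].
have := green_radial y k cu cdu cddu hu hdu hlap hF hF1 cF2 hF0 AF.
pose A (x : 'rV[R]_n) : R := u x * (dot y x ^+ k.-2 * F (sqn x)).
pose H (s : R) : R := 4 * s * F2 s + (2 * n%:R + 4 * k%:R) * F1 s + om ^+ 2 * F s.
pose B (x : 'rV[R]_n) : R := u x * (dot y x ^+ k * H (sqn x)).
have cF1 : continuous F1 by move=> s; exact: (is_derive_continuous (hF1 s)).
have cH : continuous H.
  apply: continuous_add; first apply: continuous_add.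
  - apply: continuous_mul => //; apply: continuous_mul; first exact: cst_continuous.
    by move=> s; exact: cvg_id.
  - by apply: continuous_mul => //; exact: cst_continuous.
  - by apply: continuous_mul => //; exact: cst_continuous.
have Hz s : s <= r0 ^+ 2 \/ r2 ^+ 2 <= s -> H s = 0.
  by move=> /Fz [f0 f1 f2]; rewrite /H f0 f1 f2; ring.
have ccA : ccont A.
  apply: (ccont_mul_on cu).
    apply: ccontMl; first by apply: continuous_pow; exact: continuous_dot.
    have := @ccont_radial R n 0 F (r2 ^+ 2) cF.
    under eq_fun do rewrite subr0.
    by apply => s /hF0[].
  move=> x; have [|hx] := AF0 x; [by left|right].
  by apply: filterS hx => w ->; rewrite mulr0.
have ccontB : ccont B.
  apply: (ccont_mul_on cu).
    apply: ccontMl; first by apply: continuous_pow; exact: continuous_dot.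
    have := @ccont_radial R n 0 H (r2 ^+ 2) cH.
    under eq_fun do rewrite subr0.
    by apply => s hs; apply: Hz; right.
  move=> x.
  have [xR0|xR0] := ltP R0 (enorm x); [by left|right].
  apply: filterS (near_enorm_lt (le_lt_trans xR0 R0r0)) => w /ltW wr0.
  rewrite Hz ?mulr0//; left.
  by rewrite -sqr_enorm ler_pXn2r// ?nnegrE ?enorm_ge0// ltW.
have -> : (fun x => u x * ((k * k.-1)%:R * sqn y * dot y (x - 0) ^+ k.-2 * F (sqn (x - 0)) +
     dot y (x - 0) ^+ k * (4 * sqn (x - 0) * F2 (sqn (x - 0)) +
      (2 * n%:R + 4 * k%:R) * F1 (sqn (x - 0))) +
     om ^+ 2 * (dot y (x - 0) ^+ k * F (sqn (x - 0))))) =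
   (fun x => ((k * k.-1)%:R * sqn y) * A x + B x).
  by apply/funext => x; rewrite subr0 /A /B /H; ring.
rewrite intND//; last exact: ccontZ.
rewrite intNZ//.
(* The term in [|y|^2] is a moment of order [k - 2], zero by hypothesis; for [k <= 1] its
   coefficient is zero. *)
have -> : (k * k.-1)%:R * sqn y * intN A = 0.
  have [k1|k1] := ltnP 1 k; last first.
    by move: k1; case: (k) => [|[|//]] _; rewrite ?mul0n ?muln0 !mul0r.
  by rewrite (van k1 F r0 (r2 ^+ 2)) ?mulr0// => s hs; have [] := Fz s _ => //; [left|right].
rewrite add0r => JB0; rewrite -[RHS]JB0; congr intN; apply/funext => x.
rewrite /B; congr (_ * (_ * _)).
have [xr0|r0x] := leP (enorm x) r0.
  have [-> _ ->] := z0 _ (or_introl xr0); rewrite Hz; first by rewrite !mulr0 mul0r subr0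
    addr0 mulr0.
  by left; rewrite -sqr_enorm ler_pXn2r// ?nnegrE ?enorm_ge0// ltW.
have xp : 0 < enorm x by exact: lt_trans r0x.
rewrite /H /F /F1 /F2 /P /Z /Z1 /Z2 /V -enormE -sqr_enorm.
(* The choice of [l] acts here: [4 s F2] contributes [- (2l+1) z' / r], which [2 (2l+1) F1] cancels,
   and the terms in [z / r^2] add up to [l^2 + 2l - l (2l+1) = - l (l-1)]. *)
have -> : 2 * n%:R + 4 * k%:R = 2 * (2 * l + 1) by rewrite lE; ring.
have : enorm x != 0 by rewrite gt_eqF.
move: (enorm x) (z _) (z1 _) (z2 _) (_ `^ _) => e a b c d e0.
by field.
Qed.

Context (p beta r : R) (R0r : R0 <= r) (p1 : 1 <= p) (beta0 : 0 <= beta).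
Context (nE : n%:R = 1 + 2 * beta) (bp : beta * p <= n%:R).
Context (uoo : (\int[lebesgueN n]_(t in (@row_of_tuple R n) @^-1` (exterior r))
  (`|u (row_of_tuple t)| `^ p)%:E < +oo)%E).

(** The functional [S] of the overview, [beta + k%:R] being [(n-1)/2 + k]. *)
Definition moment (k : nat) (y : 'rV[R]_n) (h : R -> R) : R :=
  intN (fun x => u x * (dot y x ^+ k * (enorm x `^ (- (beta + k%:R)) * h (enorm x)))).

Let dot_coef (k : nat) (y : 'rV[R]_n) : R := (\sum_i `|y ord0 i|) ^+ k.

Lemma dot_coef_ge0 k y : 0 <= dot_coef k y.
Proof. by rewrite exprn_ge0// sumr_ge0. Qed.

(** The growth of [(y.x)^k] cancels [r^-k], so that moments of all orders are estimated through
    [|u| r^-beta], the l1 norm of [y] giving the constant. *)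
Lemma moment_integrand_le (k : nat) (y x : 'rV[R]_n) (h : R -> R) :
  (forall r, r <= R0 -> h r = 0) ->
  `|u x * (dot y x ^+ k * (enorm x `^ (- (beta + k%:R)) * h (enorm x)))| <=
  dot_coef k y * (`|u x| * (enorm x `^ (- beta) * `|h (enorm x)|)).
Proof.
move=> h0; have [xR0|xR0] := leP (enorm x) R0.
  by rewrite h0// !mulr0 normr0 !mulr0.
have xp : 0 < enorm x by exact: lt_trans xR0.
rewrite !normrM normrX (ger0_norm (powR_ge0 _ _)).
rewrite [leRHS]mulrCA ler_wpM2l// !mulrA ler_wpM2r//.
apply: le_trans (_ : ((\sum_i `|y ord0 i|) * enorm x) ^+ k * enorm x `^ (- (beta + k%:R)) <= _).
  rewrite ler_wpM2r ?powR_ge0// lerXn2r ?nnegrE//; last exact: dot_le.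
  by rewrite mulr_ge0 ?enorm_ge0// sumr_ge0.
rewrite exprMn -/(dot_coef k y) -mulrA ler_wpM2l ?dot_coef_ge0//.
rewrite -powR_mulrn ?enorm_ge0// -powRD; last by rewrite (gt_eqF xp) implybT.
by rewrite (_ : k%:R + - (beta + k%:R) = - beta)//; ring.
Qed.


(* kap is so large that replacing g by b psi / r^2, psi being the Duhamel solution
   with source g, halves the constant K; both have the same moment up to the
   cut-off error. *)
Lemma moment_iterate (r0 Cc : R) (chi chi1 chi2 : R -> R) (W : R) (k : nat) (y : 'rV[R]_n) :
  R0 < r0 -> 0 <= W ->
  (forall t : R, is_derive t 1 chi (chi1 t)) ->
  (forall t : R, is_derive t 1 chi1 (chi2 t)) ->
  continuous chi2 -> (forall t, 0 <= chi t <= 1) ->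
  (forall t, 2 <= t -> chi t = 0) ->
  (forall t, t <= 1 \/ 2 <= t -> chi1 t = 0 /\ chi2 t = 0) ->
  0 <= Cc -> (forall t, `|chi1 t| <= Cc /\ `|chi2 t| <= Cc) ->
  (forall F (r2 : R), ccont F ->
    (forall x, `|F x| <= `|u x| * enorm x `^ (- (beta + 2))) ->
    (forall x, enorm x <= r0 \/ r2 <= enorm x -> F x = 0) -> `|intN F| <= W) ->
  ((1 < k)%N -> vanishing k.-2 y) ->
  exists2 kap, 0 < kap & forall (j : nat) (g : R -> R) (K : R), 0 <= K ->
    continuous g -> (forall r, r <= r0 -> g r = 0) ->
    (forall r, 0 < r -> `|g r| <= K * (r ^- 2 * expR (- kap / r))) ->
    forall eps, 0 < eps -> exists R1, forall R2, R1 <= R2 ->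
      `|moment k y (fun r => chi (r / R2) * g r)| <= dot_coef k y * K * W / 2 ^+ j + eps.
Proof.
move=> R0r0 W0 dchi dchi1 cchi2 chi01 chi_0 chi12_0 Cc0 chi12 Wb van.
have r00 : 0 < r0 by exact: lt_trans R0r0.
pose l := beta + k%:R.
have lE : 2 * l = n%:R - 1 + 2 * k%:R by rewrite nE /l; ring.
have [b bE] : exists b, b = l * (l - 1) by eexists.
(* The new source is at most [|b| * 2 K / (kap om)] times the weight, hence [K / 2] times it once
   [kap om >= 4 |b|]; the added 1 keeps [kap] positive when [b = 0]. *)
pose kap := 4 * `|b| / om + 1.
have kap0 : 0 < kap by rewrite /kap ltr_wpDl// divr_ge0// ?mulr_ge0// ltW.
have cchi : continuous chi by move=> t; exact: (is_derive_continuous (dchi t)).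
have cchi1 : continuous chi1 by move=> t; exact: (is_derive_continuous (dchi1 t)).
have cscale (h : R -> R) (c : R) : continuous h -> continuous (fun r : R => h (r / c)).
  move=> ch; apply: continuous_chain => //.
  by apply: continuous_mul; [move=> s; exact: cvg_id|exact: cst_continuous].
have ccm (h : R -> R) (r2 : R) : continuous h -> (forall r, r <= r0 -> h r = 0) ->
    (forall r, r2 <= r -> h r = 0) ->
    ccont (fun x => u x * (dot y x ^+ k * (enorm x `^ (- l) * h (enorm x)))).
  by move=> ch h0 h2; exact: (ccont_moment y k (- l) R0r0 ch h0 h2).
have h0R (h : R -> R) : (forall r, r <= r0 -> h r = 0) -> (forall r, r <= R0 -> h r = 0).
  by move=> h0 s sR0; apply: h0; exact: le_trans sR0 (ltW R0r0).
exists kap => //; elim => [|j ih] g K K0 cg g0 gK eps eps0.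
  (* Before any iteration the source is bounded by [K r^-2], and [weighted_bound] applies uniformly
     in [R2], after normalising by [dot_coef k y * K]. *)
  exists 1 => R2 R21; rewrite expr0 divr1.
  have R20 : 0 < R2 by exact: lt_le_trans R21.
  apply: le_trans (_ : dot_coef k y * K * W <= _); last by rewrite lerDl ltW.
  pose h (s : R) : R := chi (s / R2) * g s.
  have ch : continuous h by apply: continuous_mul => //; exact: cscale.
  have h0 s : s <= r0 -> h s = 0 by move=> hs; rewrite /h g0// mulr0.
  have h2 s : 2 * R2 <= s -> h s = 0.
    by move=> hs; rewrite /h chi_0 ?mul0r// ler_pdivlMr.
  have cF := ccm h (2 * R2) ch h0 h2.
  pose F (x : 'rV[R]_n) : R := u x * (dot y x ^+ k * (enorm x `^ (- l) * h (enorm x))).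
  have FE (x : 'rV[R]_n) : `|F x| <= (dot_coef k y * K) * (`|u x| * enorm x `^ (- (beta + 2))).
    apply: le_trans (moment_integrand_le _ _ _ (h0R _ h0)) _.
    rewrite -mulrA ler_wpM2l ?dot_coef_ge0// [leRHS]mulrCA ler_wpM2l//.
    have [xr0|xr0] := leP (enorm x) r0.
      by rewrite h0// normr0 mulr0 mulr_ge0// powR_ge0.
    have xp : 0 < enorm x by exact: lt_trans xr0.
    rewrite opprD powRD; last by rewrite (gt_eqF xp) implybT.
    rewrite mulrCA ler_wpM2l ?powR_ge0//.
    rewrite (powR_invn 2) ?(ltW xp)//.
    have /andP[c0 c1] := chi01 (enorm x / R2).
    rewrite /h normrM (ger0_norm c0).
    apply: le_trans (_ : `|g (enorm x)| <= _); first by rewrite ler_piMl.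
    apply: le_trans (gK _ xp) _; rewrite ler_wpM2l//.
    rewrite ler_piMr ?invr_ge0 ?exprn_ge0 ?(ltW xp)//.
    by rewrite -expR0 ler_expR mulNr oppr_le0 divr_ge0// ltW.
  have [c0|cn0] := eqVneq (dot_coef k y * K) 0.
    rewrite c0 mul0r /moment -/F (_ : F = fun=> 0) ?intN0 ?normr0//.
    apply/funext => x; apply/eqP; rewrite -normr_le0.
    by apply: le_trans (FE x) _; rewrite c0 mul0r.
  have cp : 0 < dot_coef k y * K by rewrite lt_neqAle eq_sym cn0 mulr_ge0// dot_coef_ge0.
  rewrite /moment -/(F) mulrC -ler_pdivrMr//.
  have := Wb (fun x => (dot_coef k y * K)^-1 * F x) (2 * R2) (ccontZ _ cF).
  rewrite intNZ// normrM gtr0_norm ?invr_gt0// => hW; rewrite mulrC; apply: hW.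
    by move=> x; rewrite normrM gtr0_norm ?invr_gt0// ler_pdivrMl.
  by move=> x [/h0|/h2] hx; rewrite /F hx !mulr0.
have [psi [psi1 [dpsi dpsi1 psi0 psib psi1b]]] := duhamel r00 om0 kap0 K0 cg g0 gK.
pose g' (s : R) : R := b * psi s / s ^+ 2.
have cpsi : continuous psi by move=> s; exact: (is_derive_continuous (dpsi s)).
have cpsi1 : continuous psi1 by move=> s; exact: (is_derive_continuous (dpsi1 s)).
have g'0 s : s <= r0 -> g' s = 0 by move=> /psi0[h _]; rewrite /g' h mulr0 mul0r.
have cg' : continuous g'.
  apply: (continuous_glue r00) => // s sp; apply: cvgM.
    by apply: cvgM; [exact: cvg_cst|exact: cpsi].
  apply: cvgV; first by rewrite expf_neq0// gt_eqF.
  by apply: (continuous_pow (g := id)) => t; exact: cvg_id.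
have K20 : 0 <= K / 2 by rewrite divr_ge0.
have g'K s : 0 < s -> `|g' s| <= K / 2 * (s ^- 2 * expR (- kap / s)).
  move=> sp; rewrite /g' !normrM normfV normrX (gtr0_norm sp).
  apply: le_trans (_ : `|b| * (2 * K / (kap * om) * expR (- kap / s)) / s ^+ 2 <= _).
    by rewrite ler_wpM2r ?invr_ge0 ?exprn_ge0 ?(ltW sp)// ler_wpM2l// psib.
  rewrite (_ : `|b| * _ / _ = (`|b| * (2 * K / (kap * om))) * (s ^- 2 * expR (- kap / s)));
    last by ring.
  rewrite ler_wpM2r ?mulr_ge0 ?expR_ge0 ?invr_ge0 ?exprn_ge0 ?(ltW sp)//.
  rewrite mulrA ler_pdivrMr ?mulr_gt0// /kap.
  rewrite (_ : K / 2 * ((4 * `|b| / om + 1) * om) = `|b| * (2 * K) + K / 2 * om); last first.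
    by field; rewrite gt_eqF.
  by rewrite lerDl mulr_ge0// ltW.
have eps20 : 0 < eps / 2 by rewrite divr_gt0.
have [R1 hR1] := ih g' (K / 2) K20 cg' g'0 g'K (eps / 2) eps20.
pose M1 := 2 * K / kap; pose M0 := 2 * K / (kap * om).
have M10 : 0 <= M1 by rewrite divr_ge0 ?mulr_ge0 ?(ltW kap0).
have M00 : 0 <= M0 by rewrite divr_ge0 ?mulr_ge0 ?(ltW kap0) ?(ltW om0).
have eb s : 0 < s -> expR (- kap / s) <= 1.
  by move=> sp; rewrite -expR0 ler_expR mulNr oppr_le0 divr_ge0// ltW.
(* [C' / R2] will bound the cut-off error, since each derivative falling on the cut-off gains
   [1/R2]. [D] exceeds [dot_coef k y * C'] by 1 so as to be positive. *)
pose C' := 2 * M1 * Cc + M0 * Cc.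
have C'0 : 0 <= C' by apply: addr_ge0; apply: mulr_ge0 => //; apply: mulr_ge0.
pose D := dot_coef k y * C' + 1.
have D0 : 0 < D by rewrite ltr_wpDl// mulr_ge0// dot_coef_ge0.
have [R1' [R1'1 _ sh]] := shell_small R00 R0r p1 nE bp cu uoo (divr_gt0 eps20 D0).
exists (Num.max R1 (Num.max R1' r0)) => R2; rewrite !ge_max => /and3P[R12 R1'2 r02].
have R21 : 1 <= R2 by exact: le_trans R1'2.
have R20 : 0 < R2 by exact: lt_le_trans R21.
pose X (s : R) : R := chi (s / R2).
pose X1 (s : R) : R := chi1 (s / R2) / R2.
pose X2 (s : R) : R := chi2 (s / R2) / R2 / R2.
have dX (s : R) : is_derive s 1 X (X1 s).
  apply: (is_derive_eq (is_derive_chain (g := fun s : R => s / R2) (dchi _)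
    (is_derive_funM (is_derive_id s 1) (is_derive_cst (R2^-1) s 1)))).
  by rewrite /X1 mul1r /= mulr0 addr0.
have dX1 (s : R) : is_derive s 1 X1 (X2 s).
  apply: (is_derive_eq (is_derive_funM (is_derive_chain (g := fun s : R => s / R2) (dchi1 _)
    (is_derive_funM (is_derive_id s 1) (is_derive_cst (R2^-1) s 1))) (is_derive_cst (R2^-1) s
      1))).
  by rewrite /X2 mul1r /= !mulr0 !addr0.
have cX2 : continuous X2.
  apply: continuous_mul; last exact: cst_continuous.
  by apply: continuous_mul; [exact: cscale|exact: cst_continuous].
have cX : continuous X by exact: cscale.
have cX1 : continuous X1 by apply: continuous_mul; [exact: cscale|exact: cst_continuous].
pose z (s : R) : R := psi s * X s.
pose z1 (s : R) : R := psi1 s * X s + psi s * X1 s.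
pose z2 (s : R) : R := ((g s - om ^+ 2 * psi s) * X s + psi1 s * X1 s)
   + (psi1 s * X1 s + psi s * X2 s).
have dz (s : R) : is_derive s 1 z (z1 s) by exact: (is_derive_funM (dpsi s) (dX s)).
have dz1 (s : R) : is_derive s 1 z1 (z2 s).
  exact: (is_derive_funD (is_derive_funM (dpsi1 s) (dX s)) (is_derive_funM (dpsi s) (dX1 s))).
(* The cut-off error: [z2 + om^2 z = X g + er]. It is carried by [R2 <= s <= 2 R2], where the
   derivatives of [X] live, while the potential term of [z] is [X g']; hence the moments of [X g]
   and [X g'] differ by that of [er]. *)
pose er (s : R) : R := 2 * (psi1 s * X1 s) + psi s * X2 s.
have cer : continuous er.
  by apply: continuous_add; apply: continuous_mul => //;
    [exact: cst_continuous|exact: continuous_mul].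
have cz2 : continuous z2.
  apply: continuous_add; last by apply: continuous_add; exact: continuous_mul.
  apply: continuous_add; last exact: continuous_mul.
  apply: continuous_mul => // s; apply: cvgB; first exact: cg.
  by apply: cvgM; [exact: cvg_cst|exact: cpsi].
have X0 s : 2 * R2 <= s -> [/\ X s = 0, X1 s = 0 & X2 s = 0].
  move=> hs; have s2 : 2 <= s / R2 by rewrite ler_pdivlMr.
  have [e1 e2] := chi12_0 _ (or_intror s2).
  by rewrite /X /X1 /X2 chi_0// e1 e2 !mul0r.
have z0 s : s <= r0 \/ 2 * R2 <= s -> [/\ z s = 0, z1 s = 0 & z2 s = 0].
  move=> [hs|/X0[e0 e1 e2]]; last by rewrite /z /z1 /z2 e0 e1 e2; split; ring.
  have [p0 p_1] := psi0 s hs.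
  by rewrite /z /z1 /z2 p0 p_1 g0//; split; ring.
have r02R : r0 <= 2 * R2 by lra.
have := moment_identity lE van R0r0 r02R dz dz1 cz2 z0.
have h1 : ccont (fun x => u x * (dot y x ^+ k * (enorm x `^ (- l) * (X (enorm x) * g (enorm
  x))))).
  apply: (ccm (fun s => X s * g s) (2 * R2)).
  - exact: continuous_mul.
  - by move=> s hs; rewrite g0// mulr0.
  - by move=> s /X0[-> _ _]; rewrite mul0r.
have h2 : ccont (fun x => u x * (dot y x ^+ k * (enorm x `^ (- l) * (X (enorm x) * g' (enorm
  x))))).
  apply: (ccm (fun s => X s * g' s) (2 * R2)).
  - exact: continuous_mul.
  - by move=> s hs; rewrite g'0// mulr0.
  - by move=> s /X0[-> _ _]; rewrite mul0r.
have er0 s : s <= r0 -> er s = 0.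
  by move=> /psi0[p0 p_1]; rewrite /er p0 p_1; ring.
have h3 : ccont (fun x => u x * (dot y x ^+ k * (enorm x `^ (- l) * er (enorm x)))).
  apply: (ccm er (2 * R2)) => //.
  by move=> s /X0[_ e1 e2]; rewrite /er e1 e2; ring.
have -> : (fun x => u x * (dot y x ^+ k * (enorm x `^ (- l) * (z2 (enorm x)
     + om ^+ 2 * z (enorm x) - l * (l - 1) * z (enorm x) / enorm x ^+ 2)))) =
  (fun x => (u x * (dot y x ^+ k * (enorm x `^ (- l) * (X (enorm x) * g (enorm x))))
    - u x * (dot y x ^+ k * (enorm x `^ (- l) * (X (enorm x) * g' (enorm x)))))
    + u x * (dot y x ^+ k * (enorm x `^ (- l) * er (enorm x)))).
  by apply/funext => x; rewrite /z2 /z /er /g' bE; ring.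
rewrite intND//; last exact: ccontB.
rewrite intNB// => idt.
have -> : moment k y (fun r => chi (r / R2) * g r) =
   moment k y (fun r => chi (r / R2) * g' r) -
   intN (fun x => u x * (dot y x ^+ k * (enorm x `^ (- l) * er (enorm x)))).
  by move: idt; rewrite /moment -/l /X; lra.
apply: le_trans (ler_normB _ _) _.
have -> : dot_coef k y * K * W / 2 ^+ j.+1 + eps =
  (dot_coef k y * (K / 2) * W / 2 ^+ j + eps / 2) + eps / 2.
  by rewrite exprS invfM; field; rewrite expf_neq0.
apply: lerD; first exact: hR1.
pose F (x : 'rV[R]_n) : R := u x * (dot y x ^+ k * (enorm x `^ (- l) * er (enorm x))).
rewrite -/F.
have er_b s : 0 < s -> `|er s| <= C' / R2.
  move=> sp; rewrite /er /C' [leRHS]mulrDl; apply: le_trans (ler_normD _ _) _.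
  have [c1 c2] := chi12 (s / R2).
  have pb : `|psi s| <= M0.
    by apply: le_trans (psib s sp) _; rewrite ler_piMr ?eb.
  have p1b : `|psi1 s| <= M1.
    by apply: le_trans (psi1b s sp) _; rewrite ler_piMr ?eb.
  have iR : 0 <= R2^-1 by rewrite invr_ge0 ltW.
apply: lerD.
    rewrite !normrM (ger0_norm (_ : 0 <= 2))// (ger0_norm iR) -!mulrA ler_wpM2l//.
    rewrite !mulrA ler_wpM2r//; exact: ler_pM.
  rewrite /X2 !normrM !(ger0_norm iR) !mulrA ler_wpM2r//.
  apply: le_trans (_ : `|psi s| * `|chi2 (s / R2)| <= _); last exact: ler_pM.
  by rewrite ler_piMr ?mulr_ge0// invf_le1.
have er_0 s : s <= R2 \/ 2 * R2 <= s -> er s = 0.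
  move=> hs; have [|e1 e2] := chi12_0 (s / R2).
    by case: hs => hs; [left; rewrite ler_pdivrMr// mul1r|right; rewrite ler_pdivlMr].
  by rewrite /er /X1 /X2 e1 e2; ring.
(* The factor that turns [|F| <= dot_coef k y * |u| * R2^(-beta) * C' / R2] into [|q F| <= |u|], the
   form in which [shell_small] takes its integrand. *)
pose q := R2 `^ (1 + beta) / D.
have q0 : 0 < q by rewrite divr_gt0// powR_gt0.
have := sh R2 R1'2 (fun x => q * F x) (ccontZ _ h3).
rewrite intNZ// normrM gtr0_norm// => h.
have {h} : q * `|intN F| <= eps / 2 / D * R2 `^ (1 + beta).
  apply: h => x.
    rewrite normrM gtr0_norm//.
    have [xR2|xR2] := leP (enorm x) R2.
      by rewrite /F er_0 ?mulr0 ?normr0 ?mulr0//; left.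
    have xp : 0 < enorm x by exact: lt_trans xR2.
    apply: le_trans (_ : q * (dot_coef k y * (`|u x| * (enorm x `^ (- beta) * `|er (enorm
      x)|))) <= _).
      by rewrite ler_pM2l//; apply: moment_integrand_le; exact: h0R.
    rewrite mulrA mulrCA ler_piMr//.
    apply: le_trans (_ : q * dot_coef k y * (R2 `^ (- beta) * (C' / R2)) <= _).
      apply: ler_wpM2l; first by rewrite mulr_ge0 ?dot_coef_ge0// ltW.
      apply: ler_pM; rewrite ?powR_ge0 ?er_b//.
      rewrite !powRN lef_pV2 ?posrE ?powR_gt0//.
      by apply: ge0_ler_powR; rewrite ?nnegrE ?(ltW xp) ?(ltW R20) ?(ltW xR2).
    rewrite /q powRD; last by rewrite (gt_eqF R20) implybT.
    rewrite powRr1 ?(ltW R20)// powRN.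
    have : R2 `^ beta != 0 by rewrite gt_eqF// powR_gt0.
    move: (R2 `^ beta) => B B0.
    rewrite (_ : R2 * B / D * dot_coef k y * (B^-1 * (C' / R2)) = dot_coef k y * C' / D).
      by rewrite ler_pdivrMr// mul1r /D lerDl.
    by field; rewrite B0 !gt_eqF.
  move=> [hx|hx]; rewrite /F er_0 ?mulr0//; [by left|right; lra].
rewrite (_ : eps / 2 / D * R2 `^ (1 + beta) = q * (eps / 2)); last by rewrite /q; ring.
by rewrite ler_pM2l.
Qed.

Lemma eq0_le_geometric (t A : R) : 0 <= A ->
  (forall (j : nat) (eps : R), 0 < eps -> `|t| <= A / 2 ^+ j + eps) -> t = 0.
Proof.
move=> A0 H; apply/eqP/negPn/negP => tn0.
have tp : 0 < `|t| / 2 by rewrite divr_gt0// normr_gt0.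
pose j := (Num.truncn (A / (`|t| / 2))).+1.
have Aj : A / 2 ^+ j < `|t| / 2.
  rewrite ltr_pdivrMr ?exprn_gt0// mulrC -ltr_pdivrMr//.
  apply: lt_le_trans (truncnS_gt _) _.
  by rewrite -natrX ler_nat ltnW// ltn_expl.
have := H j _ tp; have := splitr `|t|; lra.
Qed.

(** Induction in steps of two, as the Laplacian lowers the power of [y.x] by two. The source
    [g (r) = r^l F (r^2)] has compact support in positive radii, so it lies under some multiple of
    the weight whatever [kap] is; the bound of [moment_iterate] then holds for every [j] and every
    [eps]. *)
Lemma vanishing_all (k : nat) (y : 'rV[R]_n) : vanishing k y.
Proof.
elim/ltn_ind: k => k IH F r0 s1 R0r0 cF F0 Fs1.
have r00 : 0 < r0 by exact: lt_trans R0r0.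
have [W W0 Wb] := weighted_bound R00 R0r R0r0 p1 beta0 nE bp cu uoo.
have [chi [chi1 [chi2 [Cc [dchi dchi1 cchi2 chi01 [chi_1 chi_0 chi12_0 Cc0 chi12]]]]]] :=
  @ex_cutoff R.
have van : (1 < k)%N -> vanishing k.-2 y.
  by move=> k1; apply: IH; case: (k) k1 => [|[|m]].
have [kap kap0 it] := moment_iterate R0r0 W0 dchi dchi1 cchi2 chi01 chi_0 chi12_0 Cc0 chi12
  Wb van.
pose l := beta + k%:R.
(* Without the maximum, [s ^+ 2] would reach the support of [F] at negative [s]. *)
pose h (s : R) : R := F (Num.max s 0 ^+ 2).
have ch : continuous h.
  by apply: continuous_chain => //; exact: (@continuous_pospow R 2).
have h0 s : s <= r0 -> h s = 0.
  move=> hs; rewrite /h F0// lerXn2r ?nnegrE ?le_max ?lexx ?orbT ?(ltW r00)//.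
  by rewrite ge_max hs ltW.
(* [r2 >= 1] gives [s <= s ^+ 2] for [s >= r2], so that [s ^+ 2] is past [s1]. *)
pose r2 := r0 + `|s1| + 1.
have r2_1 : 1 <= r2 by rewrite /r2 lerDr addr_ge0// ltW.
have h2 s : r2 <= s -> h s = 0.
  move=> hs; rewrite /h Fs1// max_l; last by lra.
  apply: le_trans (_ : s <= _); last by rewrite expr2 ler_peMl//; lra.
  by apply: le_trans hs; apply: le_trans (ler_norm _) _; rewrite /r2; lra.
pose g (s : R) : R := s `^ l * h s.
have cg : continuous g by exact: (@continuous_powR_mul h l r0 r00 ch h0).
have g0 s : s <= r0 -> g s = 0 by move=> hs; rewrite /g h0// mulr0.
have g2 s : r2 <= s -> g s = 0 by move=> hs; rewrite /g h2// mulr0.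
have r02 : r0 <= r2 by rewrite /r2 -addrA lerDl addr_ge0.
have [|c _ gc] := @EVT_max R (fun s => `|g s|) r0 r2 r02.
  apply: continuous_subspaceT => s; apply: continuous_comp; first exact: cg.
  exact: norm_continuous.
(* A lower bound for the weight on [[r0, r2]], each factor being taken at the endpoint where it is
   smallest. *)
pose d := r2 ^- 2 * expR (- kap / r0).
have r20 : 0 < r2 by exact: lt_le_trans r2_1.
have d0 : 0 < d by rewrite mulr_gt0 ?expR_gt0// invr_gt0 exprn_gt0.
pose K := `|g c| / d.
have K0 : 0 <= K by rewrite divr_ge0// ltW.
have gK s : 0 < s -> `|g s| <= K * (s ^- 2 * expR (- kap / s)).
  move=> sp; have K0' : 0 <= K * (s ^- 2 * expR (- kap / s)).
    by rewrite mulr_ge0// mulr_ge0 ?expR_ge0// invr_ge0 exprn_ge0// ltW.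
  have [sr0|r0s] := leP s r0; first by rewrite g0// normr0.
  have [r2s|sr2] := leP r2 s; first by rewrite g2// normr0.
  apply: le_trans (_ : `|g c| <= _).
    by apply: gc; rewrite in_itv/= !ltW.
  rewrite /K mulrAC ler_pdivlMr// ler_wpM2l//.
  rewrite ler_pM ?expR_ge0 ?invr_ge0 ?exprn_ge0 ?(ltW r20)//.
    by rewrite lef_pV2 ?posrE ?exprn_gt0// lerXn2r ?nnegrE ?(ltW sp) ?(ltW r20) ?(ltW sr2).
  rewrite ler_expR !mulNr lerN2 ler_wpM2l ?(ltW kap0)// lef_pV2 ?posrE//.
  exact: ltW.
apply: (@eq0_le_geometric _ ((\sum_i `|y ord0 i|) ^+ k * K * W)).
  by apply: mulr_ge0 => //; apply: mulr_ge0 => //; apply: exprn_ge0; apply: sumr_ge0.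
move=> j eps eps0.
have [R1 hR1] := it j g K K0 cg g0 gK eps eps0.
(* For [R2 >= r2] the cut-off equals 1 on the support of [g] and leaves the moment unchanged. *)
pose R2 := Num.max R1 r2.
have R2R1 : R1 <= R2 by rewrite le_max lexx.
have R2r2 : r2 <= R2 by rewrite le_max lexx orbT.
apply: le_trans (hR1 R2 R2R1).
rewrite le_eqVlt; apply/orP; left; apply/eqP; congr `|_|.
rewrite /moment; congr intN; apply/funext => x; congr (_ * (_ * _)).
have xE : F (sqn x) = h (enorm x).
  by rewrite /h max_l ?enorm_ge0// sqr_enorm.
rewrite xE /g; have [xr0|r0x] := leP (enorm x) r0; first by rewrite h0// !mulr0.
have xp : 0 < enorm x by exact: lt_trans r0x.
have [xR2|R2x] := leP (enorm x) R2; last first.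
  by rewrite h2 ?mulr0//; exact: le_trans R2r2 (ltW R2x).
rewrite chi_1; last by rewrite ler_pdivrMr ?mul1r// (lt_le_trans r20).
rewrite mul1r mulrA -powRD; last by rewrite (gt_eqF xp) implybT.
by rewrite addNr powRr0 mul1r.
Qed.

(** * Concentration of Landau kernels at a point *)

Lemma near_norm_le (y : 'rV[R]_n) (P : 'rV[R]_n -> Prop) :
  (\near y, P y) -> exists2 d, 0 < d <= 1 & forall x, `|x - y| <= d -> P x.
Proof.
move=> /nbhs_normP[e /= e0 eP].
exists (Num.min 1 (e / 2)).
  by rewrite lt_min ltr01 divr_gt0//= ge_min lexx.
move=> x; rewrite le_min => /andP[_ xe]; apply: eP => /=.
by rewrite distrC; apply: le_lt_trans xe _; rewrite ltr_pdivrMr// ltr_pMr// ltr1n.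
Qed.

Lemma rellich (y : 'rV[R]_n) : exterior R0 y -> u y = 0.
Proof.
move=> yR0; apply/eqP/negPn/negP => uyn0.
pose e := enorm y.
have R0e : R0 < e by [].
have e0 : 0 < e by exact: lt_trans R0e.
pose r0 := (R0 + e) / 2.
have R0r0 : R0 < r0 by rewrite /r0; lra.
have r0e : r0 < e by rewrite /r0; lra.
have r00 : 0 < r0 by exact: lt_trans R0r0.
pose s1 := e ^+ 2 + 1.
have s10 : 0 < s1 by rewrite /s1 ltr_wpDl// exprn_ge0// ltW.
(* A weight in [s = |x|^2], positive exactly for [r0^2 < s < s1], a range that contains [|y|^2]. *)
pose th (s : R) : R := pospow 1 (s - r0 ^+ 2) * pospow 1 (s1 - s).
have cth : continuous th.
  apply: continuous_mul; apply: continuous_chain; try exact: continuous_pospow.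
    exact: (@continuous_subr _ R^o).
  by move=> s; apply: cvgB; [exact: cvg_cst|exact: cvg_id].
have th0 s : s <= r0 ^+ 2 -> th s = 0.
  by move=> hs; rewrite /th pospow0 ?mul0r// subr_le0.
have th1 s : s1 <= s -> th s = 0.
  by move=> hs; rewrite /th mulrC pospow0 ?mul0r// subr_le0.
have thge0 s : 0 <= th s by rewrite mulr_ge0 ?pospow_ge0.
have thy : 0 < th (e ^+ 2).
  have h1 : 0 < e ^+ 2 - r0 ^+ 2.
    by rewrite subr_gt0 ltrXn2r// ?nnegrE ?(ltW r00) ?(ltW e0).
  have h2 : 0 < s1 - e ^+ 2 by rewrite /s1; lra.
  by rewrite /th mulr_gt0// pospowE ?expr1// ltW.
(* [|x - y|^2 <= 2 |x|^2 + 2 |y|^2 <= Q] on the support of [th], so the kernel takes values in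
   [[0, 1]] there. *)
pose Q := 2 * s1 + 2 * e ^+ 2.
have Q2 : 2 <= Q.
  have : 0 <= e ^+ 2 by rewrite exprn_ge0// ltW.
  by rewrite /Q /s1; lra.
have Q0 : 0 < Q by lra.
pose Ker (x : 'rV[R]_n) : R := 1 - sqn (x - y) / Q.
have sqnB (x : 'rV[R]_n) : sqn (x - y) = sqn x + e ^+ 2 - 2 * dot y x.
  rewrite sqr_enorm sqnD -[- y]scaleN1r.
  have -> : sqn (-1 *: y) = sqn y by apply: eq_bigr => i _; rewrite !mxE; ring.
  have -> : dot x (-1 *: y) = - dot y x.
    by rewrite /dot -sumrN; apply: eq_bigr => i _; rewrite !mxE; ring.
  by ring.
pose a (s : R) : R := 1 - (s + e ^+ 2) / Q.
have ca : continuous a.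
  move=> s; apply: cvgB; first exact: cvg_cst.
  by apply: cvgM; [apply: cvgD; [exact: cvg_id|exact: cvg_cst]|exact: cvg_cst].
have KE x : Ker x = a (sqn x) + 2 / Q * dot y x.
  by rewrite /Ker /a sqnB; ring.
(* The binomial formula turns [Ker^N] into a polynomial in [y.x] whose coefficients depend on
   [|x|^2] alone: each term is a vanishing moment. *)
have JK N : intN (fun x => u x * (th (sqn x) * Ker x ^+ N)) = 0.
  pose Fj (j : 'I_N.+1) (s : R) : R := 'C(N, j)%:R * ((2 / Q) ^+ j * a s ^+ (N - j)) * th s.
  have cFj j : continuous (Fj j).
    apply: continuous_mul => //; apply: continuous_mul; first exact: cst_continuous.
    by apply: continuous_mul; [exact: cst_continuous|exact: continuous_pow].
  have Fj0 j s : s <= r0 ^+ 2 -> Fj j s = 0 by move=> /th0 h; rewrite /Fj h mulr0.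
  have Fj1 j s : s1 <= s -> Fj j s = 0 by move=> /th1 h; rewrite /Fj h mulr0.
  rewrite (_ : (fun x => _) = (fun x => \sum_(j < N.+1) u x * (dot y x ^+ j * Fj j (sqn x)))).
    rewrite intN_sum; first (rewrite big1 // => j _; have V := vanishing_all j y R0r0 (cFj j)
      (Fj0 j) (Fj1 j); exact: V).
    move=> j; apply: (ccont_mul_on cu).
      apply: ccontMl; first by apply: continuous_pow; exact: continuous_dot.
      have := @ccont_radial R n 0 (Fj j) s1 (cFj j) (Fj1 j).
      by under eq_fun do rewrite subr0.
    move=> x; have [xR0|xR0] := ltP R0 (enorm x); [by left|right].
    apply: filterS (near_enorm_lt (le_lt_trans xR0 R0r0)) => w /ltW wr0.
    by rewrite Fj0 ?mulr0// -sqr_enorm lerXn2r ?nnegrE ?enorm_ge0// ltW.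
  apply/funext => x; rewrite -mulr_sumr; congr (_ * _).
  rewrite KE exprDn mulr_sumr; apply: eq_bigr => j _.
  by rewrite /Fj exprMn -mulr_natl; ring.
(* The factor [u y] fixes the sign: [w y = (u y)^2 th (|y|^2) > 0]. *)
pose w (x : 'rV[R]_n) : R := u y * (u x * th (sqn x)).
have ccth : ccont (fun x : 'rV[R]_n => th (sqn x)).
  have := @ccont_radial R n 0 th s1 cth th1.
  by under eq_fun do rewrite subr0.
have ccw : ccont w.
  apply: ccontZ; apply: (ccont_mul_on cu) => // x.
  have [xR0|xR0] := ltP R0 (enorm x); [by left|right].
  apply: filterS (near_enorm_lt (le_lt_trans xR0 R0r0)) => z /ltW zr0.
  by rewrite th0// -sqr_enorm lerXn2r ?nnegrE ?enorm_ge0// ltW.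
pose m := w y / 2.
have wy0 : 0 < w y.
  rewrite /w -sqr_enorm mulrA mulr_gt0//.
  by rewrite lt_neqAle eq_sym -expr2 sqrf_eq0 uyn0 sqr_ge0.
have m0 : 0 < m by rewrite divr_gt0.
have wy : \near y, m <= w y.
  have [cw _] := ccw.
  have hm : nbhs (w y) [set t | m < t].
    by apply: lt_nbhsr; rewrite /m ltr_pdivrMr// ltr_pMr// ltr1n.
  have hw : nbhs y [set z | m < w z] by exact: (cw y _ hm).
  by apply: filterS hw => z /= /ltW.
have [d /andP[d0 d1] hd] := near_norm_le wy.
have [B B0 wB] := ccont_bounded ccw.
(* [q] bounds the kernel from above at distance more than [d] from [y]; [q'] bounds it from below at
   Euclidean distance at most [d/2]. *)
pose q := 1 - d ^+ 2 / Q.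
pose q' := 1 - d ^+ 2 / 4 / Q.
have d20 : 0 < d ^+ 2 by rewrite exprn_gt0.
have q'0 : 0 < q'.
  rewrite /q' subr_gt0 ltr_pdivrMr// mul1r.
  have : d ^+ 2 <= 1 by rewrite exprn_ile1// ltW.
  by lra.
have q0 : 0 <= q.
  rewrite /q subr_ge0 ler_pdivrMr// mul1r.
  have : d ^+ 2 <= 1 by rewrite exprn_ile1// ltW.
  by lra.
have qq' : q < q'.
  rewrite /q /q' ltrD2l ltrN2 ltr_pM2r ?invr_gt0//; lra.
(* The cube of radius [eta] lies within Euclidean distance [d/2] of [y], as [n eta^2 <= d^2/4]. *)
pose eta := d / 2 / (n%:R + 1).
have n0 : 0 <= n%:R :> R by [].
have eta0 : 0 < eta by rewrite !divr_gt0// ltr_wpDl.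
(* A continuous function of compact support that is at least 1 for [0 <= s <= s1], in place of an
   indicator. *)
pose kf (s : R) : R := pospow 1 (2 - s / s1).
have ckf : continuous kf.
  apply: continuous_chain; first exact: continuous_pospow.
  move=> s; apply: cvgB; first exact: cvg_cst.
  by apply: cvgM; [exact: cvg_id|exact: cvg_cst].
have cckf : ccont (fun x : 'rV[R]_n => kf (sqn x)).
  have kf0 s : 2 * s1 <= s -> kf s = 0.
    by move=> hs; rewrite /kf pospow0// subr_le0 ler_pdivlMr.
  have := @ccont_radial R n 0 kf (2 * s1) ckf kf0.
  by under eq_fun do rewrite subr0.
have kf1 s : s <= s1 -> 1 <= kf s.
  move=> hs; have h1 : 1 <= 2 - s / s1.
    have : s / s1 <= 1 by rewrite ler_pdivrMr// mul1r.
    by lra.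
  by rewrite /kf pospowE ?expr1//; lra.
have Ker01 x : sqn x <= s1 -> 0 <= Ker x <= 1.
  move=> hx; rewrite /Ker gerBl divr_ge0 ?sqn_ge0 ?(ltW Q0)// andbT.
  rewrite subr_ge0 ler_pdivrMr// mul1r.
  have : sqn (x - y) + sqn (x + y) = 2 * sqn x + 2 * e ^+ 2.
    by rewrite sqnB sqnD dotC sqr_enorm; ring.
  by have := sqn_ge0 (x + y); rewrite /Q; lra.
have w0 x : s1 < sqn x -> w x = 0.
  by move=> hx; rewrite /w th1 ?mulr0// ltW.
(* Adding [B q^N kf] makes the integrand [w Ker^N] nonnegative everywhere and keeps it above
   [m q'^N] near [y]. As the integral of [w Ker^N] is zero, [q'^N] is bounded by a constant times
   [q^N] for all [N], which [q < q'] forbids. *)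
have main N : m * (2 * eta) ^+ n * q' ^+ N <= B * intN (fun x : 'rV[R]_n => kf (sqn x)) * q
  ^+ N.
  have cK : continuous (fun x => Ker x ^+ N).
    apply: continuous_pow; rewrite (funext KE); apply: continuous_add.
      exact: (continuous_chain ca (@continuous_sqn R n)).
    by apply: continuous_mul; [exact: cst_continuous|exact: continuous_dot].
  have c1 : ccont (fun x => w x * Ker x ^+ N) by exact: ccontMr.
  have c2 : ccont (fun x : 'rV[R]_n => B * q ^+ N * kf (sqn x)) by exact: (ccontZ (B * q ^+
    N) cckf).
  have : m * q' ^+ N * (2 * eta) ^+ n <= intN (fun x => w x * Ker x ^+ N + B * q ^+ N * kf
    (sqn x)).
    apply: (@intN_box_lower _ _ _ _ _ y).
    - exact: ccontD.
    - by rewrite mulr_ge0 ?exprn_ge0// ltW.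
    - exact: ltW.
    - move=> x; have [xs1|xs1] := leP (sqn x) s1; last first.
        by rewrite w0// mul0r add0r mulr_ge0 ?pospow_ge0// mulr_ge0// exprn_ge0.
      have /andP[K0 K1] := Ker01 x xs1.
      have [xd|xd] := leP `|x - y| d.
        rewrite addr_ge0//.
          by rewrite mulr_ge0 ?exprn_ge0// (le_trans (ltW m0))// hd.
        by rewrite mulr_ge0 ?pospow_ge0// mulr_ge0// exprn_ge0.
      have h1 : `|w x * Ker x ^+ N| <= B * q ^+ N.
        rewrite normrM normrX (ger0_norm K0) ler_pM ?exprn_ge0//.
        rewrite lerXn2r ?nnegrE// /Ker /q lerD2l lerN2 ler_wpM2r ?invr_ge0 ?(ltW Q0)//.
        apply: le_trans (normr_le_sqn _).
        by rewrite lerXn2r ?nnegrE ?(ltW d0) ?(ltW xd).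
      have h2 : B * q ^+ N <= B * q ^+ N * kf (sqn x).
        by rewrite ler_peMr ?kf1// mulr_ge0// exprn_ge0.
      by move: h1; rewrite ler_norml => /andP[]; lra.
    - move=> x xeta.
      have xd : `|x - y| <= d.
        apply: (le_trans xeta); rewrite /eta ler_pdivrMr ?ltr_wpDl//.
        have : 0 <= d * n%:R by rewrite mulr_ge0// ltW.
        by lra.
      have mw := hd x xd.
      have xs1 : sqn x <= s1.
        rewrite leNgt; apply/negP => /w0 wx0; move: mw; rewrite wx0; lra.
      have /andP[K0 K1] := Ker01 x xs1.
      apply: le_trans (_ : w x * Ker x ^+ N <= _); last first.
        by rewrite lerDl mulr_ge0 ?pospow_ge0// mulr_ge0// exprn_ge0.
      rewrite ler_pM ?exprn_ge0 ?(ltW m0) ?(ltW q'0)//.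
      rewrite lerXn2r ?nnegrE ?(ltW q'0)// /q' /Ker lerD2l lerN2 ler_wpM2r ?invr_ge0 ?(ltW
        Q0)//.
      apply: le_trans (sqn_le_normr xeta) _.
      rewrite /eta expr_div_n expr_div_n mulrCA -[leRHS]mulr1.
      rewrite (_ : (2 : R) ^+ 2 = 4); last by rewrite -natrX.
      rewrite ler_pM2l; last by rewrite divr_gt0.
      rewrite ler_pdivrMr ?exprn_gt0 ?ltr_wpDl// mul1r.
      have : 0 <= n%:R * n%:R :> R by rewrite mulr_ge0.
      by rewrite expr2; lra.
  rewrite intND// intNZ// (_ : intN (fun x => w x * Ker x ^+ N) = 0) ?add0r; last first.
    transitivity (intN (fun x => u y * (u x * (th (sqn x) * Ker x ^+ N)))).
      by congr intN; apply/funext => x; rewrite /w; ring.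
    rewrite intNZ ?JK ?mulr0//.
    have := ccontZ (u y)^-1 c1.
    by congr ccont; apply/funext => x; rewrite /w; field.
  by move=> h; apply: le_trans (_ : m * q' ^+ N * (2 * eta) ^+ n <= _); [lra|apply: le_trans
    h _; lra].
pose A := m * (2 * eta) ^+ n.
have A0 : 0 < A by rewrite mulr_gt0// exprn_gt0// mulr_gt0.
pose t := q / q'.
have t1 : `|t| < 1.
  by rewrite ger0_norm ?divr_ge0 ?(ltW q'0)// ltr_pdivrMr// mul1r.
have ctN : (B * intN (fun x : 'rV[R]_n => kf (sqn x))) * t ^+ N @[N --> \oo] --> (0 : R).
  rewrite -[X in _ --> X](mulr0 (B * intN (fun x : 'rV[R]_n => kf (sqn x)))).
  by apply: cvgM; [exact: cvg_cst|exact: cvg_expr].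
have : \forall N \near \oo, (B * intN (fun x : 'rV[R]_n => kf (sqn x))) * t ^+ N < A.
  exact: (cvgr_lt 0).
move=> [N _ /(_ N (leqnn N)) /=]; apply/negP; rewrite -leNgt.
rewrite /t expr_div_n mulrA ler_pdivlMr ?exprn_gt0//.
Qed.

End Rellich.

(** * Boundedness at infinity when p < 1 *)

Section LocalBound.
Context {R : realType} {n : nat}.

Let bump (s : R) : R := pospow 3 (1 - s).

(* The right-hand side is -t^(1-n) times the Laplacian, at |z-x|^2 = s, of the radial
   function z |-> -(1 - |z-x|^2/t^2)_+^4 / 8. *)
Lemma is_derive_kernel (s t : R) : 0 < t ->
  is_derive t 1 (fun t : R => t^-1 ^+ n * bump (s * (t^-1 * t^-1)))
   (- (t * t^-1 ^+ n) * (4 * s * (- (3 / 2) * (t^-1 ^+ 4 * pospow 2 (1 - s * (t^-1 * t^-1))))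
      + 2 * n%:R * (2^-1 * (t^-1 ^+ 2 * bump (s * (t^-1 * t^-1)))))).
Proof.
move=> t0; have tn0 : t != 0 by rewrite gt_eqF.
pose V (t : R) : R := t^-1.
have dV : is_derive t 1 V (- (V t * V t)).
  split; first exact: (@derivableV _ _ id).
  by rewrite (@deriveV _ _ id)// derive_id -[_ *: _]/(_ * _) mulr1 /V -expr2 exprVn.
have dW : is_derive t 1 (fun t : R => 1 - s * (V t * V t)) (2 * s * (V t * (V t * V t))).
  apply: (is_derive_eq (is_derive_funB (is_derive_cst (1 : R) t 1) (is_derive_funZ s
    (is_derive_funM dV dV)))).
  by rewrite /=; ring.
have dg : is_derive t 1 (fun t : R => pospow 3 (1 - s * (V t * V t)))
    (3 * pospow 2 (1 - s * (V t * V t)) * (2 * s * (V t * (V t * V t)))).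
  exact: (is_derive_chain (g := fun t : R => 1 - s * (V t * V t)) (is_derive_pospow 1 _) dW).
apply: (is_derive_eq (is_derive_funM (is_derive_funX n dV) dg)).
have tV : t * V t = 1 by rewrite /V mulfV.
have nV : n%:R * V t ^+ n.-1 * V t = n%:R * V t ^+ n.
  by case: (n) => [|m]; rewrite ?mul0r// exprSr mulrA.
rewrite /bump -/(V t).
move: (pospow 2 _) (pospow 3 _) => a b.
have -> : n%:R * V t ^+ n.-1 * - (V t * V t) = - (n%:R * V t ^+ n * V t).
  by rewrite -nV; ring.
have -> : - (t * V t ^+ n) * (4 * s * (- (3 / 2) * (V t ^+ 4 * a)) + 2 * n%:R * (2^-1 * (V t
  ^+ 2 * b)))
  = (t * V t) * (6 * s * V t ^+ n * V t ^+ 3 * a - n%:R * V t ^+ n * V t * b) by field.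
by rewrite tV; ring.
Qed.

Lemma continuous_bump : continuous bump.
Proof.
apply: continuous_chain; first exact: continuous_pospow.
by move=> s; apply: cvgB; [exact: cvg_cst|exact: cvg_id].
Qed.

Lemma bump_ge0 s : 0 <= bump s.
Proof. exact: pospow_ge0. Qed.

Lemma bump_le1 s : 0 <= s -> bump s <= 1.
Proof. by move=> s0; rewrite /bump pospow_le1// gerBl. Qed.

Lemma bump_eq0 s : 1 <= s -> bump s = 0.
Proof. by move=> s1; rewrite /bump pospow0// subr_le0. Qed.

(** The maximum norm gives only [sqn (z - x) <= n]; the generous threshold absorbs this through
    [|x|^2 <= 2 |z|^2 + 2 |z - x|^2]. *)
Lemma exterior_unit_box (r : R) (x z : 'rV[R]_n) : 0 <= r ->
  2 * (n%:R + r + 1) < enorm x -> `|z - x| <= 1 -> exterior r z.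
Proof.
move=> r0 hx zx.
have n0 : 0 <= n%:R :> R by [].
have h1 : sqn (z - x) <= n%:R.
  by have := sqn_le_normr zx; rewrite expr1n mulr1.
have h2 : sqn x <= 2 * sqn z + 2 * sqn (z - x).
  rewrite /sqn !mulr_sumr -big_split /=; apply: ler_sum => i _; rewrite !mxE.
  have := sqr_ge0 (2 * z ord0 i - x ord0 i); rewrite !expr2; lra.
have h3 : (2 * (n%:R + r + 1)) ^+ 2 < sqn x.
  by rewrite -sqr_enorm ltrXn2r// ?nnegrE ?enorm_ge0// mulr_ge0// !addr_ge0.
have h4 : r ^+ 2 < sqn z.
  have : 0 <= n%:R * r :> R by rewrite mulr_ge0.
  have : 0 <= n%:R * n%:R :> R by rewrite mulr_ge0.
  have : 0 <= r * r by rewrite mulr_ge0.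
  by move: h3; rewrite !expr2; lra.
rewrite /exterior /= ltNge; apply/negP => h5.
move: h4; apply/negP; rewrite -leNgt -sqr_enorm.
by rewrite lerXn2r ?nnegrE ?enorm_ge0.
Qed.

Context (u : 'rV[R]_n -> R) (du ddu : 'I_n -> 'rV[R]_n -> R) (lam R0 : R).
Context (lam0 : 0 <= lam).
Context (cu : forall x, exterior R0 x -> {for x, continuous u}).
Context (cdu : forall x i, exterior R0 x -> {for x, continuous (du i)}).
Context (cddu : forall x i, exterior R0 x -> {for x, continuous (ddu i)}).
Context (hu : forall x i, exterior R0 x -> is_derive x (delta_mx ord0 i) u (du i x)).
Context (hdu : forall x i, exterior R0 x -> is_derive x (delta_mx ord0 i) (du i) (ddu i x)).
Context (hlap : forall x, exterior R0 x -> \sum_i ddu i x = - lam * u x).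

Section Ball.
Context (x : 'rV[R]_n) (t1 S : R) (t10 : 0 < t1).
Context (ball_ext : forall z, sqn (z - x) <= t1 ^+ 2 -> exterior R0 z).
Context (uS : forall z, sqn (z - x) <= t1 ^+ 2 -> `|u z| <= S).

(** An unnormalised weighted mean of [u] over the ball of radius [t]; as [t] tends to 0 it
    approaches [u x] times the integral of [bump (|z|^2)]. *)
Let H (t : R) : R := intN (fun z => t^-1 ^+ n * (u z * bump (sqn (z - x) * (t^-1 * t^-1)))).

Lemma ccont_ball (F : R -> R) (t : R) : 0 < t <= t1 -> continuous F ->
  (forall s, t ^+ 2 <= s -> F s = 0) -> ccont (fun z => u z * F (sqn (z - x))).
Proof.
move=> /andP[t0 tt1] cF F0; apply: (ccont_mul_on cu); first exact: (ccont_radial x cF F0).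
move=> z; have [zt|tz] := leP (sqn (z - x)) (t1 ^+ 2); first by left; exact: ball_ext.
right; apply: filterS (near_sqnB_gt tz) => w /= /ltW hw; apply: F0; apply: le_trans hw.
by rewrite lerXn2r ?nnegrE ?(ltW t0) ?(ltW t10).
Qed.

Lemma rescale_ge1 (t s : R) : 0 < t -> (1 <= s * (t^-1 * t^-1)) = (t ^+ 2 <= s).
Proof.
by move=> t0; rewrite -invfM -expr2 ler_pdivlMr ?exprn_gt0// mul1r.
Qed.

Lemma continuous_scale (t : R) : continuous (fun s : R => s * (t^-1 * t^-1)).
Proof. by move=> s; apply: cvgM; [exact: cvg_id|exact: cvg_cst]. Qed.

(** [green_radial] with [k = 0] and the test function [- (1 - |z-x|^2/t^2)_+^4 / 8], whose Laplacian
    is, up to a factor depending on [t], the [t]-derivative of the kernel of [H]. *)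
Lemma green_ball (t : R) : 0 < t <= t1 ->
  intN (fun z => u z * (4 * sqn (z - x) * (- (3 / 2) * (t^-1 ^+ 4 * pospow 2 (1 - sqn (z - x)
    * (t^-1 * t^-1))))
      + 2 * n%:R * (2^-1 * (t^-1 ^+ 2 * bump (sqn (z - x) * (t^-1 * t^-1)))))) =
  lam * intN (fun z => u z * (8^-1 * pospow 4 (1 - sqn (z - x) * (t^-1 * t^-1)))).
Proof.
move=> tt1; have /andP[t0 _] := tt1.
pose v := t^-1 * t^-1.
pose F (s : R) : R := - 8^-1 * pospow 4 (1 - s * v).
pose F1 (s : R) : R := 2^-1 * (t^-1 ^+ 2 * pospow 3 (1 - s * v)).
pose F2 (s : R) : R := - (3 / 2) * (t^-1 ^+ 4 * pospow 2 (1 - s * v)).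
have dW (s : R) : is_derive s 1 (fun s : R => 1 - s * v) (- v).
  apply: (is_derive_eq (is_derive_funB (is_derive_cst (1 : R) s 1)
    (is_derive_funM (is_derive_id s 1) (is_derive_cst v s 1)))).
  by rewrite /=; ring.
have hF (s : R) : is_derive s 1 F (F1 s).
  apply: (is_derive_eq (is_derive_funZ (- 8^-1) (is_derive_chain (g := fun s : R => 1 - s * v)
    (is_derive_pospow 2 _) (dW s)))).
  by rewrite /F1 /v; field; rewrite gt_eqF.
have hF1 (s : R) : is_derive s 1 F1 (F2 s).
  apply: (is_derive_eq (is_derive_funZ 2^-1 (is_derive_funZ (t^-1 ^+ 2) (is_derive_chain
    (g := fun s : R => 1 - s * v) (is_derive_pospow 1 _) (dW s))))).
  by rewrite /F2 /v; field; rewrite gt_eqF.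
have cpp k : continuous (fun s : R => pospow k (1 - s * v)).
  apply: continuous_chain; first exact: continuous_pospow.
  move=> s; exact: (is_derive_continuous (dW s)).
have cF2 : continuous F2.
  apply: continuous_mul; first exact: cst_continuous.
  by apply: continuous_mul; [exact: cst_continuous|exact: cpp].
have pp0 k s : t ^+ 2 <= s -> pospow k.+1 (1 - s * v) = 0.
  by rewrite -(rescale_ge1 s t0) => hs; rewrite pospow0// subr_le0.
have F0 s : t ^+ 2 <= s -> [/\ F s = 0, F1 s = 0 & F2 s = 0].
  by move=> hs; rewrite /F /F1 /F2 !pp0// !mulr0.
have AF z : exterior R0 z \/ \near z, F (sqn (z - x)) = 0.
  have [zt|tz] := leP (sqn (z - x)) (t1 ^+ 2); first by left; exact: ball_ext.
  right; apply: filterS (near_sqnB_gt tz) => w /= /ltW hw; have [] // := F0 (sqn (w - x));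
    apply: le_trans hw.
  by move/andP: tt1 => [_ tt1]; rewrite lerXn2r ?nnegrE ?(ltW t0) ?(ltW t10).
have := green_radial 0 0 cu cdu cddu hu hdu hlap hF hF1 cF2 F0 AF.
rewrite (_ : (fun z => _) = (fun z => u z * (4 * sqn (z - x) * F2 (sqn (z - x))
   + 2 * n%:R * F1 (sqn (z - x))) - lam * (u z * (8^-1 * pospow 4 (1 - sqn (z - x) * v)))));
     last first.
  by apply/funext => z; rewrite /F mul0n mul0r; ring.
rewrite intNB; last 2 first.
- apply: (ccont_ball (F := fun s => 4 * s * F2 s + 2 * n%:R * F1 s) tt1).
    apply: continuous_add; apply: continuous_mul => //.
    + by apply: continuous_mul; [exact: cst_continuous|move=> s; exact: cvg_id].
    + exact: cst_continuous.
    + by move=> s; exact: (is_derive_continuous (hF1 s)).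
  by move=> s /F0[_ f1 f2]; rewrite f1 f2; ring.
- apply: ccontZ; apply: (ccont_ball (F := fun s => 8^-1 * pospow 4 (1 - s * v)) tt1).
    by apply: continuous_mul; [exact: cst_continuous|exact: cpp].
  by move=> s hs; rewrite pp0 ?mulr0.
rewrite intNZ; last first.
  apply: (ccont_ball (F := fun s => 8^-1 * pospow 4 (1 - s * v)) tt1).
    by apply: continuous_mul; [exact: cst_continuous|exact: cpp].
  by move=> s hs; rewrite pp0 ?mulr0.
by move=> /eqP; rewrite subr_eq0 => /eqP.
Qed.

(** The mean value property for the Helmholtz equation: differentiating the kernel in [t] produces a
    Laplacian, which Green's identity trades for [lam] times an average of [u]. The derivative is
    thus of order [t] and would vanish for a harmonic function. *)
Lemma derive_mean (t : R) : 0 < t < t1 ->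
  is_derive t 1 H (- (t * t^-1 ^+ n) * (lam *
     intN (fun z => u z * (8^-1 * pospow 4 (1 - sqn (z - x) * (t^-1 * t^-1)))))).
Proof.
move=> /andP[t0 tt1].
have S0 : 0 <= S.
  apply: le_trans (uS (z := x) _) => //.
  rewrite subrr (_ : sqn 0 = 0) ?exprn_ge0 ?(ltW t10)//.
  by rewrite /sqn big1// => i _; rewrite mxE expr0n.
pose d (t s : R) : R := - (t * t^-1 ^+ n) * (4 * s * (- (3 / 2) * (t^-1 ^+ 4 * pospow 2 (1 -
  s * (t^-1 * t^-1))))
      + 2 * n%:R * (2^-1 * (t^-1 ^+ 2 * bump (s * (t^-1 * t^-1))))).
pose f (t : R) (z : tupleR n) : R :=
  t^-1 ^+ n * (u (row_of_tuple z) * bump (sqn (row_of_tuple z - x) * (t^-1 * t^-1))).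
have df (z : tupleR n) (tau : R) : 0 < tau ->
    is_derive tau 1 (f ^~ z) (u (row_of_tuple z) * d tau (sqn (row_of_tuple z - x))).
  move=> tau0.
  apply: (is_derive_ext (f := fun tau : R => u (row_of_tuple z) *
    (tau^-1 ^+ n * bump (sqn (row_of_tuple z - x) * (tau^-1 * tau^-1))))).
    by move=> s; rewrite /f mulrCA.
  exact: (is_derive_funZ _ (is_derive_kernel _ tau0)).
have ccg (tau : R) : 0 < tau <= t1 ->
    ccont (fun z => u z * bump (sqn (z - x) * (tau^-1 * tau^-1))).
  move=> htau; apply: (ccont_ball (F := fun s => bump (s * (tau^-1 * tau^-1))) htau).
    by apply: continuous_chain; [exact: continuous_bump|exact: continuous_scale].
  by move=> s hs; rewrite bump_eq0// rescale_ge1//; case/andP: htau.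
have intf (tau : R) : [set` `]t / 2, t1[] tau ->
    (lebesgueN n).-integrable setT (EFin \o f tau).
  rewrite /= in_itv/= => /andP[h1 h2].
  have tau01 : 0 < tau <= t1.
    by rewrite (ltW h2) andbT; apply: lt_trans h1; rewrite divr_gt0.
  exact: (ccont_integrable (ccontZ _ (ccg tau tau01))).
have derf (tau : R) (z : tupleR n) : [set` `]t / 2, t1[] tau -> setT z ->
    derivable (f ^~ z) tau 1.
  rewrite /= in_itv/= => /andP[h1 h2] _.
  by have [] := df z tau (lt_trans (divr_gt0 t0 (ltr0Sn _ 1)) h1).
(* On []t/2, t1[], which stays away from 0, [w] bounds the inverse radius; [D] then dominates the
   derivative of the integrand, [6 t1^2 w^4] and [n w^2] coming from its two terms. *)
pose w := (t / 2)^-1.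
have w0 : 0 < w by rewrite invr_gt0 divr_gt0.
pose D := S * (t1 * w ^+ n * (6 * t1 ^+ 2 * w ^+ 4 + n%:R * w ^+ 2)).
have D0 : 0 <= D.
  apply: mulr_ge0 => //; apply: mulr_ge0.
    by apply: mulr_ge0; [exact: ltW|apply: exprn_ge0; exact: ltW].
  apply: addr_ge0; apply: mulr_ge0 => //; try (by apply: exprn_ge0; exact: ltW).
  by apply: mulr_ge0 => //; apply: exprn_ge0; exact: ltW.
have [I1 _] := Rintegral_indic_box D x (ltW t10).
have G0 z : 0 <= D * \1_(box x t1) z by rewrite mulr_ge0.
have Gub (tau : R) (z : tupleR n) : [set` `]t / 2, t1[] tau -> setT z ->
    `|partial1of2 f tau z| <= D * \1_(box x t1) z.
  rewrite /= in_itv/= => /andP[h1 h2] _.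
  have tau0 : 0 < tau by apply: lt_trans h1; rewrite divr_gt0.
  rewrite partial1of2E; have [_ ->] := df z tau tau0.
  pose s := sqn (row_of_tuple z - x); rewrite -/s.
  have s0 : 0 <= s by exact: sqn_ge0.
  have [hs|hs] := leP (tau ^+ 2) s.
    rewrite /d pospow0; last by rewrite subr_le0 rescale_ge1.
    by rewrite bump_eq0 ?rescale_ge1// !mulr0 addr0 !mulr0 normr0 G0.
  have hst : s <= t1 ^+ 2.
    by apply: ltW; apply: lt_trans hs _; rewrite ltrXn2r ?nnegrE ?(ltW tau0) ?(ltW t10).
  rewrite indicE mem_set ?mulr1; last first.
    apply/row_of_tuple_box; first exact: ltW.
    rewrite -(ler_pXn2r (_ : 0 < 2)%N)// ?nnegrE ?(ltW t10)//.
    exact: le_trans (normr_le_sqn _) hst.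
  rewrite normrM; apply: ler_pM => //; first exact: uS.
  have iw : tau^-1 <= w.
    by rewrite /w lef_pV2 ?posrE ?divr_gt0// ltW.
  have i0 : 0 <= tau^-1 by rewrite invr_ge0 ltW.
  have ik k : tau^-1 ^+ k <= w ^+ k by rewrite lerXn2r ?nnegrE// ltW.
  have v0 : 0 <= s * (tau^-1 * tau^-1) by rewrite mulr_ge0// mulr_ge0.
  have pp : 0 <= pospow 2 (1 - s * (tau^-1 * tau^-1)) <= 1.
    by rewrite pospow_ge0 pospow_le1// gerBl.
  have gg : 0 <= bump (s * (tau^-1 * tau^-1)) <= 1 by rewrite bump_ge0 bump_le1.
  rewrite /d normrM normrN; apply: ler_pM => //.
    rewrite normrM (gtr0_norm tau0) ger0_norm ?exprn_ge0//.
    by apply: ler_pM => //; [exact: ltW|exact: exprn_ge0|exact: ltW].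
  apply: le_trans (ler_normD _ _) _; apply: lerD.
    rewrite (_ : 4 * s * _ = - (6 * s * tau^-1 ^+ 4 * pospow 2 (1 - s * (tau^-1 * tau^-1))));
      last by field; rewrite gt_eqF.
    rewrite normrN ger0_norm; last first.
      case/andP: pp => pp0 _; apply: mulr_ge0 => //; apply: mulr_ge0; last exact: exprn_ge0.
      exact: mulr_ge0.
    case/andP: pp => pp0 pp1.
    rewrite -[leRHS]mulr1; apply: ler_pM => //.
      by apply: mulr_ge0; [exact: mulr_ge0|exact: exprn_ge0].
    apply: ler_pM => //; [exact: mulr_ge0|exact: exprn_ge0|].
    by rewrite ler_pM2l.
  rewrite (_ : 2 * n%:R * _ = n%:R * (tau^-1 ^+ 2 * bump (s * (tau^-1 * tau^-1)))); last by
    field; rewrite gt_eqF.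
  case/andP: gg => gg0 gg1.
  rewrite ger0_norm; last by apply: mulr_ge0 => //; apply: mulr_ge0 => //; exact: exprn_ge0.
  apply: ler_wpM2l => //; rewrite -[leRHS]mulr1; apply: ler_pM => //.
  exact: exprn_ge0.
have It : [set` `]t / 2, t1[] t.
  by rewrite /= in_itv/= tt1 andbT ltr_pdivrMr// ltr_pMr// ltr1n.
have dH := @derivable_under_integral R _ _ (lebesgueN n) f setT measurableT t (t / 2) t1
  It intf derf _ G0 I1 Gub.
have dHE := @differentiation_under_integral R _ _ (lebesgueN n) f setT measurableT t (t / 2) t1
  It intf derf _ G0 I1 Gub.
split; first exact: dH.
rewrite -derive1E [LHS]dHE.
rewrite -(green_ball (t := t)) ?t0 ?(ltW tt1)//.
rewrite -intNZ; last first.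
  apply: (ccont_ball (F := fun s => (4 * s * (- (3 / 2) * (t^-1 ^+ 4 * pospow 2 (1 - s *
    (t^-1 * t^-1))))
      + 2 * n%:R * (2^-1 * (t^-1 ^+ 2 * bump (s * (t^-1 * t^-1)))))) (t := t)).
  - by rewrite t0 ltW.
  - have cpp k : continuous (fun s : R => pospow k (1 - s * (t^-1 * t^-1))).
      apply: continuous_chain; first exact: continuous_pospow.
      by move=> s; apply: cvgB; [exact: cvg_cst|exact: continuous_scale].
    apply: continuous_add; apply: continuous_mul.
    + by apply: continuous_mul; [exact: cst_continuous|move=> s; exact: cvg_id].
    + apply: continuous_mul; first exact: cst_continuous.
      by apply: continuous_mul; [exact: cst_continuous|exact: cpp].
    + exact: cst_continuous.
    + apply: continuous_mul; first exact: cst_continuous.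
      by apply: continuous_mul; [exact: cst_continuous|exact: cpp].
  - move=> s hs; rewrite pospow0; last by rewrite subr_le0 rescale_ge1.
    by rewrite bump_eq0 ?rescale_ge1// !mulr0 addr0.
rewrite /intN; apply: eq_Rintegral => z _.
rewrite /partial1of2 derive1E; have [_ ->] := df z t t0.
by rewrite /d; ring.
Qed.

(** [H] is compared at [t] and at a tiny [e]: by [derive_mean] the two values differ by at most
    [lam S 2^n t^2], and near radius 0 the mean recovers [u x] times the mass of the bump, which is
    at least [8^-1 (n+1)^-n]. *)
Lemma local_estimate (t : R) : 0 < t < t1 ->
  8^-1 * (n%:R + 1)^-1 ^+ n * `|u x| <= `|H t| + lam * S * 2 ^+ n * t ^+ 2.
Proof.
move=> /andP[t0 tt1].
have x_in : sqn (x - x) <= t1 ^+ 2.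
  rewrite subrr (_ : sqn 0 = 0) ?exprn_ge0 ?(ltW t10)//.
  by rewrite /sqn big1// => i _; rewrite mxE expr0n.
have S0 : 0 <= S by exact: le_trans (uS x_in).
have far (z : 'rV[R]_n) (c : R) : 0 < c -> c < `|z - x| -> c ^+ 2 <= sqn (z - x).
  move=> c0 cz; apply: le_trans (normr_le_sqn _).
  by rewrite lerXn2r ?nnegrE ?(ltW c0)// ltW.
have nge0 : 0 <= n%:R :> R by [].
have N1 : 0 < n%:R + 1 :> R by rewrite ltr_wpDl.
apply/ler_addgt0Pr => om om0.
(* [u] will vary by at most [om'] on the cube of radius [e], whose volume [(2 e)^n] times the factor
   [e^-n] turns this into an error [om]. *)
pose om' := om / 2 ^+ n.
have om'0 : 0 < om' by rewrite divr_gt0// exprn_gt0.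
have [e0 /andP[e00 _] ue] : exists2 d, 0 < d <= 1 & forall z, `|z - x| <= d -> `|u z - u x|
  <= om'.
  apply: near_norm_le; have /cvgr_dist_le := cu (ball_ext x_in).
  by move=> /(_ _ om'0); apply: filterS => z; rewrite distrC.
pose e := Num.min e0 (t / 2).
have e_gt0 : 0 < e by rewrite lt_min e00 divr_gt0.
have e_t : e < t.
  by rewrite gt_min; apply/orP; right; rewrite ltr_pdivrMr// ltr_pMr// ltr1n.
have e_t1 : 0 < e <= t1 by rewrite e_gt0 (ltW (lt_trans e_t tt1)).
have ue' z : `|z - x| <= e -> `|u z - u x| <= om'.
  by move=> ze; apply: ue; apply: (le_trans ze); rewrite ge_min lexx.
have He : `|H e| <= `|H t| + lam * S * 2 ^+ n * t ^+ 2.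
  have dH c : e <= c -> c < t1 -> is_derive c 1 H (- (c * c^-1 ^+ n) * (lam *
     intN (fun z => u z * (8^-1 * pospow 4 (1 - sqn (z - x) * (c^-1 * c^-1)))))).
    by move=> ec ct; apply: derive_mean; rewrite ct (lt_le_trans e_gt0).
  have [||c] := @MVT R H (fun c => - (c * c^-1 ^+ n) * (lam *
     intN (fun z => u z * (8^-1 * pospow 4 (1 - sqn (z - x) * (c^-1 * c^-1)))))) e t e_t.
  - move=> c; rewrite in_itv/= => /andP[ec ct]; apply: dH; first exact: ltW.
    exact: lt_trans ct tt1.
  - apply: continuous_in_subspaceT => c; rewrite inE/= in_itv/= => /andP[ec ct].
    exact: (is_derive_continuous (dH c ec (le_lt_trans ct tt1))).
  rewrite in_itv/= => /andP[ec ct] E.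
  have c0 : 0 < c by exact: lt_trans ec.
  have Jb : `|intN (fun z => u z * (8^-1 * pospow 4 (1 - sqn (z - x) * (c^-1 * c^-1))))| <= S
    * (2 * c) ^+ n.
    have hc : 0 < c <= t1 by rewrite c0 (ltW (lt_trans ct tt1)).
    apply: (@intN_box_upper _ _ _ _ _ x) => //.
    - apply: (ccont_ball (F := fun s => 8^-1 * pospow 4 (1 - s * (c^-1 * c^-1))) hc).
        apply: continuous_mul; first exact: cst_continuous.
        apply: continuous_chain; first exact: continuous_pospow.
        by move=> s; apply: cvgB; [exact: cvg_cst|exact: continuous_scale].
      by move=> s hs; rewrite pospow0 ?mulr0// subr_le0 rescale_ge1.
    - exact: ltW.
    - move=> z; have [hz|hz] := leP (c ^+ 2) (sqn (z - x)).
        by rewrite pospow0 ?mulr0 ?normr0// subr_le0 rescale_ge1.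
      rewrite normrM -[leRHS]mulr1; apply: ler_pM => //.
        apply: uS; apply: ltW; apply: (lt_trans hz).
        by rewrite ltrXn2r ?nnegrE ?(ltW c0) ?(ltW t10) ?(lt_trans ct tt1).
      rewrite normrM ger0_norm ?invr_ge0// ger0_norm ?pospow_ge0//.
      have : pospow 4 (1 - sqn (z - x) * (c^-1 * c^-1)) <= 1.
        by apply: pospow_le1; rewrite gerBl mulr_ge0 ?sqn_ge0// mulr_ge0// invr_ge0 ltW.
      by have := pospow_ge0 4 (1 - sqn (z - x) * (c^-1 * c^-1)); lra.
    - by move=> z cz; have hz := far z c c0 cz; rewrite pospow0 ?mulr0// subr_le0 rescale_ge1.
  have -> : H e = H t - (H t - H e) by ring.
  rewrite E; apply: le_trans (ler_normB _ _) _; rewrite lerD2l.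
  rewrite !normrM normrN normrM (gtr0_norm c0) (ger0_norm lam0).
  rewrite (ger0_norm (_ : 0 <= t - e)) ?subr_ge0 ?(ltW e_t)//.
  rewrite ger0_norm ?exprn_ge0 ?invr_ge0 ?(ltW c0)//.
  apply: le_trans (_ : c * c^-1 ^+ n * (lam * (S * (2 * c) ^+ n)) * (t - e) <= _).
    rewrite ler_wpM2r ?subr_ge0 ?(ltW e_t)//.
    rewrite ler_wpM2l ?mulr_ge0 ?exprn_ge0 ?invr_ge0 ?(ltW c0)//.
    by rewrite ler_wpM2l.
  rewrite (_ : c * c^-1 ^+ n * (lam * (S * (2 * c) ^+ n)) * (t - e) =
     lam * S * 2 ^+ n * (c * (t - e)) * (c^-1 ^+ n * c ^+ n)); last by rewrite exprMn; ring.
  rewrite -exprMn mulVf ?gt_eqF// expr1n mulr1.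
  apply: ler_wpM2l; first by rewrite !mulr_ge0// exprn_ge0.
  rewrite expr2; apply: ler_pM; rewrite ?subr_ge0 ?(ltW c0) ?(ltW ct) ?(ltW e_t)//.
  by rewrite gerBl ltW.
pose gg (z : 'rV[R]_n) : R := bump (sqn (z - x) * (e^-1 * e^-1)).
have cg : continuous (fun s : R => bump (s * (e^-1 * e^-1))).
  by apply: continuous_chain; [exact: continuous_bump|exact: continuous_scale].
have g0 s : e ^+ 2 <= s -> bump (s * (e^-1 * e^-1)) = 0 by move=> hs; rewrite bump_eq0//
  rescale_ge1.
have ccgg : ccont gg by exact: (ccont_radial x cg g0).
have ccug : ccont (fun z => u z * gg z) by exact: (ccont_ball (F := fun s => bump (s * (e^-1
  * e^-1))) e_t1).
have v0 z : 0 <= sqn (z - x) * (e^-1 * e^-1).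
  by rewrite mulr_ge0 ?sqn_ge0// mulr_ge0// invr_ge0 ltW.
have i0 : 0 <= e^-1 ^+ n by rewrite exprn_ge0// invr_ge0 ltW.
(* The bump is at least [(1/2)^3] on the cube of radius [e / (2 (n+1))], of volume
   [(e / (n+1))^n]. *)
have Nlow : 8^-1 * (n%:R + 1)^-1 ^+ n <= e^-1 ^+ n * intN gg.
  pose eta := e / 2 / (n%:R + 1).
  have eta0 : 0 < eta by rewrite !divr_gt0.
  have : 8^-1 * (2 * eta) ^+ n <= intN gg.
    apply: (@intN_box_lower _ _ _ _ _ x) => //; first exact: ltW.
      by move=> z; exact: bump_ge0.
    move=> z zeta; rewrite /gg /bump.
    have hs : sqn (z - x) * (e^-1 * e^-1) <= 2^-1.
      rewrite -invfM -expr2 ler_pdivrMr ?exprn_gt0//.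
      apply: le_trans (sqn_le_normr zeta) _.
      rewrite (_ : n%:R * eta ^+ 2 = 4^-1 * (n%:R / (n%:R + 1) ^+ 2 * e ^+ 2)); last first.
        by rewrite /eta; field; rewrite gt_eqF.
      have e20 : 0 < e ^+ 2 by rewrite exprn_gt0.
      have : n%:R / (n%:R + 1) ^+ 2 <= 1 :> R.
        rewrite ler_pdivrMr ?exprn_gt0// mul1r expr2.
        have : 0 <= n%:R * n%:R :> R by rewrite mulr_ge0.
        by lra.
      have : 0 <= n%:R / (n%:R + 1) ^+ 2 :> R by rewrite divr_ge0// exprn_ge0// ltW.
      move: e20; move: (e ^+ 2) (n%:R / (n%:R + 1) ^+ 2) => a b a0 b0 b1.
      have : b * a <= 1 * a by rewrite ler_wpM2r// ltW.
      by lra.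
    rewrite pospowE; last by lra.
    apply: le_trans (_ : (2^-1) ^+ 3 <= _); first by rewrite exprVn -natrX.
    by rewrite lerXn2r ?nnegrE//; lra.
  rewrite -(ler_pM2l (_ : 0 < e^-1 ^+ n)); last by rewrite exprn_gt0// invr_gt0.
  apply: le_trans; rewrite le_eqVlt; apply/orP; left; apply/eqP.
  rewrite mulrCA -exprMn /eta; congr (_ * _ ^+ _); field.
  by rewrite !gt_eqF.
have HeE : H e = u x * (e^-1 ^+ n * intN gg) + e^-1 ^+ n * intN (fun z => u z * gg z - u x *
  gg z).
  rewrite /H intNZ// intNB//; last exact: ccontZ.
  by rewrite intNZ//; ring.
have err : `|intN (fun z => u z * gg z - u x * gg z)| <= om' * (2 * e) ^+ n.
  apply: (@intN_box_upper _ _ _ _ _ x).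
  - by apply: ccontB => //; exact: ccontZ.
  - exact: ltW.
  - exact: ltW.
  - move=> z; rewrite -mulrBl normrM.
    have [hz|hz] := leP `|z - x| e.
      rewrite -[leRHS]mulr1; apply: ler_pM => //; first exact: ue'.
      by rewrite ger0_norm ?bump_ge0// bump_le1.
    by rewrite /gg g0 ?normr0 ?mulr0 ?(ltW om'0)//; exact: far.
  - by move=> z hz; rewrite /gg g0 ?mulr0 ?subrr//; exact: far.
apply: le_trans (_ : e^-1 ^+ n * intN gg * `|u x| <= _); first by rewrite ler_wpM2r.
have -> : e^-1 ^+ n * intN gg * `|u x| = `|H e - e^-1 ^+ n * intN (fun z => u z * gg z - u x
  * gg z)|.
  rewrite HeE addrK normrM mulrC; congr (_ * _); rewrite ger0_norm//.
  by rewrite mulr_ge0// intN_ge0// => z; exact: bump_ge0.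
apply: le_trans (ler_normB _ _) _; apply: lerD He _.
rewrite normrM (ger0_norm i0).
apply: le_trans (ler_wpM2l i0 err) _.
have -> : e^-1 ^+ n * (om' * (2 * e) ^+ n) = om' * 2 ^+ n * (e^-1 ^+ n * e ^+ n).
  by rewrite exprMn [LHS]mulrCA -[RHS]mulrA; congr (_ * _); rewrite mulrCA.
rewrite -exprMn.
rewrite mulVf ?gt_eqF// expr1n mulr1 /om' divfK//.
Qed.

End Ball.

Lemma intN_le_powR (p r c : R) (F : 'rV[R]_n -> R) : R0 <= r -> 0 <= c -> ccont F ->
  (\int[lebesgueN n]_(t in (@row_of_tuple R n) @^-1` (exterior r))
    (`|u (row_of_tuple t)| `^ p)%:E < +oo)%E ->
  (forall z, exterior r z -> `|F z| <= c * `|u z| `^ p) ->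
  (forall z, ~ exterior r z -> F z = 0) ->
  `|intN F| <= c * fine (\int[lebesgueN n]_(t in (@row_of_tuple R n) @^-1` (exterior r))
    (`|u (row_of_tuple t)| `^ p)%:E).
Proof.
move=> R0r c0 cF uoo Fu F0.
set E := _ @^-1` _ in uoo *.
have mE : measurable E by exact: measurable_exterior.
pose f (t : tupleR n) : R := `|u (row_of_tuple t)| `^ p.
have mf : measurable_fun E f by exact: measurable_powR_exterior cu.
have I0 : (0 <= \int[lebesgueN n]_(t in E) (f t)%:E)%E.
  by apply: integral_ge0 => t _; rewrite lee_fin powR_ge0.
apply: le_trans (le_normr_intN cF (ccont_norm cF) (fun x => lexx _)) _.
rewrite -lee_fin EFinM [X in (_ <= _ * X)%E]fineK; last by rewrite (ge0_fin_numE I0); exact: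
  uoo.
rewrite /intN /Rintegral fineK; last first.
  by apply: integrable_fin_num => //; exact: (ccont_integrable (ccont_norm cF)).
rewrite -ge0_integralZl//; last exact/measurable_EFinP.
rewrite [leRHS]integral_mkcond; apply: ge0_le_integral => //.
- by apply/measurable_EFinP; apply: (measurable_cont (F := fun x => `|F x|)); case:
  (ccont_norm cF).
- apply/(measurable_restrictT _ mE); apply: measurable_funeM; exact/measurable_EFinP.
- move=> t _; rewrite patchE; case: ifPn => [|/negP tE].
    by rewrite inE => tE; rewrite -EFinM lee_fin; exact: Fu.
  by rewrite F0 ?normr0// => h; apply: tE; rewrite inE.
Qed.

(* At a maximiser zs of |u(z)| (1 - |z-x0|)^m, |u| is at most 2^m |u(zs)| on the ball of
   radius d = (1 - |zs-x0|)/2, so at a small multiple of d the error term of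
   local_estimate is absorbed by its left-hand side. *)
Lemma normr_le_powR_at_infinity (p r : R) : 0 < R0 -> R0 <= r -> 0 < p -> p < 1 ->
  (\int[lebesgueN n]_(t in (@row_of_tuple R n) @^-1` (exterior r))
    (`|u (row_of_tuple t)| `^ p)%:E < +oo)%E ->
  exists2 M, 0 <= M & forall x, 2 * (n%:R + r + 1) < enorm x -> `|u x| <= M * `|u x| `^ p.
Proof.
move=> R00 R0r p0 p1 uoo.
have n0 : 0 <= n%:R :> R by [].
have r0 : 0 <= r by apply: ltW; exact: lt_le_trans R0r.
pose I := fine (\int[lebesgueN n]_(t in (@row_of_tuple R n) @^-1` (exterior r))
    (`|u (row_of_tuple t)| `^ p)%:E)%E.
have I0 : 0 <= I.
  by apply: fine_ge0; apply: integral_ge0 => t _; rewrite lee_fin powR_ge0.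
(* With [n <= m p] the weight [(w^m)^p <= w^n] compensates the factor [t^-n] of an average over a
   ball of radius proportional to [w]. *)
pose m := (Num.truncn (n%:R / p)).+1.
have nm : n%:R <= m%:R * p by rewrite -ler_pdivrMr//; exact/ltW/truncnS_gt.
pose Q : R := 2 ^+ m.
have Q0 : 0 < Q by rewrite exprn_gt0.
pose N0 : R := 8^-1 * (n%:R + 1)^-1 ^+ n.
have N00 : 0 < N0 by rewrite mulr_gt0// exprn_gt0// invr_gt0 ltr_wpDl.
pose Lc := lam * 2 ^+ n * Q.
have Lc0 : 0 <= Lc by rewrite mulr_ge0 ?(ltW Q0)// mulr_ge0// exprn_ge0.
(* The radius will be [t = th d]. The second entry makes the error term at most half of the
   left-hand side of [local_estimate]; the first keeps [t] below [d]. *)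
pose th := Num.min 2^-1 (N0 / 2 / (Lc + 1)).
have th0 : 0 < th.
  by rewrite lt_min invr_gt0 ltr0Sn divr_gt0 ?divr_gt0// ltr_wpDl.
have th1 : th < 1 by rewrite gt_min invf_lt1// ltr1n.
have Lth : Lc * th ^+ 2 <= N0 / 2.
  apply: le_trans (_ : (Lc + 1) * th <= _).
    apply: ler_pM => //; [by rewrite exprn_ge0// ltW|by rewrite lerDl|].
    by rewrite expr2 ler_piMl// ltW.
  by rewrite mulrC -ler_pdivlMr ?ltr_wpDl// ge_min lexx orbT.
pose B := 2 / N0 * Q `^ (1 - p) * I * (2 / th) ^+ n.
have B0 : 0 <= B.
  apply: mulr_ge0; last by rewrite exprn_ge0// divr_ge0// ltW.
  by rewrite !mulr_ge0 ?powR_ge0// invr_ge0 ltW.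
(* Since [|u| = (|u|^p)^((1-p)/p) |u|^p], it suffices to bound [|u|^p] by [B]. The form
   [|u| <= M |u|^p] is what later turns p-integrability into integrability. *)
exists (B `^ ((1 - p) / p)); first exact: powR_ge0.
move=> x0 hx0.
have near_ext z : `|z - x0| <= 1 -> exterior r z by exact: exterior_unit_box.
have ext_R0 z : exterior r z -> exterior R0 z by exact: le_lt_trans.
have [->|ux0] := eqVneq (u x0) 0; first by rewrite normr0 mulr_ge0// powR_ge0.
have ux0_gt0 : 0 < `|u x0| by rewrite normr_gt0.
suff key : `|u x0| `^ p <= B.
  rewrite [leLHS](_ : _ = (`|u x0| `^ p) `^ ((1 - p) / p) * `|u x0| `^ p); last first.
    rewrite -powRrM mulrC (_ : p * _ = 1 - p); last by field; rewrite gt_eqF.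
    rewrite -powRD; last by rewrite (gt_eqF ux0_gt0) implybT.
    by rewrite addrC subrK powRr1.
  rewrite ler_wpM2r ?powR_ge0//; apply: ge0_ler_powR; rewrite ?nnegrE ?powR_ge0//.
  by rewrite divr_ge0 ?subr_ge0 ?(ltW p0) ?(ltW p1).
pose K := [set z : 'rV[R]_n | `|z - x0| <= 1].
have cnorm : continuous (fun z : 'rV[R]_n => `|z - x0|).
  move=> z; exact: (@continuous_comp _ _ _ (fun z : 'rV[R]_n => z - x0)
    (fun w : 'rV[R]_n => `|w|) z (@continuous_subr _ _ x0 z) (@norm_continuous _ _ (z - x0))).
have cK : compact K.
  apply: bounded_closed_compact.
    exists (1 + `|x0|); split; first exact: num_real.
    move=> M hM z /= zK; apply: le_trans (ltW hM).
    by rewrite -[z](subrK x0); apply: le_trans (ler_normD _ _) _; rewrite lerD2r.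
  apply: (@preimage_closed _ _ (fun z : 'rV[R]_n => `|z - x0|) [set y | y <= 1]).
    by move=> z _; exact: cnorm.
  exact: closed_le.
pose Psi (z : 'rV[R]_n) : R := `|u z| * (1 - `|z - x0|) ^+ m.
have [|||zs zsK hmax] := @EVT_max_rV R n Psi K.
- by exists x0; rewrite /K /= subrr normr0.
- exact: cK.
- apply: continuous_in_subspaceT => z; rewrite inE => zK.
  have cz : {for z, continuous u} by apply: cu; apply: ext_R0; exact: near_ext.
  have cw : continuous (fun z : 'rV[R]_n => (1 - `|z - x0|) ^+ m).
    apply: continuous_pow; apply: continuous_add; first exact: cst_continuous.
    under eq_fun do rewrite -mulN1r.
    by apply: continuous_mul; [exact: cst_continuous|exact: cnorm].
  exact: (cvgM (cvg_norm cz) (cw z)).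
have {zsK}zsK : `|zs - x0| <= 1 by move: zsK; rewrite inE.
pose us := `|u zs|; pose w := 1 - `|zs - x0|.
have w0 : 0 <= w by rewrite subr_ge0.
have w1 : w <= 1 by rewrite gerBl.
have x0max : `|u x0| <= us * w ^+ m.
  have := hmax x0; rewrite inE /K /Psi /= subrr normr0 subr0 expr1n mulr1; exact.
have wp : 0 < w.
  rewrite lt_neqAle eq_sym w0 andbT; apply/eqP => w_0.
  by move: x0max; rewrite w_0 expr0n /= mulr0 leNgt ux0_gt0.
have usp : 0 < us.
  rewrite lt_neqAle eq_sym normr_ge0 andbT; apply/eqP => us_0.
  by move: x0max; rewrite us_0 mul0r leNgt ux0_gt0.
pose d := w / 2.
have d0 : 0 < d by rewrite divr_gt0.
have in_ball z : `|z - zs| <= d -> `|z - x0| <= 1 - d.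
  move=> zd; rewrite (_ : z - x0 = (z - zs) + (zs - x0)); last by rewrite addrA subrK.
  apply: le_trans (ler_normD _ _) _; move: zd; rewrite /d /w; lra.
have ball_u z : `|z - zs| <= d -> `|u z| <= Q * us.
  move=> zd; have zx := in_ball z zd.
  have := hmax z; rewrite inE /K /= => h.
  have {}h : Psi z <= Psi zs by apply: h; move: zx d0; lra.
  have dm : 0 < d ^+ m by rewrite exprn_gt0.
  rewrite -(ler_pM2r dm).
  apply: le_trans (_ : Psi z <= _).
    rewrite ler_wpM2l// lerXn2r ?nnegrE ?(ltW d0)//; move: zx d0; lra.
  apply: le_trans h _; rewrite /Psi -/us -/w mulrAC -exprMn.
  by rewrite (_ : 2 * d = w) 1?mulrC// /d; field.
have ball_ext z : sqn (z - zs) <= d ^+ 2 -> `|z - zs| <= d.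
  move=> hz; rewrite -(ler_pXn2r (_ : 0 < 2)%N)// ?nnegrE ?(ltW d0)//.
  exact: le_trans (normr_le_sqn _) hz.
pose t := th * d.
have t0 : 0 < t by rewrite mulr_gt0.
have td : t < d by rewrite /t -[ltRHS]mul1r ltr_pM2r.
have d1 : d <= 1 by rewrite /d; lra.
have hyp1 z : sqn (z - zs) <= d ^+ 2 -> exterior r z.
  by move=> /ball_ext/in_ball hz; apply: near_ext; move: hz d0; lra.
have hyp1' z : sqn (z - zs) <= d ^+ 2 -> exterior R0 z by move=> /hyp1; exact: ext_R0.
have hyp2 z : sqn (z - zs) <= d ^+ 2 -> `|u z| <= Q * us by move=> /ball_ext; exact: ball_u.
have t0d : 0 < t < d by rewrite t0 td.
have est := local_estimate d0 hyp1' hyp2 t0d.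
pose F (z : 'rV[R]_n) : R := t^-1 ^+ n * (u z * pospow 3 (1 - sqn (z - zs) * (t^-1 * t^-1))).
have {}est : N0 / 2 * us <= `|intN F|.
  have h1 : lam * (Q * us) * 2 ^+ n * t ^+ 2 <= N0 / 2 * us.
    rewrite (_ : _ * t ^+ 2 = Lc * th ^+ 2 * d ^+ 2 * us); last by rewrite /Lc /t exprMn; ring.
    rewrite ler_wpM2r ?(ltW usp)//; apply: le_trans Lth.
    rewrite ler_piMr ?exprn_ile1 ?(ltW d0)//.
    by rewrite mulr_ge0// exprn_ge0// ltW.
  have h2 : N0 * us <= `|intN F| + lam * (Q * us) * 2 ^+ n * t ^+ 2 by exact: est.
  by lra.
have pp0 z : t ^+ 2 <= sqn (z - zs) -> pospow 3 (1 - sqn (z - zs) * (t^-1 * t^-1)) = 0.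
  by move=> hz; rewrite pospow0// subr_le0 rescale_ge1.
have small z : sqn (z - zs) < t ^+ 2 -> sqn (z - zs) <= d ^+ 2.
  move=> hz; apply: ltW; apply: lt_trans hz _.
  by rewrite ltrXn2r// ?nnegrE ?(ltW t0) ?(ltW d0).
have ti0 : 0 <= t^-1 ^+ n by rewrite exprn_ge0// invr_ge0 ltW.
have ccF : ccont F.
  apply: ccontZ; apply: (ccont_ball d0 hyp1' (F := fun s => pospow 3 (1 - s * (t^-1 * t^-1)))
    (t := t)).
  - by rewrite t0 ltW.
  - apply: continuous_chain; first exact: continuous_pospow.
    by move=> s; apply: cvgB; [exact: cvg_cst|exact: continuous_scale].
  - by move=> s hs; rewrite pospow0// subr_le0 rescale_ge1.
(* Writing [|u| = |u|^(1-p) |u|^p] and bounding the first factor by [(Q us)^(1-p)] leaves the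
   p-integral; dividing the estimate by [us^(1-p)] then bounds [us^p]. *)
have Fb : `|intN F| <= t^-1 ^+ n * (Q * us) `^ (1 - p) * I.
  apply: (intN_le_powR R0r _ ccF uoo).
  - by rewrite mulr_ge0// powR_ge0.
  - move=> z _; rewrite /F normrM (ger0_norm ti0) -mulrA ler_wpM2l//.
    have [hz|/small hz] := leP (t ^+ 2) (sqn (z - zs)).
      by rewrite pp0// mulr0 normr0 mulr_ge0// powR_ge0.
    rewrite normrM (ger0_norm (pospow_ge0 _ _)).
    apply: le_trans (_ : `|u z| <= _).
      rewrite ler_piMr// pospow_le1// gerBl mulr_ge0 ?sqn_ge0// mulr_ge0// invr_ge0 ltW//.
    have [->|uzn0] := eqVneq (u z) 0; first by rewrite normr0 mulr_ge0// powR_ge0.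
    have uzp : 0 < `|u z| by rewrite normr_gt0.
    apply: le_trans (_ : `|u z| `^ (1 - p) * `|u z| `^ p <= _).
      rewrite -powRD; last by rewrite (gt_eqF uzp) implybT.
      by rewrite subrK powRr1.
    rewrite ler_wpM2r ?powR_ge0//; apply: ge0_ler_powR; rewrite ?nnegrE//.
    + by rewrite subr_ge0 ltW.
    + by rewrite mulr_ge0 ?ltW.
    + exact: hyp2.
  - move=> z hz; rewrite /F pp0 ?mulr0// leNgt; apply/negP => /small/hyp1; exact: hz.
have us_le : us `^ p <= 2 / N0 * (t^-1 ^+ n * Q `^ (1 - p) * I).
  have up : 0 < us `^ (1 - p) by rewrite powR_gt0.
  have usE : us `^ (1 - p) * us `^ p = us.
    rewrite -powRD; last by rewrite (gt_eqF usp) implybT.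
    by rewrite subrK powRr1// ltW.
  rewrite -(ler_pM2l up) usE.
  have h : 2 / N0 * (N0 / 2 * us) <= 2 / N0 * (t^-1 ^+ n * (Q * us) `^ (1 - p) * I).
    by rewrite ler_pM2l ?divr_gt0//; exact: le_trans est Fb.
  move: h; rewrite powRM ?(ltW Q0) ?(ltW usp)//.
  rewrite (_ : 2 / N0 * (N0 / 2 * us) = us); last by field; rewrite gt_eqF.
  move=> /le_trans; apply; rewrite le_eqVlt; apply/orP; left; apply/eqP.
  by ring.
apply: le_trans (_ : (us * w ^+ m) `^ p <= _).
  by apply: ge0_ler_powR; rewrite ?nnegrE ?(ltW p0) ?mulr_ge0 ?exprn_ge0 ?(ltW usp).
rewrite powRM ?exprn_ge0 ?(ltW usp)//.
have wm : (w ^+ m) `^ p <= w ^+ n.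
  rewrite -powR_mulrn// -powRrM -powR_mulrn//.
  by apply: ger_powR => //; rewrite wp.
apply: le_trans (_ : 2 / N0 * (t^-1 ^+ n * Q `^ (1 - p) * I) * w ^+ n <= _).
  by apply: ler_pM; rewrite ?powR_ge0.
rewrite /B (_ : 2 / th = t^-1 * w); last first.
  by rewrite /t /d; field; rewrite !gt_eqF.
by rewrite exprMn le_eqVlt; apply/orP; left; apply/eqP; ring.
Qed.

End LocalBound.

(** * Reduction to real solutions and to exponents at least 1 *)

Section Reduction.
Context {R : realType} {n : nat}.

(** For [p < 1], the bound [|u| <= M |u|^p] far out makes [u] integrable on a smaller exterior
    domain, and [rellich] is applied with exponent 1, admissible as [beta <= n]. Its conclusion
    still covers the whole of [exterior R0], because integrability enters it only through the
    tail. *)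
Lemma helmholtz_component_eq0 (u : 'rV[R]_n -> R) (lam R0 p : R) : (2 <= n)%N ->
  0 < R0 -> 0 < lam -> Ck_on 2 (exterior R0) u ->
  (forall x, exterior R0 x -> \sum_(i < n) partial i (partial i u) x = - lam * u x) ->
  0 < p -> p <= 2 * n%:R / (n%:R - 1) ->
  (\int[lebesgueN n]_(t in (@row_of_tuple R n) @^-1` (exterior (R0 + 4)))
    (`|u (row_of_tuple t)| `^ p)%:E < +oo)%E ->
  forall x, exterior R0 x -> u x = 0.
Proof.
move=> n2 R00 lam0 [cu Cu] hlap p0 pn uoo.
pose du i := partial i u; pose ddu i := partial i (partial i u).
have cdu x i : exterior R0 x -> {for x, continuous (du i)}.
  by have [_ [h _]] := Cu i; exact: h.
have cddu x i : exterior R0 x -> {for x, continuous (ddu i)}.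
  by have [_ [_ /(_ i)[_ [h _]]]] := Cu i; exact: h.
have hu x i : exterior R0 x -> is_derive x (delta_mx ord0 i) u (du i x).
  by have [h _] := Cu i; move=> /h/derivableP.
have hdu x i : exterior R0 x -> is_derive x (delta_mx ord0 i) (du i) (ddu i x).
  by have [_ [_ /(_ i)[h _]]] := Cu i; move=> /h/derivableP.
pose om := Num.sqrt lam.
have om0 : 0 < om by rewrite sqrtr_gt0.
have omE : om ^+ 2 = lam by rewrite sqr_sqrtr// ltW.
have hlap' x : exterior R0 x -> \sum_i ddu i x = - om ^+ 2 * u x by rewrite omE; exact: hlap.
pose beta : R := (n%:R - 1) / 2.
have n1 : 2 <= n%:R :> R by rewrite (ler_nat _ 2).
have beta0 : 0 <= beta by rewrite /beta; lra.
have nE : n%:R = 1 + 2 * beta by rewrite /beta; lra.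
have bp : beta * p <= n%:R.
  have : p * (n%:R - 1) <= 2 * n%:R by rewrite -ler_pdivlMr//; lra.
  by rewrite /beta; lra.
have R04 : R0 <= R0 + 4 by lra.
have [p1|p1] := leP 1 p.
  exact: (rellich R00 om0 cu cdu cddu hu hdu hlap' R04 p1 beta0 nE bp uoo).
have [M M0 Mb] := normr_le_powR_at_infinity (ltW lam0) cu cdu cddu hu hdu hlap R00 R04 p0 p1
  uoo.
pose r := 2 * (n%:R + (R0 + 4) + 1).
have R0r : R0 <= r by rewrite /r; lra.
have b1 : beta * 1 <= n%:R by rewrite /beta; lra.
apply: (rellich R00 om0 cu cdu cddu hu hdu hlap' R0r (lexx 1) beta0 nE b1).
have mf := measurable_powR_exterior p R04 cu.
have sub : (@row_of_tuple R n) @^-1` (exterior r) `<=` (@row_of_tuple R n) @^-1` (exterior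
  (R0 + 4)).
  by move=> t; apply: le_lt_trans; rewrite /r; lra.
apply: le_lt_trans (_ : M%:E * \int[lebesgueN n]_(t in (@row_of_tuple R n) @^-1` (exterior
  (R0 + 4)))
    (`|u (row_of_tuple t)| `^ p)%:E < +oo)%E; last first.
  by rewrite lte_mul_pinfty.
rewrite -ge0_integralZl//; last 2 first.
- exact: measurable_exterior.
- exact/measurable_EFinP.
apply: le_trans (_ : \int[lebesgueN n]_(t in (@row_of_tuple R n) @^-1` (exterior r))
   (M%:E * (`|u (row_of_tuple t)| `^ p)%:E) <= _)%E.
  apply: ge0_le_integral => //.
  - exact: measurable_exterior.
  - by apply/measurable_EFinP; exact: measurable_powR_exterior cu.
  - apply: measurable_funeM; apply/measurable_EFinP; apply: measurable_powR_exterior cu => //.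
  - by move=> t rt; rewrite -EFinM lee_fin powRr1//; exact: Mb.
apply: ge0_subset_integral => //.
- exact: measurable_exterior.
- exact: measurable_exterior.
- by apply: measurable_funeM; apply/measurable_EFinP.
- by move=> t _; rewrite mule_ge0 ?lee_fin ?powR_ge0.
Qed.

End Reduction.

Theorem theorem1p1 (R : realType) (n : nat) (R0 lambda : R)
    (f : 'rV[R]_n -> complex R) (p : R) :
  (2 <= n)%N -> 0 < R0 -> 0 < lambda ->
  helmholtz_solution (exterior R0) lambda f ->
  0 < p -> p <= 2 * n%:R / (n%:R - 1) ->
  (\int[lebesgueN n]_(t in [set t | exterior (R0 + 4) (row_of_tuple t)])
     (Normc.normc (f (row_of_tuple t)) `^ p)%:E < +oo)%E ->
  forall x, exterior R0 x -> f x = 0.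
Proof.
move=> n2 R00 lam0 [[CRe CIm] hf] p0 pn foo x xR0.
have fE z : f z = Complex (complex.Re (f z)) (complex.Im (f z)) by case: (f z).
have nE z : Normc.normc (f z) = Num.sqrt (complex.Re (f z) ^+ 2 + complex.Im (f z) ^+ 2).
  by case: (f z).
have R04 : R0 <= R0 + 4 by lra.
have cRe z : exterior R0 z -> {for z, continuous (fun w => complex.Re (f w))} by case: CRe =>
  h _; exact: h.
have cIm z : exterior R0 z -> {for z, continuous (fun w => complex.Im (f w))} by case: CIm =>
  h _; exact: h.
(* The real and imaginary parts solve the same equation, [lambda] being real, and inherit
   p-integrability from the pointwise bound by the modulus. *)
have dom (u : 'rV[R]_n -> R) : (forall z, exterior R0 z -> {for z, continuous u}) ->
    (forall z, `|u z| <= Normc.normc (f z)) ->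
    (\int[lebesgueN n]_(t in (@row_of_tuple R n) @^-1` (exterior (R0 + 4)))
    (`|u (row_of_tuple t)| `^ p)%:E < +oo)%E.
  move=> cu uf; apply: le_lt_trans foo.
  apply: ge0_le_integral.
  - exact: measurable_exterior.
  - by move=> t _; rewrite lee_fin powR_ge0.
  - by apply/measurable_EFinP; exact: measurable_powR_exterior cu.
  - apply/measurable_EFinP; apply: (measurableT_comp (measurable_powR p)).
    rewrite (_ : (fun t => _) = (fun z => Num.sqrt (complex.Re (f z) ^+ 2 + complex.Im (f z)
      ^+ 2)) \o @row_of_tuple R n); last first.
      by apply/funext => t; rewrite /= nE.
    apply: measurable_fun_continuous_row; first exact: open_exterior.
    move=> z rz; have R0z : exterior R0 z by exact: le_lt_trans rz.
    apply: continuous_comp; last exact: sqrt_continuous.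
    exact: (cvgD (cvgM (cRe z R0z) (cRe z R0z)) (cvgM (cIm z R0z) (cIm z R0z))).
  - by move=> t _; rewrite lee_fin; apply: ge0_ler_powR; rewrite ?nnegrE ?(ltW p0)// nE
    sqrtr_ge0.
have ReD : {morph @complex.Re R : a b / a + b} by move=> [? ?] [? ?].
have ImD : {morph @complex.Im R : a b / a + b} by move=> [? ?] [? ?].
have ReM z : complex.Re (- lambda%:C%C * f z) = - lambda * complex.Re (f z).
  by case: (f z) => a b /=; rewrite oppr0 mul0r subr0.
have ImM z : complex.Im (- lambda%:C%C * f z) = - lambda * complex.Im (f z).
  by case: (f z) => a b /=; rewrite oppr0 mul0r addr0.
have Re0 : complex.Re (f x) = 0.
  have lap z : exterior R0 z ->
      \sum_(i < n) partial i (partial i (fun w => complex.Re (f w))) z =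
      - lambda * complex.Re (f z).
    by move=> /hf hz; rewrite -ReM -hz /laplacian (big_morph _ ReD erefl).
  have le z : `|complex.Re (f z)| <= Normc.normc (f z).
    by rewrite nE -sqrtr_sqr; apply: ler_wsqrtr; rewrite lerDl sqr_ge0.
  exact: (helmholtz_component_eq0 n2 R00 lam0 CRe lap p0 pn (dom _ cRe le) xR0).
have Im0 : complex.Im (f x) = 0.
  have lap z : exterior R0 z ->
      \sum_(i < n) partial i (partial i (fun w => complex.Im (f w))) z =
      - lambda * complex.Im (f z).
    by move=> /hf hz; rewrite -ImM -hz /laplacian (big_morph _ ImD erefl).
  have le z : `|complex.Im (f z)| <= Normc.normc (f z).
    by rewrite nE -sqrtr_sqr; apply: ler_wsqrtr; rewrite lerDr sqr_ge0.
  exact: (helmholtz_component_eq0 n2 R00 lam0 CIm lap p0 pn (dom _ cIm le) xR0).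
by rewrite fE Re0 Im0.
Qed.
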